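(* Let $d\ge1$ and let $D=2d$ be the real dimension of $\mathbb{CP}^d$. For every $M>0$ there exists a constant $C>0$, depending only on $d$ and $M$, such that for every integer $L\ge1$, if $x_1,\dots,x_N\in\mathbb{CP}^d$ are the $N=\binom{d+L}{d}$ points drawn from the projective ensemble, then with probability at least $1-N^{-M}$, $$\mathbb D(x_1,\dots,x_N)\le C\,\bigl(N^{1-1/D}\bigr)^{1/2}\sqrt{\log N}.$$
   Context: $\mathbb{CP}^d$ carries its Riemannian (Fubini--Study) distance, normalized so that $\cos\operatorname{dist}(p,q)=\bigl|\bigl\langle \tfrac{p}{\|p\|},\tfrac{q}{\|q\|}\bigr\rangle\bigr|$ (so the diameter is $\pi/2$), and its volume measure is normalized so that $\operatorname{vol}(\mathbb{CP}^d)=1$. Discrepancy: with $\mathcal A$ the set of all metric balls in $\mathbb{CP}^d$, $\mathbb D(x_1,\dots,x_N)=\sup_{A\in\mathcal A}\bigl|\#\{j: x_j\in A\}-N\operatorname{vol}(A)\bigr|$. A simple point process $\mathcal X$ of $N$ points on $\mathbb{CP}^d$ is a random $N$-point subset. Its joint intensities $\rho_k$ satisfy $\mathbb E\bigl(\prod_{i=1}^k\#(x\cap A_i)\bigr)=\int_{\prod A_i}\rho_k(y_1,\dots,y_k)\,dy_1\cdots dy_k$ for mutually disjoint measurable $A_i$, where $x$ is sampled from $\mathcal X$. It is a determinantal point process with kernel $K$ if $\rho_k(x_1,\dots,x_k)=\det(K(x_i,x_j))_{1\le i,j\le k}$ for all $k\ge1$. Projective ensemble: for $L\ge1$ and $N=\binom{d+L}{d}$,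 it is the determinantal point process of $N$ points on $\mathbb{CP}^d$ whose (projection) kernel satisfies $$\bigl|K_\star^{(N,d)}(p,q)\bigr|=N\,\Bigl|\Bigl\langle\frac{p}{\|p\|},\frac{q}{\|q\|}\Bigr\rangle\Bigr|^{L},$$ where on the right $p,q\in\mathbb C^{d+1}$ are affine representatives of the projective points. Explicitly, $K_\star^{(N,d)}(p,q)=N\bigl\langle\frac{p}{\|p\|},\frac{q}{\|q\|}\bigr\rangle^{L}$ with representatives $p=(1,z)$, $q=(1,w)$, $z,w\in\mathbb C^d$ (defined off a hyperplane of measure zero). *)

(* Defs.v *)
From HB Require Import structures.
From mathcomp Require Import all_boot all_order all_algebra.
From mathcomp Require Import finmap.
From mathcomp Require Import complex ring.
From mathcomp Require Import all_classical all_reals all_analysis.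
From mathcomp Require Import measurable_realfun.

Set Implicit Arguments.
Unset Strict Implicit.
Unset Printing Implicit Defensive.

Import Order.TTheory GRing.Theory Num.Theory.
Import numFieldNormedType.Exports.

Local Open Scope classical_set_scope.
Local Open Scope ring_scope.

Section sigma_finite_product.
Context d1 d2 (T1 : measurableType d1) (T2 : measurableType d2) (R : realType).
Variable m1 : {sigma_finite_measure set T1 -> \bar R}.
Variable m2 : {sigma_finite_measure set T2 -> \bar R}.

Definition prod_measure : set (T1 * T2) -> \bar R := (m1 \x m2)%E.

HB.instance Definition _ := Measure.copy prod_measure (m1 \x m2)%E.

Let prod_measure_sigma_finite : sigma_finite setT prod_measure.
Proof.
have /sigma_finiteP[F [FT ndF Foo]] := sigma_finiteT m1.
have /sigma_finiteP[G [GT ndG Goo]] := sigma_finiteT m2.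
exists (fun k => F k `*` G k).
  rewrite -setXTT FT GT predeqE => -[x y]; split; last first.
    by move=> [k _ []/= ? ?]; split; exists k.
  move=> [/= [k _ Fx] [l _ Gy]]; exists (maxn k l) => //; split.
    by move: x Fx; exact/subsetPset/ndF/leq_maxl.
  by move: y Gy; exact/subsetPset/ndG/leq_maxr.
move=> k; have [mF Fk] := Foo k; have [mG Gk] := Goo k; split.
  exact: measurableX.
by rewrite /prod_measure product_measure1E// lte_mul_pinfty// ge0_fin_numE.
Qed.

HB.instance Definition _ := Measure_isSigmaFinite.Build _ _ _ prod_measure
  prod_measure_sigma_finite.

End sigma_finite_product.

Section power_measure.
Context d (T : measurableType d) (R : realType).

Definition cons_tuple n (x : T * n.-tuple T) : n.+1.-tuple T :=
  [tuple of x.1 :: x.2].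

Lemma measurable_cons_tuple n : measurable_fun [set: T * n.-tuple T] (@cons_tuple n).
Proof. exact: measurable_cons measurable_fst measurable_snd. Qed.

Definition uncons_tuple n (x : n.+1.-tuple T) : T * n.-tuple T :=
  (thead x, [tuple of behead x]).

Lemma cons_tupleK n : cancel (@cons_tuple n) (@uncons_tuple n).
Proof.
move=> [x s]; rewrite /uncons_tuple /cons_tuple /=; congr pair.
by apply: val_inj.
Qed.

Lemma uncons_tupleK n : cancel (@uncons_tuple n) (@cons_tuple n).
Proof. by move=> s; rewrite [RHS]tuple_eta; apply: val_inj. Qed.

Lemma measurable_uncons_tuple n :
  measurable_fun [set: n.+1.-tuple T] (@uncons_tuple n).
Proof.
by apply: measurable_fun_pair; [exact: measurable_tnth|exact: measurable_behead].
Qed.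

Section step.
Variables (n : nat) (mu : {sigma_finite_measure set T -> \bar R}).
Variable nu : {sigma_finite_measure set (n.-tuple T) -> \bar R}.

Definition cons_measure (A : set (n.+1.-tuple T)) : \bar R :=
  pushforward (prod_measure mu nu) (@cons_tuple n) A.

Let m0 : cons_measure set0 = 0%E.
Proof. by rewrite /cons_measure /pushforward preimage_set0 measure0. Qed.

Let m_ge0 A : (0 <= cons_measure A)%E.
Proof. by rewrite /cons_measure /pushforward; exact: measure_ge0. Qed.

Let m_sigma : semi_sigma_additive cons_measure.
Proof.
move=> F mF tF mUF; rewrite /cons_measure /pushforward preimage_bigcup.
have mp A : measurable A -> measurable (@cons_tuple n @^-1` A).
  by move=> mA; rewrite -[X in measurable X]setTI; exact: measurable_cons_tuple.
apply: measure_semi_sigma_additive => [k||].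
- exact: mp.
- apply/trivIsetP => /= i j _ _ ij; rewrite -preimage_setI.
  by move/trivIsetP : tF => /(_ _ _ _ _ ij) ->//; rewrite preimage_set0.
- by rewrite -preimage_bigcup; exact: mp.
Qed.

HB.instance Definition _ := isMeasure.Build _ _ _ cons_measure m0 m_ge0 m_sigma.

Let m_fin : sigma_finite setT cons_measure.
Proof.
have [F FT Foo] := sigma_finiteT (prod_measure mu nu).
exists (fun k => @uncons_tuple n @^-1` F k).
  by rewrite -preimage_bigcup -FT preimage_setT.
move=> k; have [mF Fk] := Foo k; split.
  by rewrite -[X in measurable X]setTI; exact: measurable_uncons_tuple.
rewrite /cons_measure /pushforward -comp_preimage.
rewrite (_ : _ \o _ = id)//; apply/funext; exact: cons_tupleK.
Qed.

HB.instance Definition _ := Measure_isSigmaFinite.Build _ _ _ cons_measure m_fin.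

End step.

Fixpoint power_measure (mu : {sigma_finite_measure set T -> \bar R}) (n : nat) :
    {sigma_finite_measure set (n.-tuple T) -> \bar R} :=
  match n with
  | 0 => dirac [tuple]
  | k.+1 => cons_measure mu (power_measure mu k)
  end.

End power_measure.

Section normalize.
Context (C : numClosedFieldType) (n : nat).
Implicit Types (a : C) (u v : 'rV[C]_n).

(* dotmx is linear in its first argument and antilinear in the second. *)
Definition normalize v := (sqrtC (dotmx v v))^-1 *: v.

Lemma dotmxZr a u v : dotmx u (a *: v) = a^* * dotmx u v.
Proof. by rewrite linearZr_LR. Qed.

Lemma dotmx_ge0 v : 0 <= dotmx v v.
Proof. exact: dnorm_ge0. Qed.

Lemma normdot2 u v :
  `|dotmx u (normalize v)| ^+ 2 = `|dotmx u v| ^+ 2 / dotmx v v.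
Proof.
rewrite /normalize dotmxZr normrM norm_conjC normfV exprMn exprVn -normrX sqrtCK.
by rewrite (ger0_norm (dotmx_ge0 v)) mulrC.
Qed.

Lemma normdotZ a u v : a != 0 ->
  `|dotmx u (normalize (a *: v))| = `|dotmx u (normalize v)|.
Proof.
move=> a0.
have sq_inj (x y : C) : 0 <= x -> 0 <= y -> x ^+ 2 = y ^+ 2 -> x = y.
  by move=> x0 y0 xy; rewrite -(sqrCK x0) xy sqrCK.
apply: sq_inj; [exact: normr_ge0|exact: normr_ge0|].
rewrite (normdot2 u (a *: v)).
rewrite (normdot2 u v).
rewrite (dnormZ (@dotmx C n)) dotmxZr.
rewrite normrM exprMn norm_conjC -mulf_div divff ?mul1r//.
by rewrite expf_neq0// normr_eq0.
Qed.

Lemma dotmx_normalize1 v : v != 0 -> dotmx (normalize v) (normalize v) = 1.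
Proof.
move=> v0; rewrite (dnormZ (@dotmx C n)) normfV exprVn -normrX sqrtCK.
by rewrite (ger0_norm (dotmx_ge0 v)) mulVf// (dnorm_eq0 (@dotmx C n)).
Qed.

Lemma normdot_le1 u v : u != 0 -> v != 0 ->
  `|dotmx (normalize u) (normalize v)| <= 1.
Proof.
move=> u0 v0.
have [+ _] := CauchySchwarz_sqrt (@dotmx C n) (normalize u) (normalize v).
have e : sqrtC (dotmx (normalize u) (normalize u)) *
         sqrtC (dotmx (normalize v) (normalize v)) = 1.
  by rewrite !dotmx_normalize1// sqrtC1 mulr1.
by move=> uv; apply: (le_trans uv); rewrite le_eqVlt; apply/orP; left; apply/eqP.
Qed.

End normalize.

Section projective_space.
Context (C : numClosedFieldType) (d : nat).

(* Points are the lines of C^(d+1). *)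
Definition projective_space : Type := {V : {vspace 'rV[C]_d.+1} | \dim V == 1%N}.

HB.instance Definition _ := Choice.on projective_space.

Implicit Types (p q : projective_space) (z : d.-tuple C).

Definition repr_vec p : 'rV[C]_d.+1 := vpick (val p).

Definition line_of (v : 'rV[C]_d.+1) (v0 : v != 0) : projective_space.
Proof. by exists <[v]>%VS; rewrite dim_vline v0. Defined.

Definition affine_vec z : 'rV[C]_d.+1 :=
  \row_j if unlift ord0 j is Some i then tnth z i else 1.

Lemma affine_vec_neq0 z : affine_vec z != 0.
Proof.
apply/eqP => /matrixP /(_ 0 ord0) /eqP.
by rewrite !mxE unlift_none oner_eq0.
Qed.

Definition affine_point z : projective_space := line_of (affine_vec_neq0 z).

(* Representative of p of the form (1, z); on the hyperplane where the first    *)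
(* homogeneous coordinate vanishes it is the zero vector, since 0^-1 = 0.       *)
Definition affine_repr p : 'rV[C]_d.+1 :=
  (repr_vec p 0 ord0)^-1 *: repr_vec p.

Definition overlap p q : C :=
  `|dotmx (normalize (repr_vec p)) (normalize (repr_vec q))|.

Lemma repr_vec_neq0 p : repr_vec p != 0.
Proof.
rewrite /repr_vec vpick0; apply/eqP => p0.
by have := valP p; rewrite p0 dimv0.
Qed.

Lemma overlap_ge0 p q : 0 <= overlap p q.
Proof. exact: normr_ge0. Qed.

Lemma overlap_le1 p q : overlap p q <= 1.
Proof. exact: normdot_le1 (repr_vec_neq0 p) (repr_vec_neq0 q). Qed.

Lemma overlap_affine p z (w := normalize (repr_vec p)) :
  overlap p (affine_point z) ^+ 2 =
  `|w 0 ord0 + \sum_(i < d) w 0 (lift ord0 i) * (tnth z i)^*| ^+ 2 /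
  (1 + \sum_(i < d) `|tnth z i| ^+ 2).
Proof.
have /vlineP[a az] : repr_vec (affine_point z) \in <[affine_vec z]>%VS.
  exact: memv_pick.
have a0 : a != 0.
  apply/eqP => a0; have := repr_vec_neq0 (affine_point z).
  by rewrite az a0 scale0r eqxx.
rewrite /overlap az (normdotZ _ _ a0) (normdot2 w); congr (`|_| ^+ 2 / _).
  rewrite dotmxE mxE big_ord_recl !mxE unlift_none conjC1 mulr1; congr (_ + _).
  by apply: eq_bigr => i _; rewrite !mxE liftK.
rewrite dotmxE mxE big_ord_recl !mxE unlift_none conjC1 mulr1; congr (_ + _).
by apply: eq_bigr => i _; rewrite !mxE liftK normCK.
Qed.

End projective_space.

Section complex_projective_space.
Context (R : realType) (d : nat).
Local Notation R2 := (measurableTypeR R * measurableTypeR R)%type.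


Definition CP : Type := projective_space R[i] d.

HB.instance Definition _ := Choice.on CP.

Definition chart (z : d.-tuple R2) : CP :=
  affine_point [tuple of [seq Complex (x.1 : R) (x.2 : R) | x <- z]].

HB.instance Definition _ := isPointed.Build CP (chart [tuple (0, 0) | i < d]).

Definition FSdist (p q : CP) : R := acos (complex.Re (overlap p q)).

(* Open and closed balls both count. CP is separable, so the sigma-algebra they *)
(* generate is the Borel one.                                                   *)
Definition metric_balls : set (set CP) :=
  [set A | exists (p : CP) (r : R),
    A = [set q | FSdist p q < r] \/ A = [set q | FSdist p q <= r]].

HB.instance Definition _ := @isMeasurable.Build (sigma_display metric_balls)
  CP <<s metric_balls >> (@sigma_algebra0 _ setT metric_balls)
  (@sigma_algebraC _ metric_balls)
  (@sigma_algebra_bigcup _ setT metric_balls).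

Lemma Re_overlap_itv (p q : CP) : 0 <= complex.Re (overlap p q) <= 1.
Proof.
have := overlap_le1 p q; have := overlap_ge0 p q.
by rewrite !lecE => /andP[_ ->] /andP[_ ->].
Qed.

Let sumC (z : d.-tuple R2) (w : 'rV[R[i]]_d.+1) : R[i] :=
  w 0 ord0 + \sum_(i < d)
    w 0 (lift ord0 i) * (Complex ((tnth z i).1 : R) (- (tnth z i).2 : R)).

Lemma Re_overlap_chart (p : CP) z (w := normalize (repr_vec p)) :
  complex.Re (overlap p (chart z)) =
  Num.sqrt ((complex.Re (sumC z w) ^+ 2 + complex.Im (sumC z w) ^+ 2) /
            (1 + \sum_(i < d) (((tnth z i).1 : R) ^+ 2 + ((tnth z i).2 : R) ^+ 2))).
Proof.
have /andP[ov0 _] := Re_overlap_itv p (chart z).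
rewrite -[LHS]ger0_norm// -sqrtr_sqr; congr Num.sqrt.
apply: complexI; rewrite rmorphXn/=.
have -> : (complex.Re (overlap p (chart z)))%:C%C = overlap p (chart z).
  have := overlap_ge0 p (chart z); case: (overlap _ _) => a b.
  by rewrite lecE /= => /andP[/eqP -> _].
have normc2 (x : R[i]) :
    `|x| ^+ 2 = (complex.Re x ^+ 2 + complex.Im x ^+ 2)%:C%C.
  by rewrite normc_def -rmorphXn/= sqr_sqrtr// addr_ge0 ?sqr_ge0.
rewrite overlap_affine fmorph_div; congr (_ / _).
  apply: etrans (normc2 (sumC z w)); congr (`|_ + _| ^+ 2).
  by apply: eq_bigr => i _; rewrite tnth_map.
rewrite rmorphD rmorph_sum/=; congr (_ + _).
by apply: eq_bigr => i _; rewrite normc2 tnth_map.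
Qed.

Definition FSform (z : d.-tuple R2) : R :=
  1 + \sum_(i < d) (((tnth z i).1 : R) ^+ 2 + ((tnth z i).2 : R) ^+ 2).

Lemma FSform_gt0 z : 0 < FSform z.
Proof.
by rewrite ltr_pwDl// sumr_ge0// => i _; rewrite addr_ge0// sqr_ge0.
Qed.

Lemma measurable_sumC (w : 'rV[R[i]]_d.+1) :
  measurable_fun setT (fun z => complex.Re (sumC z w)) /\
  measurable_fun setT (fun z => complex.Im (sumC z w)).
Proof.
have mt1 i : measurable_fun setT (fun z : d.-tuple R2 => (tnth z i).1 : R).
  by apply: measurableT_comp => //; exact: measurable_tnth.
have mt2 i : measurable_fun setT (fun z : d.-tuple R2 => (tnth z i).2 : R).
  by apply: measurableT_comp => //; exact: measurable_tnth.
rewrite /sumC; split.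
  rewrite (_ : (fun z => _) = (fun z => complex.Re (w 0 ord0) +
    \sum_(i < d) (complex.Re (w 0 (lift ord0 i)) * (tnth z i).1 +
                  complex.Im (w 0 (lift ord0 i)) * (tnth z i).2))).
    apply: measurable_funD => //; apply: measurable_sum => i.
    by apply: measurable_funD; exact: measurable_funM.
  apply/funext => z; rewrite raddfD; congr (_ + _); rewrite raddf_sum.
  apply: eq_bigr => i _; case: (w 0 _) => a b /=; ring.
rewrite (_ : (fun z => _) = (fun z => complex.Im (w 0 ord0) +
  \sum_(i < d) (complex.Im (w 0 (lift ord0 i)) * (tnth z i).1 -
                complex.Re (w 0 (lift ord0 i)) * (tnth z i).2))).
  apply: measurable_funD => //; apply: measurable_sum => i.
  by apply: measurable_funB; exact: measurable_funM.
apply/funext => z; rewrite raddfD; congr (_ + _); rewrite raddf_sum.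
apply: eq_bigr => i _; case: (w 0 _) => a b /=; ring.
Qed.

Lemma measurable_FSform : measurable_fun setT (@FSform).
Proof.
by apply: measurable_funD => //; apply: measurable_sum => i;
  apply: measurable_funD; apply: measurable_funX; apply: measurableT_comp => //;
  exact: measurable_tnth.
Qed.

Lemma measurable_Re_overlap (p : CP) :
  measurable_fun setT (fun z => complex.Re (overlap p (chart z))).
Proof.
have [mRe mIm] := measurable_sumC (normalize (repr_vec p)).
rewrite (_ : (fun z => _) = (fun z => Num.sqrt
  ((complex.Re (sumC z (normalize (repr_vec p))) ^+ 2 +
    complex.Im (sumC z (normalize (repr_vec p))) ^+ 2) * FSform z `^ (-1)))).
  apply: (measurableT_comp (f := @Num.sqrt R)).
    apply: continuous_measurable_fun; exact: sqrt_continuous.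
  apply: measurable_funM.
    by apply: measurable_funD; exact: measurable_funX.
  by apply: (measurableT_comp (f := fun x : R => powR x (-1)));
    [exact: measurable_powR|exact: measurable_FSform].
by apply/funext => z; rewrite Re_overlap_chart powR_inv1// ltW// FSform_gt0.
Qed.

Lemma measurable_chart : measurable_fun setT chart.
Proof.
apply: (measurability metric_balls) => // _ [_ [p [r [->|->]]] <-].
  rewrite setTI.
  pose g z := complex.Re (overlap p (chart z)).
  have g01 z : -1 <= g z <= 1.
    have /andP[g0 ->] := Re_overlap_itv p (chart z).
    by rewrite andbT (le_trans _ g0)// lerN10.
  have mg : measurable_fun setT g by exact: measurable_Re_overlap.
  have [r0|r0] := leP r 0.
    rewrite (_ : _ @^-1` _ = set0)//; apply/seteqP; split => // z /=.
    by rewrite /FSdist ltNge (le_trans r0)// acos_ge0 ?g01.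
  have [rpi|rpi] := leP r pi; last first.
    rewrite (_ : _ @^-1` _ = setT)//; apply/seteqP; split => // z _ /=.
    by rewrite (le_lt_trans _ rpi)// acos_lepi ?g01.
  rewrite (_ : _ @^-1` _ = g @^-1` `]cos r, +oo[).
    by rewrite -[X in measurable X]setTI; exact: mg.
  apply/seteqP; split => z /=; rewrite in_itv/= andbT /FSdist -/(g z).
    by rewrite -ltr_cos ?acosK ?in_itv//= ?acos_ge0 ?acos_lepi ?g01 ?(ltW r0).
  by rewrite -ltr_cos ?acosK ?in_itv//= ?acos_ge0 ?acos_lepi ?g01 ?(ltW r0).
rewrite setTI.
pose g z := complex.Re (overlap p (chart z)).
have g01 z : -1 <= g z <= 1.
  have /andP[g0 ->] := Re_overlap_itv p (chart z).
  by rewrite andbT (le_trans _ g0)// lerN10.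
have mg : measurable_fun setT g by exact: measurable_Re_overlap.
have [r0|r0] := ltP r 0.
  rewrite (_ : _ @^-1` _ = set0)//; apply/seteqP; split => // z /=.
  by rewrite /FSdist leNgt (lt_le_trans r0)// acos_ge0 ?g01.
have [rpi|rpi] := leP r pi; last first.
  rewrite (_ : _ @^-1` _ = setT)//; apply/seteqP; split => // z _ /=.
  by rewrite (le_trans _ (ltW rpi))// acos_lepi ?g01.
rewrite (_ : _ @^-1` _ = g @^-1` `[cos r, +oo[).
  by rewrite -[X in measurable X]setTI; exact: mg.
apply/seteqP; split => z /=; rewrite in_itv/= andbT /FSdist -/(g z).
  by rewrite [acos _ <= _]leNgt -ltr_cos ?acosK -?leNgt ?in_itv//= ?acos_ge0 ?acos_lepi ?g01 ?r0.
by rewrite [acos _ <= _]leNgt -ltr_cos ?acosK -?leNgt ?in_itv//= ?acos_ge0 ?acos_lepi ?g01 ?r0.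
Qed.

Definition lebesgue_Cd : {sigma_finite_measure set (d.-tuple R2) -> \bar R} :=
  power_measure (prod_measure lebesgue_measure lebesgue_measure) d.

(* In the chart, the Fubini-Study metric normalized as in FSdist is the         *)
(* Hermitian form ((1 + |z|^2) |dz|^2 - |<dz, z>|^2) / (1 + |z|^2)^2; its       *)
(* determinant (1 + |z|^2)^-(d+1) is the Riemannian volume density, and the     *)
(* hyperplane missed by the chart is a null set.                                *)
Definition FSdensity (z : d.-tuple R2) : R := (FSform z ^+ d.+1)^-1.

Lemma FSdensity_ge0 z : 0 <= FSdensity z.
Proof. by rewrite invr_ge0 exprn_ge0// ltW// FSform_gt0. Qed.

Lemma measurable_FSdensity : measurable_fun setT FSdensity.
Proof.
rewrite (_ : FSdensity = fun z => powR (FSform z ^+ d.+1) (-1)).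
  apply: (measurableT_comp (f := fun x : R => powR x (-1))).
    exact: measurable_powR.
  by apply: measurable_funX; exact: measurable_FSform.
apply/funext => z; rewrite /FSdensity powR_inv1//.
by rewrite exprn_ge0// ltW// FSform_gt0.
Qed.

Definition FSvolume (A : set CP) : \bar R :=
  (\int[lebesgue_Cd]_(z in chart @^-1` A) (FSdensity z)%:E)%E.

Let FSvolume0 : FSvolume set0 = 0%E.
Proof. by rewrite /FSvolume preimage_set0 integral_set0. Qed.

Let FSvolume_ge0 A : (0 <= FSvolume A)%E.
Proof.
by apply: integral_ge0 => z _; rewrite lee_fin; exact: FSdensity_ge0.
Qed.

Let FSvolume_sigma : semi_sigma_additive FSvolume.
Proof.
move=> F mF tF mUF.
have mp A : measurable A -> measurable (chart @^-1` A).
  by move=> mA; rewrite -[X in measurable X]setTI; exact: measurable_chart.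
rewrite {2}/FSvolume preimage_bigcup ge0_integral_bigcup//.
- by apply: is_cvg_ereal_nneg_natsum_cond => n _ _; exact: FSvolume_ge0.
- by move=> n; exact: mp.
- apply: measurable_funTS; apply/measurable_EFinP; exact: measurable_FSdensity.
- by move=> z _; rewrite lee_fin; exact: FSdensity_ge0.
- apply/trivIsetP => /= i j _ _ ij; rewrite -preimage_setI.
  by move/trivIsetP : tF => /(_ _ _ _ _ ij) ->//; rewrite preimage_set0.
Qed.

HB.instance Definition _ := isMeasure.Build _ _ _ FSvolume
  FSvolume0 FSvolume_ge0 FSvolume_sigma.

(* FSvolume setT is finite and nonzero, so mnormalize divides by it and the     *)
(* default probability plays no role.                                           *)
Definition vol : probability CP R := mnormalize FSvolume (dirac point).

End complex_projective_space.

Section point_process.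
Context dO (Omega : measurableType dO) dT (T : measurableType dT) (R : realType).
Variables (P : probability Omega R) (X : Omega -> {fset T}).

Definition count_in (x : {fset T}) (A : set T) : nat :=
  #|` [fset y in x | y \in A]%fset|.

Definition simple_point_process (N : nat) : Prop :=
  (forall w, #|` X w| = N) /\
  forall A, measurable A ->
    measurable_fun [set: Omega] (fun w => (count_in (X w) A)%:R : R).

(* A i are pairwise disjoint; the integral is over A 0 x ... x A (k - 1).       *)
Definition joint_intensity (mu : {sigma_finite_measure set T -> \bar R})
    (k : nat) (rho : k.-tuple T -> R) : Prop :=
  [/\ measurable_fun [set: k.-tuple T] rho,
      forall y, 0 <= rho y &
      forall A : 'I_k -> set T,
        (forall i, measurable (A i)) -> trivIset [set: 'I_k] A ->
        ('E_P[(fun w => \prod_(i < k) (count_in (X w) (A i))%:R)%R] =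
         \int[power_measure mu k]_(y in [set y | forall i, A i (tnth y i)])
           (rho y)%:E)%E].

(* For a Hermitian kernel the determinant is real, hence the cast of rho.       *)
Definition determinantal (mu : {sigma_finite_measure set T -> \bar R})
    (K : T -> T -> R[i]) : Prop :=
  forall k, (0 < k)%N -> exists rho : k.-tuple T -> R,
    joint_intensity mu rho /\
    forall y, (rho y)%:C%C = \det (\matrix_(i, j) K (tnth y i) (tnth y j)).

End point_process.

Section projective_ensemble.
Context (R : realType) (d : nat).

Definition projective_kernel (L : nat) (p q : CP R d) : R[i] :=
  'C(d + L, d)%:R *
  dotmx (normalize (affine_repr p)) (normalize (affine_repr q)) ^+ L.

Definition projective_ensemble (L : nat) dO (Omega : measurableType dO)
    (P : probability Omega R) (X : Omega -> {fset CP R d}) : Prop :=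
  simple_point_process R X 'C(d + L, d) /\
  determinantal P X (vol R d) (projective_kernel L).

Definition discrepancy (x : {fset CP R d}) : \bar R :=
  ereal_sup [set `|(count_in x A)%:R%:E - (#|` x|)%:R%:E * vol R d A|%E
            | A in @metric_balls R d].

End projective_ensemble.

(* Main.v *)
(** The projective kernel is a projection of rank N.  For a ball B, restricting it
to B gives a Gram matrix with eigenvalues lam_a in [0, 1], and the factorial
moments of the number n of points in B satisfy
E[n (n-1) ... (n-k+1)] <= sum over injective f of prod_j lam_(f j), whence
E[(1 + t)^n] <= prod_a (1 + t lam_a) for t >= 0, as for a sum of independent
Bernoulli variables of parameters lam_a.  Their sum is N vol(B), and their
variance sum_a lam_a (1 - lam_a) is the integral of |K(x, y)|^2 over x in B, y
outside B; since |K|^2 = N^2 |<x, y>|^(2L) decays at distance L^(-1/2) and shells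
of width w around the boundary of B have volume O(w), the variance is
O(N L^(-1/2)) = O(N^(1 - 1/(2d))).  Chernoff's bound, applied to balls and to
their complements, gives Gaussian tails at scale N^((1 - 1/(2d))/2) sqrt(log N).
Every ball is squeezed between two members of a net of polynomially many balls up
to volume O(1/N), so a union bound over the net concludes. *)

Require Import Defs.
From HB Require Import structures.
From mathcomp Require Import all_boot all_order all_algebra.
From mathcomp Require Import fingroup perm finmap.
From mathcomp Require Import complex ring lra.
From mathcomp Require Import all_classical all_reals all_analysis.
From mathcomp Require Import measurable_realfun.

Set Implicit Arguments.
Unset Strict Implicit.
Unset Printing Implicit Defensive.

Import Order.TTheory GRing.Theory Num.Theory.
Import numFieldNormedType.Exports.

Local Open Scope classical_set_scope.
Local Open Scope ring_scope.

(** * Invariance of Lebesgue integrals on C^n *)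

(** The overview takes the law of the overlap for granted. Volume is a density in one chart, where
    unitary symmetry is invisible, so chart integrals are lifted to Gaussian integrals on [C^(d+1)].
    There the integrand depends on one linear form and the norm only, and substitutions in one and
    two coordinates move any centre to the first axis. The outcome, volume [(1 - s)^d] for squared
    overlap above [s], supplies the shells, the moments of the kernel and the nullity of the
    hyperplane on which the kernel vanishes. Orthonormality is not checked monomial by monomial:
    trace and squared Hilbert-Schmidt norm of the kernel both equal N, which forces the Gram matrix
    to be the identity. Joint intensities speak of disjoint sets only, so factorial moments are
    reached by cutting a set into cells and are bounded from one side. This confines the generating
    function to [t >= 0] and is why lower tails pass through complements. The sigma-algebra is
    generated by balls, so measurability, from the kernel coordinates to the discrepancy event, is
    always traced back to overlaps. *)

Section affine.
Context {R : realType}.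
Local Notation mu := (@lebesgue_measure R).
Local Open Scope ereal_scope.

(** Uniqueness of Lebesgue measure: the rescaled pushforward has the right value on half-open
    intervals. For negative [a] the preimage of such an interval is closed at the other end, with
    the same length. *)
Lemma lebesgue_measure_affine (a b : R) (A : set (measurableTypeR R)) :
  a != 0%R -> measurable A ->
  mu A = `|a|%:E * mu ((fun x : measurableTypeR R => a * x + b)%R @^-1` A).
Proof.
move=> a0 mA.
pose phi : measurableTypeR R -> measurableTypeR R := fun x => (a * x + b)%R.
have mphi : measurable_fun setT phi.
  by apply: measurable_funD => //; exact: measurable_funM.
pose phimu : {measure set (measurableTypeR R) -> \bar R} :=
  measure_function_pushforward__canonical__measure_function_Measure mu mphi.
pose nu : {measure set (measurableTypeR R) -> \bar R} :=
  mscale (NngNum (normr_ge0 a)) phimu.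
suff -> : mu A = nu A by [].
apply: (lebesgue_measure_unique (mu := nu)) => // _ [[u v]] _ <-.
rewrite /nu /mscale /= /pushforward.
have [a_gt0|a_lt0] : (0 < a)%R \/ (a < 0)%R.
  by case: (ltrgtP a 0%R) a0 => //; [right|left].
  rewrite [X in _ = _ * mu X](_ : _ =
      [set` `] ((u - b) / a)%R, ((v - b) / a)%R]]); last first.
    apply/seteqP; split => x /=;
    by rewrite !in_itv /= ltr_pdivrMr// ler_pdivlMr// ltrBlDr lerBrDr mulrC.
  rewrite !lebesgue_measure_itv/= !lte_fin ltr_pM2r ?invr_gt0// ltrD2r.
  case: ifPn => // _; last by rewrite mule0.
  rewrite gtr0_norm// -!EFinD -EFinM; congr EFin.
  by field.
rewrite [X in _ = _ * mu X](_ : _ =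
    [set` `[ ((v - b) / a)%R, ((u - b) / a)%R[]); last first.
  apply/seteqP; split => x /=;
  by rewrite !in_itv /= ltr_ndivlMr// ler_ndivrMr// ltrBlDr lerBrDr mulrC andbC.
rewrite !lebesgue_measure_itv/= !lte_fin ltr_nM2r ?invr_lt0// ltrD2r.
case: ifPn => // _; last by rewrite mule0.
rewrite ltr0_norm// -!EFinD -EFinM; congr EFin.
by field.
Qed.

Lemma ge0_integral_affine (a b : R) (f : R -> \bar R) :
  a != 0%R -> measurable_fun setT f -> (forall x, 0 <= f x) ->
  `|a|%:E * \int[mu]_x f (a * x + b)%R = \int[mu]_x f x.
Proof.
move=> a0 mf f0.
pose phi : measurableTypeR R -> measurableTypeR R := fun x => (a * x + b)%R.
have mphi : measurable_fun setT phi.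
  by apply: measurable_funD => //; exact: measurable_funM.
pose phimu : {measure set (measurableTypeR R) -> \bar R} :=
  measure_function_pushforward__canonical__measure_function_Measure mu mphi.
pose nu : {measure set (measurableTypeR R) -> \bar R} :=
  mscale (NngNum (normr_ge0 a)) phimu.
transitivity (\int[nu]_x f x).
  rewrite ge0_integral_mscale//=.
  congr (_ * _).
  rewrite (ge0_integral_pushforward mphi)//.
apply: eq_measure_integral => A mA _.
exact/esym/lebesgue_measure_affine.
Qed.

End affine.

Section prod_integral.
Context d1 d2 (T1 : measurableType d1) (T2 : measurableType d2) (R : realType).
Variable m1 : {sigma_finite_measure set T1 -> \bar R}.
Variable m2 : {sigma_finite_measure set T2 -> \bar R}.
Local Open Scope ereal_scope.

Lemma ge0_integral_prod (f : T1 * T2 -> \bar R) :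
  measurable_fun setT f -> (forall x, 0 <= f x) ->
  \int[prod_measure m1 m2]_z f z = \int[m1]_x \int[m2]_y f (x, y).
Proof. by move=> mf f0; exact: fubini_tonelli1. Qed.

End prod_integral.

Section power_integral.
Context d (T : measurableType d) (R : realType).
Variable m : {sigma_finite_measure set T -> \bar R}.
Local Open Scope ereal_scope.

Lemma ge0_integral_powerS n (f : n.+1.-tuple T -> \bar R) :
  measurable_fun setT f -> (forall x, 0 <= f x) ->
  \int[power_measure m n.+1]_z f z =
  \int[m]_x \int[power_measure m n]_y f [tuple of x :: y].
Proof.
move=> mf f0.
have mfc := measurableT_comp mf (@measurable_cons_tuple _ T n).
rewrite /= (ge0_integral_pushforward (@measurable_cons_tuple _ T n))//.
exact: (ge0_integral_prod _ _ mfc (fun x => f0 _)).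
Qed.

End power_integral.

Section plane.
Context {R : realType}.
Local Notation mu := (@lebesgue_measure R).
Local Notation R2 := (measurableTypeR R * measurableTypeR R)%type.

Definition leb2 : {sigma_finite_measure set R2 -> \bar R} := prod_measure mu mu.

Definition sqn (x : R * R) : R := x.1 ^+ 2 + x.2 ^+ 2.

Definition cmul (a x : R * R) : R * R :=
  (a.1 * x.1 - a.2 * x.2, a.1 * x.2 + a.2 * x.1).

Lemma sqn_ge0 x : 0 <= sqn x.
Proof. by rewrite addr_ge0 ?sqr_ge0. Qed.

Lemma sqn_eq0 x : (sqn x == 0) = (x == (0, 0)).
Proof.
by case: x => x y; rewrite /sqn paddr_eq0 ?sqr_ge0// !sqrf_eq0 -pair_eqE.
Qed.

Lemma sqn_cmul a x : sqn (cmul a x) = sqn a * sqn x.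
Proof. rewrite /sqn /cmul /=; ring. Qed.

Lemma measurable_affine2 (a b c : R) :
  measurable_fun setT (fun x : R2 => a * x.1 + b * x.2 + c : measurableTypeR R).
Proof. by apply: measurable_funD => //; apply: measurable_funD; exact: measurable_funM. Qed.

Lemma measurable_cmulD (a b : R * R) :
  measurable_fun setT (fun x : R2 => ((cmul a x).1 + b.1, (cmul a x).2 + b.2) : R2).
Proof.
apply: measurable_fun_pair => /=.
  under eq_fun do rewrite -mulNr.
  exact: measurable_affine2.
under eq_fun do rewrite [X in X + _]addrC.
exact: measurable_affine2.
Qed.

Local Open Scope ereal_scope.

(** Pairs of reals stand for complex numbers, so this is the substitution [z -> a z + b] with
    Jacobian [|a|^2]. It is composed of one-dimensional affine substitutions under Tonelli. Dividing
    by the real part of [a] forces a separate case for purely imaginary [a], which swaps the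
    axes. *)
Lemma ge0_integral_cmulD (a b : R * R) (F : R2 -> \bar R) :
  sqn a != 0%R -> measurable_fun setT F -> (forall x, 0 <= F x) ->
  (sqn a)%:E * \int[leb2]_x F (((cmul a x).1 + b.1)%R, ((cmul a x).2 + b.2)%R) =
  \int[leb2]_x F x.
Proof.
move=> sa0 mF F0.
have mG : measurable_fun setT (fun x : R2 => F (((cmul a x).1 + b.1)%R, ((cmul a x).2 + b.2)%R)).
  exact: (measurableT_comp mF (measurable_cmulD _ _)).
have [a10|a10] := eqVneq a.1 0%R.
  have a20 : a.2 != 0%R.
    by apply: contraNN sa0 => /eqP a20; rewrite /sqn a10 a20 expr0n addr0.
  rewrite {1}/leb2 ge0_integral_prod//= -ge0_integralZl//; last first.
  - by rewrite lee_fin sqn_ge0.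
  - by move=> x _; exact: integral_ge0.
  - exact: (measurable_fun_fubini_tonelli_F _ mG (fun x => F0 _)).
  pose H v := \int[mu]_u F (u, v).
  have mH : measurable_fun setT H by exact: (measurable_fun_fubini_tonelli_G _ mF).
  have H0 v : 0 <= H v by exact: integral_ge0.
  rewrite [RHS](fubini_tonelli2 F)//.
  rewrite -[RHS](ge0_integral_affine b.2 a20 mH H0) -ge0_integralZl//; last first.
  - apply: (measurableT_comp mH) => /=.
    by apply: measurable_funD => //; exact: measurable_funM.
  apply: eq_integral => x _.
  rewrite -[X in _ = _ * X](@ge0_integral_affine _ (- a.2) b.1) ?oppr_eq0//; last first.
    exact: (measurableT_comp mF (measurable_pair2 _)).
  rewrite muleA -EFinM normrN -normrM -expr2 ger0_norm ?sqr_ge0//.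
  rewrite /sqn a10 expr0n add0r; congr (_ * _).
  apply: eq_integral => y _.
  congr F; congr pair; rewrite /= ?a10; ring.
rewrite {1}/leb2 [X in _ * X](fubini_tonelli2 _ mG)//= -ge0_integralZl//; last first.
- by rewrite lee_fin sqn_ge0.
- by move=> x _; exact: integral_ge0.
- exact: (measurable_fun_fubini_tonelli_G _ mG (fun x => F0 _)).
have sa1 : (sqn a / a.1 != 0)%R by rewrite mulf_neq0// invr_eq0.
(* For fixed [y] the new variable is [u = a.1 x - a.2 y + b.1]. Expressed through [u], the second
   coordinate has slope [|a|^2 / a.1] in [y], and the two Jacobians multiply to [|a|^2]. *)
have step y : (sqn a)%:E * \int[mu]_x F (((a.1 * x - a.2 * y) + b.1)%R, ((a.1 * y + a.2 * x) + b.2)%R)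
  = `|sqn a / a.1|%:E * \int[mu]_u F (u, ((sqn a / a.1) * y + (b.2 + a.2 / a.1 * (u - b.1)))%R).
  rewrite -[X in _ = _ * X](@ge0_integral_affine _ a.1 (b.1 - a.2 * y))//; last first.
    apply: (measurableT_comp mF) => /=; apply: measurable_fun_pair => //=.
    apply: measurable_funD => //; apply: measurable_funD => //.
    by apply: measurable_funM => //; exact: measurable_funB.
  rewrite muleA -EFinM -normrM divfK// ger0_norm ?sqn_ge0//; congr (_ * _).
  apply: eq_integral => x _; congr F; congr pair; first by ring.
  by rewrite /sqn; field.
under eq_integral do rewrite step.
have mK : measurable_fun setT (fun z : R2 => F (z.1, ((sqn a / a.1) * z.2 + (b.2 + a.2 / a.1 * (z.1 - b.1)))%R)).
  apply: (measurableT_comp mF) => /=; apply: measurable_fun_pair => //=.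
  apply: measurable_funD => //; first exact: measurable_funM.
  apply: measurable_funD => //.
  by apply: measurable_funM => //; exact: measurable_funB.
rewrite ge0_integralZl//; last first.
- by move=> x _; exact: integral_ge0.
- exact: (measurable_fun_fubini_tonelli_G _ mK (fun x => F0 _)).
rewrite -(fubini_tonelli _ mK)//= -ge0_integralZl//; last first.
- by move=> x _; exact: integral_ge0.
- exact: (measurable_fun_fubini_tonelli_F _ mK (fun x => F0 _)).
rewrite [RHS](fubini_tonelli1 F)//.
apply: eq_integral => x _.
rewrite (@ge0_integral_affine _ _ _ (fun y => F (x, y)))//.
exact: (measurableT_comp mF (measurable_pair1 _)).
Qed.

End plane.

Section unitary.
Context {R : realType}.
Local Notation mR := (measurableTypeR R).
Local Notation R2 := (measurableTypeR R * measurableTypeR R)%type.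
Local Notation leb2 := (@leb2 R).

Lemma measurable_sqn : measurable_fun setT (fun x : R2 => sqn x : mR).
Proof. by apply: measurable_funD; exact: measurable_funX. Qed.

Lemma measurable_scale (r : R) (d : measure_display) (T : measurableType d) (f : T -> R2) :
  measurable_fun setT f ->
  measurable_fun setT (fun x => ((r * (f x).1)%R, (r * (f x).2)%R) : R2).
Proof.
move=> mf; apply: measurable_fun_pair => /=.
  apply: measurable_funM => //.
  exact: (measurableT_comp measurable_fst mf).
apply: measurable_funM => //.
exact: (measurableT_comp measurable_snd mf).
Qed.

Lemma measurable_cmul (a : R * R) (d : measure_display) (T : measurableType d) (f : T -> R2) :
  measurable_fun setT f ->
  measurable_fun setT (fun x => cmul a (f x) : R2).
Proof.
move=> mf.
have := measurableT_comp (measurable_cmulD a (0, 0)) mf.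
by apply: eq_measurable_fun => x _ /=; rewrite !addr0.
Qed.

Lemma measurable_add2 (d : measure_display) (T : measurableType d) (f g : T -> R2) :
  measurable_fun setT f -> measurable_fun setT g ->
  measurable_fun setT (fun x => ((f x).1 + (g x).1, (f x).2 + (g x).2) : R2).
Proof.
move=> mf mg; apply: measurable_fun_pair => /=; apply: measurable_funD.
- exact: (measurableT_comp measurable_fst mf).
- exact: (measurableT_comp measurable_fst mg).
- exact: (measurableT_comp measurable_snd mf).
- exact: (measurableT_comp measurable_snd mg).
Qed.

Local Open Scope ereal_scope.

(** Multiplication by the unit [a / |a|] preserves both [leb2] and [sqn], so only the modulus of [a]
    is visible. *)
Lemma ge0_integral_rot1 (a : R * R) (G : R2 * mR -> \bar R) :
  measurable_fun setT G -> (forall x, 0 <= G x) ->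
  \int[leb2]_x G (cmul a x, sqn x) =
  \int[leb2]_x G (((Num.sqrt (sqn a) * x.1)%R, (Num.sqrt (sqn a) * x.2)%R), sqn x).
Proof.
move=> mG G0; have [sa0|sa0] := eqVneq (sqn a) 0%R.
  apply: eq_integral => x _; rewrite sa0 sqrtr0.
  by move: sa0 => /eqP; rewrite sqn_eq0 => /eqP ->; rewrite /cmul /= !mul0r subr0 addr0.
set s := Num.sqrt (sqn a).
have s2 : (s ^+ 2 = sqn a)%R by rewrite sqr_sqrtr ?sqn_ge0.
have s0 : s != 0%R by rewrite -sqrf_eq0 s2.
pose F (u : R2) := G ((s * u.1, s * u.2)%R, sqn u).
have mF : measurable_fun setT F.
  apply: (measurableT_comp mG) => /=; apply: measurable_fun_pair => /=.
    exact: measurable_scale.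
  exact: measurable_sqn.
have su : sqn (a.1 / s, a.2 / s)%R = 1%R.
  by rewrite /sqn /= !expr_div_n -mulrDl -/(sqn a) -s2 divff// sqrf_eq0.
have := @ge0_integral_cmulD _ (a.1 / s, a.2 / s)%R (0, 0)%R F.
rewrite su oner_neq0 mul1e => /(_ isT mF (fun x => G0 _)) <-.
apply: eq_integral => x _; rewrite /F; congr G; congr pair => /=.
  by rewrite /cmul /= !addr0; congr pair; field.
have -> : ((a.1 / s * x.1 - a.2 / s * x.2 + 0)%R, (a.1 / s * x.2 + a.2 / s * x.1 + 0)%R) =
   cmul (a.1 / s, a.2 / s)%R x by rewrite /cmul /= !addr0.
by rewrite sqn_cmul su mul1r.
Qed.

(** A two-coordinate unitary change of variables, done one complex variable at a time:
    [u = (w x + r y) / rho] for fixed [y], then [v = (rho y - r u) / |w|] for fixed [u]. The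
    Jacobians [|w|^2 / rho^2] and [rho^2 / |w|^2] cancel, and [|u|^2 + |v|^2 = |x|^2 + |y|^2]. For
    [w = 0] the two variables are merely exchanged. *)
Lemma ge0_integral_rot2 (w : R * R) (r rho : R) (G : R2 * mR -> \bar R) :
  (0 <= r)%R -> (0 <= rho)%R -> (rho ^+ 2 = sqn w + r ^+ 2)%R ->
  measurable_fun setT G -> (forall x, 0 <= G x) ->
  \int[leb2]_x \int[leb2]_y
    G ((((cmul w x).1 + r * y.1)%R, ((cmul w x).2 + r * y.2)%R), (sqn x + sqn y)%R) =
  \int[leb2]_x \int[leb2]_y
    G (((rho * x.1)%R, (rho * x.2)%R), (sqn x + sqn y)%R).
Proof.
move=> r0 rho0 rhoE mG G0.
have mxy : measurable_fun setT (fun x : R2 * R2 => sqn x.1 + sqn x.2 : mR)%R.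
  by apply: measurable_funD; apply: (measurableT_comp measurable_sqn).
have mL : measurable_fun setT (fun x : R2 * R2 =>
    G ((((cmul w x.1).1 + r * x.2.1)%R, ((cmul w x.1).2 + r * x.2.2)%R), (sqn x.1 + sqn x.2)%R)).
  apply: (measurableT_comp mG) => /=; apply: measurable_fun_pair => //=.
  apply: (measurable_add2 (f := fun x : R2 * R2 => cmul w x.1)
      (g := fun x => ((r * x.2.1)%R, (r * x.2.2)%R))).
    exact: measurable_cmul.
  exact: measurable_scale.
have [w0|w0] := eqVneq (sqn w) 0%R.
  have <- : r = rho.
    by apply/eqP; rewrite -(@eqrXn2 _ 2)// rhoE w0 add0r.
  apply: etrans (fubini_tonelli (m1 := leb2) (m2 := leb2) _ mL (fun x => G0 _)) _.
  apply: eq_integral => x _.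
  apply: eq_integral => y _ /=; rewrite [X in (_, X)]addrC.
  move: w0 => /eqP; rewrite sqn_eq0 => /eqP ->.
  by rewrite !mul0r subr0 addr0 !add0r.
have rho20 : (0 < rho ^+ 2)%R by rewrite rhoE ltr_wpDr ?sqr_ge0// lt0r w0 sqn_ge0.
have rhoN0 : rho != 0%R by rewrite -sqrf_eq0 gt_eqF.
apply: etrans (fubini_tonelli (m1 := leb2) (m2 := leb2) _ mL (fun x => G0 _)) _.
pose F (z : R2 * R2) := G ((rho * z.1.1, rho * z.1.2)%R,
  (sqn z.1 + sqn (rho * z.2.1 - r * z.1.1, rho * z.2.2 - r * z.1.2)%R / sqn w)%R).
have mF : measurable_fun setT F.
  apply: (measurableT_comp mG) => /=; apply: measurable_fun_pair => //=.
    exact: measurable_scale.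
  apply: measurable_funD; first exact: (measurableT_comp measurable_sqn).
  apply: measurable_funM => //; apply: (measurableT_comp measurable_sqn) => /=.
  have := measurable_add2 (measurable_scale rho (@measurable_snd _ _ R2 R2))
      (measurable_scale (- r) (@measurable_fst _ _ R2 R2)).
  by apply: eq_measurable_fun => x _ /=; rewrite !mulNr.
have F0 z : 0 <= F z by exact: G0.
have step1 y : \int[leb2]_x G ((((cmul w x).1 + r * y.1)%R, ((cmul w x).2 + r * y.2)%R), (sqn x + sqn y)%R)
   = (rho ^+ 2 / sqn w)%:E * \int[leb2]_x F (x, y).
  have := @ge0_integral_cmulD _ (w.1 / rho, w.2 / rho)%R (r * y.1 / rho, r * y.2 / rho)%R
     (fun u => F (u, y)).
  have -> : sqn (w.1 / rho, w.2 / rho)%R = (sqn w / rho ^+ 2)%R.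
    by rewrite /sqn /= !expr_div_n -mulrDl.
  rewrite mulf_neq0 ?invr_eq0 ?(gt_eqF rho20) ?w0// => /(_ isT) <-//; last first.
    exact: (measurableT_comp mF (measurable_pair2 _)).
  rewrite muleA -EFinM.
  have -> : (rho ^+ 2 / sqn w * (sqn w / rho ^+ 2) = 1)%R by rewrite mulrA divfK// divff// gt_eqF.
  rewrite mul1e; apply: eq_integral => x _; rewrite /F /=; congr G; congr pair.
    by congr pair; field.
  symmetry; set P := (cmul w x).
  rewrite [X in (X + _)%R](_ : _ = (sqn w * sqn x + r ^+ 2 * sqn y + 2 * r * (P.1 * y.1 + P.2 * y.2)) / rho ^+ 2)%R; last first.
    by rewrite /P /sqn /cmul /=; field.
  rewrite [X in (_ + X / _)%R](_ : _ =
    rho ^+ 2 * sqn y - 2 * r * (P.1 * y.1 + P.2 * y.2) - 2 * r ^+ 2 * sqn y +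
    r ^+ 2 * ((sqn w * sqn x + r ^+ 2 * sqn y + 2 * r * (P.1 * y.1 + P.2 * y.2)) / rho ^+ 2))%R; last first.
    by rewrite /P /sqn /cmul /=; field.
  move: (P.1 * y.1 + _)%R (sqn x) (sqn y) => Z X Y.
  rewrite rhoE; field.
  by rewrite w0 -rhoE gt_eqF.
under eq_integral do rewrite step1.
have cge0 : (0 <= rho ^+ 2 / sqn w)%R by rewrite divr_ge0 ?sqr_ge0 ?sqn_ge0.
rewrite ge0_integralZl//; last first.
- by move=> y _; exact: integral_ge0.
- exact: (measurable_fun_fubini_tonelli_G _ mF).
rewrite -(fubini_tonelli _ mF)// -ge0_integralZl//; last first.
- by move=> y _; exact: integral_ge0.
- exact: (measurable_fun_fubini_tonelli_F _ mF).
apply: eq_integral => u _.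
have s0 : (0 < Num.sqrt (sqn w))%R by rewrite sqrtr_gt0 lt0r w0 sqn_ge0.
set s := Num.sqrt (sqn w) in s0.
have s2 : (s ^+ 2 = sqn w)%R by rewrite sqr_sqrtr ?sqn_ge0.
have := @ge0_integral_cmulD _ (rho / s, 0)%R (- r * u.1 / s, - r * u.2 / s)%R
     (fun v => G ((rho * u.1, rho * u.2)%R, sqn u + sqn v)%R).
have -> : sqn (rho / s, 0)%R = (rho ^+ 2 / sqn w)%R.
  by rewrite /sqn /= expr_div_n expr0n addr0 s2.
rewrite mulf_neq0 ?invr_eq0 ?(gt_eqF rho20) ?w0// => /(_ isT) <-//; last first.
  apply: (measurableT_comp mG) => /=; apply: measurable_fun_pair => //=.
  by apply: measurable_funD => //; exact: measurable_sqn.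
congr (_ * _); apply: eq_integral => y _; rewrite /F /=.
congr G; congr pair; congr (_ + _)%R.
by rewrite -s2 /sqn /=; field; rewrite gt_eqF.
Qed.

End unitary.

Section rotation.
Context {R : realType}.
Local Notation mR := (measurableTypeR R).
Local Notation R2 := (measurableTypeR R * measurableTypeR R)%type.
Local Notation leb2 := (@leb2 R).
Local Notation pw := (power_measure leb2).

(** Bilinear: conjugates are put into [v] by the caller. Missing entries count as zero, so [lin
    [:: (r, 0)] z] sees only the first coordinate, whatever the length of [z]. *)
Fixpoint lin (v z : seq (R * R)) : R * R :=
  if (v, z) is (a :: v', x :: z') then
    ((cmul a x).1 + (lin v' z').1, (cmul a x).2 + (lin v' z').2)
  else (0, 0).

Definition nrm (z : seq (R * R)) : R := \sum_(x <- z) sqn x.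

Lemma nrm_ge0 z : 0 <= nrm z.
Proof. by apply: sumr_ge0 => x _; exact: sqn_ge0. Qed.

Lemma nrm_nil : nrm [::] = 0.
Proof. exact: big_nil. Qed.

Lemma nrm_cons x z : nrm (x :: z) = sqn x + nrm z.
Proof. by rewrite /nrm big_cons. Qed.

Lemma measurable_nrm n : measurable_fun setT (fun z : n.-tuple R2 => nrm z : mR).
Proof.
have -> : (fun z : n.-tuple R2 => nrm z : mR) =
    (fun z => \sum_(i < n) sqn (tnth z i) : R).
  by apply/funext => z; rewrite /nrm big_tuple.
by apply: measurable_sum => i; apply: (measurableT_comp measurable_sqn);
  exact: measurable_tnth.
Qed.

Lemma measurable_lin n v : measurable_fun setT (fun z : n.-tuple R2 => lin v z : R2).
Proof.
elim: n v => [|n IH] [|a v]; try exact: measurable_cst.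
  by rewrite (_ : (fun z => _) = cst (0, 0))//; apply/funext => z; rewrite tuple0.
have -> : (fun z : n.+1.-tuple R2 => lin (a :: v) z : R2) =
    (fun z => ((cmul a (thead z)).1 + (lin v [tuple of behead z]).1,
               (cmul a (thead z)).2 + (lin v [tuple of behead z]).2)).
  by apply/funext => z; rewrite [in LHS](tuple_eta z).
apply: (measurable_add2 (f := fun z : n.+1.-tuple R2 => cmul a (thead z))
   (g := fun z : n.+1.-tuple R2 => lin v [tuple of behead z])).
  by apply: measurable_cmul; exact: measurable_tnth.
by apply: (measurableT_comp (IH v)); exact: measurable_behead.
Qed.

Local Open Scope ereal_scope.

Lemma measurable_tuple_integral n (G : R2 * mR -> \bar R) :
  measurable_fun setT G -> (forall x, 0 <= G x) ->
  measurable_fun setT (fun p : R2 * mR =>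
    \int[pw n]_z G (p.1, (p.2 + nrm z)%R)).
Proof.
move=> mG G0.
apply: (measurable_fun_fubini_tonelli_F
  (fun q : (R2 * mR) * n.-tuple R2 => G (q.1.1, (q.1.2 + nrm q.2)%R))) => //.
apply: (measurableT_comp mG) => /=; apply: measurable_fun_pair => /=.
  exact: (measurableT_comp measurable_fst measurable_fst).
apply: measurable_funD; first exact: (measurableT_comp measurable_snd measurable_fst).
exact: (measurableT_comp (@measurable_nrm n) measurable_snd).
Qed.

Lemma measurable_lin_nrm n v (G : R2 * mR -> \bar R) : measurable_fun setT G ->
  measurable_fun setT (fun z : n.-tuple R2 => G (lin v z, nrm z)).
Proof.
move=> mG; apply: (measurableT_comp mG) => /=; apply: measurable_fun_pair.
  exact: measurable_lin.
exact: measurable_nrm.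
Qed.

(** Induction on the length: the tail of [v] is rotated into a single real coefficient, its norm,
    which [ge0_integral_rot2] then merges with the head. [G] stays arbitrary because it has to
    absorb the contribution of the head coordinate. *)
Lemma ge0_integral_rot n (v : seq (R * R)) (G : R2 * mR -> \bar R) :
  size v = n.+1 -> measurable_fun setT G -> (forall x, 0 <= G x) ->
  \int[pw n.+1]_z G (lin v z, nrm z) =
  \int[pw n.+1]_z G (lin [:: (Num.sqrt (nrm v), 0%R)] z, nrm z).
Proof.
have S m (w : seq (R * R)) (K : R2 * mR -> \bar R) : measurable_fun setT K -> (forall x, 0 <= K x) ->
    \int[pw m.+1]_z K (lin w z, nrm z) =
    \int[leb2]_x \int[pw m]_z K (lin w (x :: z), nrm (x :: z)).
  move=> mK K0; exact: (ge0_integral_powerS leb2 (measurable_lin_nrm w mK) (fun x => K0 _)).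
have lin1 (r : R) (x : R * R) (z : seq (R * R)) :
    lin [:: (r, 0%R)] (x :: z) = ((r * x.1)%R, (r * x.2)%R).
  by rewrite /lin /cmul /= !mul0r !addr0 subr0.
elim: n v G => [|n IH] [//|a v] G [sv] mG G0.
  apply: etrans (S _ _ _ mG G0) _; apply: etrans _ (esym (S _ _ _ mG G0)).
  pose Gh p := \int[pw 0]_z G (p.1, (p.2 + nrm z)%R).
  have mGh : measurable_fun setT Gh by exact: measurable_tuple_integral.
  have Gh0 x : 0 <= Gh x by exact: integral_ge0.
  have -> : v = [::] by case: (v) sv.
  rewrite (nrm_cons a) nrm_nil addr0.
  apply: etrans; last apply: etrans (ge0_integral_rot1 a mGh Gh0) _.
    apply: eq_integral => x _; apply: eq_integral => z _ /=.
    by rewrite nrm_cons !addr0.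
  apply: eq_integral => x _; apply: eq_integral => z _.
  by rewrite lin1 nrm_cons.
have r0 : (0 <= Num.sqrt (nrm v))%R by exact: sqrtr_ge0.
(* Integrating out the coordinates beyond the first two leaves a function of the linear form and of
   the norm of that pair, the shape treated by [ge0_integral_rot2]. *)
pose Gh p := \int[pw n]_z G (p.1, (p.2 + nrm z)%R).
have mGh : measurable_fun setT Gh by exact: measurable_tuple_integral.
have Gh0 x : 0 <= Gh x by exact: integral_ge0.
have rhoE : ((Num.sqrt (nrm (a :: v))) ^+ 2 = sqn a + (Num.sqrt (nrm v)) ^+ 2)%R.
  by rewrite !sqr_sqrtr ?nrm_ge0// nrm_cons.
apply: etrans (S _ _ _ mG G0) _; apply: etrans _ (esym (S _ _ _ mG G0)).
apply: etrans; last apply: etrans (ge0_integral_rot2 r0 (sqrtr_ge0 _) rhoE mGh Gh0) _.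
  apply: eq_integral => x _.
  pose Gx (p : R2 * mR) := G (((cmul a x).1 + p.1.1, (cmul a x).2 + p.1.2)%R, (sqn x + p.2)%R).
  have mGx : measurable_fun setT Gx.
    apply: (measurableT_comp mG) => /=; apply: measurable_fun_pair => /=.
      exact: (measurable_add2 (f := cst (cmul a x)) (g := fst)).
    exact: measurable_funD.
  have Gx0 p : 0 <= Gx p by exact: G0.
  transitivity (\int[pw n.+1]_z Gx (lin v z, nrm z)).
    by apply: eq_integral => z _; rewrite /Gx /= nrm_cons.
  apply: etrans (IH _ _ sv mGx Gx0) _.
  apply: etrans (S _ _ _ mGx Gx0) _.
  apply: eq_integral => y _; apply: eq_integral => z _.
  by rewrite lin1 /Gx /= nrm_cons -(addrA (sqn x) (sqn y)).
apply: eq_integral => x _.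
pose Gx (p : R2 * mR) := G ((Num.sqrt (nrm (a :: v)) * x.1, Num.sqrt (nrm (a :: v)) * x.2)%R, (sqn x + p.2)%R).
have mGx : measurable_fun setT Gx.
  have mx : measurable_fun setT (fun p : R2 * mR => (sqn x + p.2)%R : mR).
    exact: measurable_funD.
  have mc : measurable_fun setT (fun _ : R2 * mR =>
      (Num.sqrt (nrm (a :: v)) * x.1, Num.sqrt (nrm (a :: v)) * x.2)%R : R2) by [].
  exact: (measurableT_comp mG (measurable_fun_pair mc mx)).
have Gx0 p : 0 <= Gx p by exact: G0.
transitivity (\int[pw n.+1]_z Gx (lin [::] z, nrm z)); last first.
  by apply: eq_integral => z _; rewrite /Gx lin1 (nrm_cons x).
apply: etrans _ (esym (S _ _ _ mGx Gx0)).
apply: eq_integral => y _; apply: eq_integral => z _.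
by rewrite /Gx /= (nrm_cons y) -(addrA (sqn x) (sqn y)).
Qed.

End rotation.

(** * The law of the overlap with a fixed point *)

Section gaussian_tail.
Context {R : realType}.
Local Notation mu := (@lebesgue_measure R).
Local Notation mR := (measurableTypeR R).
Local Notation R2 := (measurableTypeR R * measurableTypeR R)%type.
Local Notation leb2 := (@leb2 R).

Lemma measurable_natr_bool (d : measure_display) (T : measurableType d) (b : T -> bool) :
  measurable_fun setT b -> measurable_fun setT (fun x => (b x)%:R : mR).
Proof.
move=> mb; have mn : measurable_fun [set: bool] (fun b : bool => b%:R : mR).
  by move=> _ Y _; exact: I.
exact: (measurableT_comp mn mb).
Qed.

Lemma measurable_expRN (d : measure_display) (T : measurableType d) (f : T -> mR) :
  measurable_fun setT f -> measurable_fun setT (fun x => expR (- f x) : mR).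
Proof.
move=> mf; apply: (measurableT_comp (@measurable_expR R)).
exact: (measurableT_comp (@oppr_measurable R setT) mf).
Qed.

Local Open Scope ereal_scope.

(** Dilation by [sqrt u]. The area of the unit disc stays symbolic and cancels in [gtail_exp]. *)
Lemma leb2_disc (u : R) : (0 <= u)%R ->
  leb2 [set x | (sqn x <= u)%R] = u%:E * leb2 [set x | (sqn x <= 1)%R].
Proof.
have mS v : measurable [set x : R2 | (sqn x <= v)%R].
  rewrite [X in measurable X](_ : _ = (fun x : R2 => sqn x : mR) @^-1` `]-oo, v]).
    by rewrite -[X in measurable X]setTI; exact: measurable_sqn.
  by apply/seteqP; split => x /=; rewrite in_itv.
have iE v : leb2 [set x | (sqn x <= v)%R] =
    \int[leb2]_x (\1_[set x | (sqn x <= v)%R] x)%:E.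
  by rewrite integral_indic// setIT.
rewrite le_eqVlt => /predU1P[<-|u0].
  rewrite mul0e (_ : [set _ | _] = [set 0%R] `*` [set 0%R]); last first.
    apply/seteqP; split => -[x y] /=; last by move=> [-> ->]; rewrite /sqn /= expr0n addr0.
    by rewrite le_eqVlt ltNge sqn_ge0 orbF sqn_eq0 => /eqP[-> ->].
  apply: etrans (product_measure1E _ _ _ _) _; try exact: measurable_set1.
  by rewrite [X in X * _]lebesgue_measure_set1 mul0e.
rewrite !iE.
have sa : sqn ((Num.sqrt u)%R, 0%R) = u by rewrite /sqn /= expr0n addr0 sqr_sqrtr// ltW.
have mi : measurable_fun setT (fun x : R2 => (\1_[set x | (sqn x <= u)%R] x)%:E : \bar R).
  by apply/measurable_EFinP; exact: measurable_indic.
have := @ge0_integral_cmulD _ ((Num.sqrt u)%R, 0%R) (0, 0)%R _ _ mi.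
rewrite sa gt_eqF// => <- //; congr (_ * _); apply: eq_integral => x _.
congr EFin; rewrite !indicE; congr (nat_of_bool _)%:R; apply/idP/idP; rewrite !inE /= !addr0;
  by rewrite -[sqn (_ - _, _)%R]/(sqn (cmul ((Num.sqrt u)%R, 0%R) x)) sqn_cmul sa
    -ler_pdivlMl// mulVf// gt_eqF.
Qed.

Definition gauss2 : \bar R := \int[leb2]_x (expR (- sqn x))%:E.

Lemma gauss2_lty : gauss2 < +oo.
Proof.
have mg : measurable_fun setT (fun x : R2 => (expR (- sqn x))%:E : \bar R).
  by apply/measurable_EFinP; apply: measurable_expRN; exact: measurable_sqn.
have g0 (x : R2) : 0 <= (expR (- sqn x))%:E :> \bar R by rewrite lee_fin expR_ge0.
apply: le_lt_trans (_ : \int[mu]_x \int[mu]_y (expR (- sqn (x, y)))%:E < +oo).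
  by rewrite le_eqVlt; apply/orP; left; apply/eqP; exact: (ge0_integral_prod mu mu mg g0).
have e x y : (expR (- sqn (x, y)))%:E = (gauss_fun x)%:E * (gauss_fun y)%:E :> \bar R.
  by rewrite -EFinM /gauss_fun -expRD /sqn opprD.
under eq_integral do under eq_integral do rewrite e.
have mf : measurable_fun setT (fun y : R => (gauss_fun y)%:E : \bar R).
  by apply/measurable_EFinP; exact: measurable_gauss_fun.
have f0 (y : R) : 0 <= (gauss_fun y)%:E :> \bar R by rewrite lee_fin gauss_fun_ge0.
under eq_integral do rewrite (ge0_integralZl mu measurableT mf (fun y _ => f0 y) (f0 _)) (@integralT_gauss R) muleC.
rewrite (ge0_integralZl mu measurableT mf (fun y _ => f0 y)) ?(@integralT_gauss R) -?EFinM ?ltry//.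
Qed.

Lemma leb2_disc1_lty : leb2 [set x | (sqn x <= 1)%R] < +oo.
Proof.
have mS : measurable [set x : R2 | (sqn x <= 1)%R].
  rewrite [X in measurable X](_ : _ = (fun x : R2 => sqn x : mR) @^-1` `]-oo, 1%R]).
    by rewrite -[X in measurable X]setTI; exact: measurable_sqn.
  by apply/seteqP; split => x /=; rewrite in_itv.
have sub : [set x : R2 | (sqn x <= 1)%R] `<=` `[(-1)%R, 1%R]%classic `*` `[(-1)%R, 1%R]%classic.
  move=> [x y]; rewrite /sqn /= !in_itv /= -!ler_norml => h; split.
    by rewrite -(@ler_pXn2r _ 2)// ?nnegrE// expr1n real_normK ?num_real// (le_trans _ h)// lerDl sqr_ge0.
  by rewrite -(@ler_pXn2r _ 2)// ?nnegrE// expr1n real_normK ?num_real// (le_trans _ h)// lerDr sqr_ge0.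
apply: (@le_lt_trans _ _ (leb2 (`[(-1)%R, 1%R]%classic `*` `[(-1)%R, 1%R]%classic))).
  by apply: le_measure => //; rewrite inE//; exact: measurableX.
apply: (@le_lt_trans _ _ (mu `[(-1)%R, 1%R]%classic * mu `[(-1)%R, 1%R]%classic)).
  by rewrite le_eqVlt; apply/orP; left; apply/eqP; exact: product_measure1E.
by rewrite lebesgue_measure_itv/=; case: ifP => _; rewrite ?mul0e ?ltry// -EFinD -EFinM ltry.
Qed.

Definition gtail (k : R) : \bar R :=
  \int[leb2]_x ((k < sqn x)%R%:R * expR (- sqn x))%:E.

Lemma leb2_annulus (k u : R) : (0 <= k)%R ->
  \int[leb2]_x ((k < sqn x)%R%:R * (sqn x <= k + u)%R%:R)%:E =
  (Num.max u 0)%:E * leb2 [set x | (sqn x <= 1)%R].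
Proof.
move=> k0.
have mS v : measurable [set x : R2 | (sqn x <= v)%R].
  rewrite [X in measurable X](_ : _ = (fun x : R2 => sqn x : mR) @^-1` `]-oo, v]).
    by rewrite -[X in measurable X]setTI; exact: measurable_sqn.
  by apply/seteqP; split => x /=; rewrite in_itv.
transitivity (\int[leb2]_x (\1_([set x : R2 | (sqn x <= k + u)%R] `\` [set x : R2 | (sqn x <= k)%R]) x)%:E).
  apply: eq_integral => x _; rewrite -natrM mulnb indicE in_setD andbC; congr (nat_of_bool (_ && _))%:R%:E.
    by apply/idP/idP; rewrite inE.
  by rewrite ltNge; congr negb; apply/idP/idP; rewrite inE.
rewrite integral_indic//; last exact: measurableD.
rewrite setIT; have [u0|u0] := leP u 0%R.
  rewrite mul0e (_ : _ `\` _ = set0) ?measure0//.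
  by apply/seteqP; split => x //= [h]; apply; rewrite (le_trans h)// gerDl.
have sub : [set x : R2 | (sqn x <= k)%R] `<=` [set x | (sqn x <= k + u)%R].
  by move=> x /= h; rewrite (le_trans h)// lerDl ltW.
have fin : leb2 [set x | (sqn x <= 1)%R] \is a fin_num.
  by rewrite ge0_fin_numE// leb2_disc1_lty.
have fin2 : leb2 [set x | (sqn x <= k + u)%R] < +oo.
  by rewrite leb2_disc ?addr_ge0 ?(ltW u0)// lte_mul_pinfty// ?lee_fin ?addr_ge0 ?(ltW u0)// leb2_disc1_lty.
apply: etrans (measureD (mS _) (mS _) fin2) _.
rewrite (setIidr sub).
apply: etrans (congr2 (fun a b => a - b) (leb2_disc (addr_ge0 k0 (ltW u0))) (leb2_disc k0)) _.
rewrite -(fineK fin) -!EFinM -EFinD; congr EFin; ring.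
Qed.

(** The squared modulus of a complex Gaussian is exponentially distributed; no polar coordinates are
    involved. Write [expR (- |x|^2)] as the integral of [expR (- u)] over [u >= |x|^2] and exchange
    the integrals: the annulus [k < |x|^2 <= u] has area proportional to [u - k], so shifting [u] by
    [k] extracts the factor [expR (- k)]. *)
Lemma gtail_exp (k : R) : (0 <= k)%R -> gtail k = (expR (- k))%:E * gtail 0.
Proof.
pose e := exponential_pdf (1 : R).
have me : measurable_fun setT e by exact: measurable_exponential_pdf.
have e0 u : (0 <= e u)%R by exact: exponential_pdf_ge0.
have eE u : e u = ((0 <= u)%R%:R * expR (- u))%R.
  rewrite /e; have [u0|u0] := leP 0%R u.
    by rewrite exponential_pdfE// mul1r mulN1r mul1r.
  by rewrite lt0_exponential_pdf// mul0r.
have mh x : measurable_fun setT (fun u : mR => ((x <= u)%R%:R * expR (- u))%:E : \bar R).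
  apply/measurable_EFinP; apply: measurable_funM; last exact: measurable_expRN.
  by apply: measurable_natr_bool; exact: measurable_fun_ler.
have h0 x u : 0 <= ((x <= u)%R%:R * expR (- u))%:E :> \bar R.
  by rewrite lee_fin mulr_ge0 ?expR_ge0.
have int_e x : \int[mu]_u ((x <= u)%R%:R * expR (- u))%:E = (expR (- x))%:E.
  rewrite -(ge0_integral_affine x (oner_neq0 R) (mh x) (h0 x)) normr1 mul1e.
  transitivity (\int[mu]_u ((expR (- x))%:E * (e u)%:E)).
    apply: eq_integral => u _; rewrite -EFinM eE mul1r lerDr; congr EFin.
    by rewrite opprD expRD; ring.
  have mE : measurable_fun setT (fun u : mR => (e u)%:E : \bar R) by exact/measurable_EFinP.
  rewrite (ge0_integralZl mu measurableT mE) ?lee_fin ?expR_ge0//.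
    by rewrite integral_exponential_pdf// mule1.
  by move=> u _; rewrite lee_fin.
suff main v : (0 <= v)%R -> gtail v = (expR (- v))%:E * \int[mu]_u ((expR (- u))%:E * ((Num.max u 0)%:E * leb2 [set x | (sqn x <= 1)%R])).
  by move=> k0; rewrite main// [X in _ = _ * X]main// oppr0 expR0 mul1e.
move=> v0.
pose F (z : R2 * mR) : \bar R := ((v < sqn z.1)%R%:R * (sqn z.1 <= z.2)%R%:R * expR (- z.2))%:E.
have mF : measurable_fun setT F.
  apply/measurable_EFinP; apply: measurable_funM; last exact: measurable_expRN.
  apply: measurable_funM; apply: measurable_natr_bool.
    by apply: measurable_fun_ltr => //; exact: (measurableT_comp measurable_sqn).
  by apply: measurable_fun_ler => //; exact: (measurableT_comp measurable_sqn).
have F0 z : 0 <= F z by rewrite lee_fin !mulr_ge0 ?expR_ge0.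
rewrite /gtail.
transitivity (\int[leb2]_x \int[mu]_u F (x, u)).
  apply: eq_integral => x _.
  rewrite EFinM -int_e -(ge0_integralZl mu measurableT (mh _) (fun u _ => h0 _ u)) ?lee_fin//.
  by apply: eq_integral => u _; rewrite -EFinM /F /= mulrA.
apply: etrans (fubini_tonelli (m1 := leb2) (m2 := mu) F mF F0) _.
transitivity (\int[mu]_u ((expR (- u))%:E * ((Num.max (u - v) 0)%:E * leb2 [set x | (sqn x <= 1)%R]))).
  apply: eq_integral => u _.
  rewrite -(leb2_annulus (u - v) v0).
  have ma : measurable_fun setT (fun x : R2 => ((v < sqn x)%R%:R * (sqn x <= v + (u - v))%R%:R)%:E : \bar R).
    apply/measurable_EFinP; apply: measurable_funM; apply: measurable_natr_bool.
      by apply: measurable_fun_ltr => //; exact: measurable_sqn.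
    by apply: measurable_fun_ler => //; exact: measurable_sqn.
  rewrite -(ge0_integralZl leb2 measurableT ma) ?lee_fin ?expR_ge0//.
  apply: eq_integral => x _; rewrite -EFinM /F /= addrC subrK; congr EFin; ring.
have fin : leb2 [set x | (sqn x <= 1)%R] \is a fin_num.
  by rewrite ge0_fin_numE// leb2_disc1_lty.
rewrite -(fineK fin); set a := fine _.
have a0 : (0 <= a)%R by exact: fine_ge0.
have mmax (w : R) : measurable_fun setT (fun u : mR => (Num.max (u + w) 0)%R : mR).
  by apply: measurable_maxr => //; exact: measurable_funD.
have mm (w : R) : measurable_fun setT (fun u : mR => (expR (- u))%:E * ((Num.max (u + w) 0)%:E * a%:E)).
  under eq_fun do rewrite -!EFinM.
  apply/measurable_EFinP; apply: measurable_funM; first exact: measurable_expRN.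
  by apply: measurable_funM; [exact: mmax|exact: measurable_cst].
have mm0 (w u : R) : 0 <= (expR (- u))%:E * ((Num.max (u + w) 0)%:E * a%:E) :> \bar R.
  by rewrite -!EFinM lee_fin !mulr_ge0 ?expR_ge0// le_max lexx orbT.
rewrite -(ge0_integral_affine v (oner_neq0 R) (mm (- v)%R) (mm0 (- v)%R)) normr1 mul1e.
have {mm}mm : measurable_fun setT (fun u : mR => (expR (- u))%:E * ((Num.max u 0)%:E * a%:E)).
  by have := mm 0%R; under eq_fun do rewrite addr0.
rewrite -(ge0_integralZl mu measurableT mm) ?lee_fin ?expR_ge0//; last first.
  by move=> u _; have := mm0 0%R u; rewrite addr0.
apply: eq_integral => u _; rewrite mul1r addrK [RHS]muleA; congr (_ * _).
by rewrite -EFinM -expRD opprD addrC.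
Qed.

End gaussian_tail.

Lemma mule_integral d (T : measurableType d) (R : realType)
    (m : {measure set T -> \bar R}) (f : T -> \bar R) (k : \bar R) :
  measurable_fun setT f -> (forall x, 0 <= f x)%E -> (0 <= k)%E ->
  (k * \int[m]_x f x = \int[m]_x (k * f x))%E.
Proof. by move=> mf f0 k0; rewrite ge0_integralZl. Qed.

Section positivity.
Context d (T : measurableType d) (R : realType) (m : {measure set T -> \bar R}).
Local Open Scope ereal_scope.

Lemma integral_gt0 (D : set T) (f : T -> \bar R) : measurable D ->
  measurable_fun setT f -> (forall x, 0 <= f x) -> (forall x, D x -> 0 < f x) ->
  0 < m D -> 0 < \int[m]_x f x.
Proof.
move=> mD mf f0 fD mD0; rewrite lt0e integral_ge0// andbT.
apply/negP => /eqP if0.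
have /(ae_eq_integral_abs m measurableT mf) [N [mN N0 sub]] : \int[m]_x `|f x| = 0.
  by rewrite -[RHS]if0; apply: eq_integral => x _; rewrite gee0_abs.
suff mD00 : m D = 0 by rewrite mD00 ltxx in mD0.
apply: (subset_measure0 mD mN _ N0) => x /fD fx; apply: sub => /= /(_ I) fx0.
by rewrite fx0 ltxx in fx.
Qed.

End positivity.

(** * Lifting chart integrals to Gaussian integrals *)

Section lift.
Context {R : realType}.
Local Notation mu := (@lebesgue_measure R).
Local Notation mR := (measurableTypeR R).
Local Notation R2 := (measurableTypeR R * measurableTypeR R)%type.
Local Notation leb2 := (@leb2 R).
Local Notation pw := (power_measure leb2).
Local Open Scope ereal_scope.

Lemma ge0_integral_lin_nrmS n (w : seq (R * R)) (K : R2 * mR -> \bar R) :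
  measurable_fun setT K -> (forall x, 0 <= K x) ->
  \int[pw n.+1]_z K (lin w z, nrm z) =
  \int[leb2]_x \int[pw n]_z K (lin w (x :: z), nrm (x :: z)).
Proof.
move=> mK K0; exact: (ge0_integral_powerS leb2 (measurable_lin_nrm w mK) (fun x => K0 _)).
Qed.

Lemma measurable_cons_lin n (b : R * R) (v : seq (R * R)) :
  measurable_fun setT (fun q : R2 * n.-tuple R2 =>
    (((cmul b q.1).1 + (lin v q.2).1)%R, ((cmul b q.1).2 + (lin v q.2).2)%R) : R2).
Proof.
have m1 : measurable_fun setT (fun q : R2 * n.-tuple R2 => cmul b q.1 : R2).
  exact: measurable_cmul.
have m2 : measurable_fun setT (fun q : R2 * n.-tuple R2 => lin v q.2 : R2).
  exact: (measurableT_comp (measurable_lin (n := n) v) measurable_snd).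
exact: (measurable_add2 m1 m2).
Qed.

Lemma measurable_cons_nrm n :
  measurable_fun setT (fun q : R2 * n.-tuple R2 => (sqn q.1 + nrm q.2)%R : mR).
Proof.
apply: measurable_funD; first exact: (measurableT_comp measurable_sqn measurable_fst).
exact: (measurableT_comp (@measurable_nrm _ n) measurable_snd).
Qed.

Lemma lebn_gt0 n : 0 < pw n setT.
Proof.
elim: n => [|n IH]; first by rewrite /= diracT lte01.
have -> : pw n.+1 setT = \int[leb2]_x pw n setT.
  have m1 : measurable_fun setT (fun _ : n.+1.-tuple R2 => 1 : \bar R) by [].
  have := ge0_integral_powerS leb2 m1 (fun=> lee01).
  rewrite integral_cst// mul1e => ->.
  by apply: eq_integral => x _; rewrite integral_cst// mul1e.
pose D : set R2 := `[0%R, 1%R]%classic `*` `[0%R, 1%R]%classic.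
apply: (@integral_gt0 _ _ _ _ D) => //.
  exact: measurableX.
have e : leb2 D = mu `[0%R, 1%R]%classic * mu `[0%R, 1%R]%classic by exact: product_measure1E.
suff : 0 < mu `[0%R, 1%R]%classic * mu `[0%R, 1%R]%classic by rewrite -e.
by rewrite lebesgue_measure_itv/= lte01 -EFinD -EFinM subr0 mul1r lte01.
Qed.

(** [lin] commutes with multiplication by a scalar, so all [n] coordinates are scaled at once, each
    with Jacobian [|a|^2]. *)
Lemma ge0_integral_scale n (v : seq (R * R)) (a : R * R) (K : R2 * mR -> \bar R) :
  size v = n -> sqn a != 0%R -> measurable_fun setT K -> (forall x, 0 <= K x) ->
  (sqn a ^+ n)%:E * \int[pw n]_z K (cmul a (lin v z), (sqn a * nrm z)%R) =
  \int[pw n]_z K (lin v z, nrm z).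
Proof.
move=> + sa; elim: n v K => [|n IH] [|b v]// K sv mK K0.
  rewrite expr0 mul1e; apply: eq_integral => z _.
  by rewrite (tuple0 z) /= nrm_nil /cmul /= !mulr0 subr0 addr0.
move: sv => [sv].
pose aK (p : R2 * mR) := K (cmul a p.1, (sqn a * p.2)%R).
have maK : measurable_fun setT aK.
  apply: (measurableT_comp mK) => /=; apply: measurable_fun_pair => /=.
    exact: measurable_cmul.
  exact: measurable_funM.
have aK0 p : 0 <= aK p by exact: K0.
rewrite -[X in _ * X]/(\int[pw n.+1]_z aK (lin (b :: v) z, nrm z)).
rewrite !ge0_integral_lin_nrmS//.
pose H (y : R2) := \int[pw n]_z K (((cmul b y).1 + (lin v z).1, (cmul b y).2 + (lin v z).2)%R, (sqn y + nrm z)%R).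
have mKK : measurable_fun setT (fun q : R2 * n.-tuple R2 =>
    K (((cmul b q.1).1 + (lin v q.2).1, (cmul b q.1).2 + (lin v q.2).2)%R, (sqn q.1 + nrm q.2)%R)).
  exact: (measurableT_comp mK (measurable_fun_pair (measurable_cons_lin (n := n) b v) (@measurable_cons_nrm n))).
have mH : measurable_fun setT H.
  exact: (measurable_fun_fubini_tonelli_F _ mKK (fun x => K0 _)).
have H0 y : 0 <= H y by exact: integral_ge0.
transitivity (\int[leb2]_x H x); last first.
  by apply: eq_integral => x _; apply: eq_integral => z _; rewrite nrm_cons.
have := ge0_integral_cmulD (0, 0)%R sa mH H0 => <-.
rewrite exprS EFinM -muleA; congr (_ * _).
rewrite -ge0_integralZl//; last first.
- by rewrite lee_fin exprn_ge0// sqn_ge0.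
- by move=> x _; exact: integral_ge0.
- have mK' := measurableT_comp mKK (measurable_fun_pair
    (measurable_cmul a (@measurable_fst _ _ R2 (n.-tuple R2))) measurable_snd).
  pose aKK (q : R2 * n.-tuple R2) := aK (lin (b :: v) (q.1 :: q.2), nrm (q.1 :: q.2)).
  have maKK : measurable_fun setT aKK.
    have := measurableT_comp maK (measurable_fun_pair (measurable_cons_lin (n := n) b v) (@measurable_cons_nrm n)).
    by apply: eq_measurable_fun => q _; rewrite /aKK nrm_cons.
  exact: (measurable_fun_fubini_tonelli_F _ maKK (fun x => aK0 _)).
apply: eq_integral => x _.
transitivity (H (cmul a x)); last by rewrite /= !addr0.
pose Kx (p : R2 * mR) := K (((cmul b (cmul a x)).1 + p.1.1, (cmul b (cmul a x)).2 + p.1.2)%R, (sqn (cmul a x) + p.2)%R).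
have mKx : measurable_fun setT Kx.
  apply: (measurableT_comp mK) => /=; apply: measurable_fun_pair => /=.
    exact: (measurable_add2 (f := cst (cmul b (cmul a x))) (g := fst)).
  exact: measurable_funD.
rewrite /H -[RHS](IH v Kx sv mKx (fun=> K0 _)); congr (_ * _); apply: eq_integral => z _.
rewrite /aK /Kx /= nrm_cons sqn_cmul; congr K; congr pair; last by ring.
by rewrite /cmul /=; congr pair; ring.
Qed.

(** With [p.1] a linear form in [z] and [p.2 = |z|^2], the condition is the homogeneous version of a
    squared overlap exceeding [s]: it is constant on complex lines, hence descends to projective
    space. *)
Definition wt (s : R) (p : R2 * mR) : \bar R :=
  ((s * p.2 < sqn p.1)%R%:R * expR (- p.2))%:E.

Lemma wt_ge0 s p : 0 <= wt s p.
Proof. by rewrite lee_fin mulr_ge0 ?expR_ge0. Qed.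

Lemma measurable_wt s : measurable_fun setT (wt s).
Proof.
apply/measurable_EFinP; apply: measurable_funM; last exact: measurable_expRN.
apply: measurable_natr_bool; apply: measurable_fun_ltr.
  exact: measurable_funM.
exact: (measurableT_comp measurable_sqn measurable_fst).
Qed.

(** The integral over the fibre coordinate [x] of a line; [sqn x ^+ d] is the Jacobian of [z -> x z]
    on [C^d]. *)
Definition radial_mass (d : nat) : \bar R :=
  \int[leb2]_x (sqn x ^+ d * expR (- sqn x))%:E.

Lemma measurable_radial d : measurable_fun setT
  (fun x : R2 => (sqn x ^+ d * expR (- sqn x))%:E : \bar R).
Proof.
apply/measurable_EFinP; apply: measurable_funM.
  by apply: measurable_funX; exact: measurable_sqn.
by apply: measurable_expRN; exact: measurable_sqn.
Qed.

Lemma radial_ge0 d (x : R2) : 0 <= (sqn x ^+ d * expR (- sqn x))%:E.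
Proof. by rewrite lee_fin mulr_ge0 ?expR_ge0 ?exprn_ge0 ?sqn_ge0. Qed.

Lemma radial_mass_gt0 d : 0 < radial_mass d.
Proof.
pose D : set R2 := `[1%R, 2%R]%classic `*` `[0%R, 1%R]%classic.
apply: (@integral_gt0 _ _ _ _ D).
- exact: measurableX.
- exact: measurable_radial.
- exact: radial_ge0.
- move=> x [] /=; rewrite !in_itv /= => /andP[x1 _] _.
  rewrite lte_fin mulr_gt0 ?expR_gt0// exprn_gt0// /sqn.
  by rewrite ltr_pwDl ?sqr_ge0// exprn_gt0// (lt_le_trans _ x1).
have e : leb2 D = mu `[1%R, 2%R]%classic * mu `[0%R, 1%R]%classic by exact: product_measure1E.
suff : 0 < mu `[1%R, 2%R]%classic * mu `[0%R, 1%R]%classic by rewrite -e.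
rewrite !lebesgue_measure_itv/= !lte_fin ltr1n ltr01 -!EFinD -EFinM subr0 mulr1 lte_fin.
by rewrite subr_gt0 ltr1n.
Qed.

Lemma radial_mass_scale d (t : R) : (0 < t)%R ->
  \int[leb2]_x (sqn x ^+ d * expR (- (sqn x * t)))%:E = radial_mass d * ((t ^+ d.+1)^-1)%:E.
Proof.
move=> t0.
have sa : sqn ((Num.sqrt t)%R, 0%R) = t by rewrite /sqn /= expr0n addr0 sqr_sqrtr// ltW.
have := @ge0_integral_cmulD _ ((Num.sqrt t)%R, 0%R) (0, 0)%R _ _ (measurable_radial d) (radial_ge0 d).
rewrite sa gt_eqF// => /(_ isT) h.
have mf : measurable_fun setT (fun x : R2 => (sqn x ^+ d * expR (- (sqn x * t)))%:E : \bar R).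
  apply/measurable_EFinP; apply: measurable_funM.
    by apply: measurable_funX; exact: measurable_sqn.
  by apply: measurable_expRN; apply: measurable_funM => //; exact: measurable_sqn.
rewrite /radial_mass -h muleAC -EFinM exprS invfM mulrA mulfV ?gt_eqF// mul1r.
rewrite muleC -ge0_integralZr//; last first.
- by rewrite lee_fin invr_ge0 exprn_ge0// ltW.
- by move=> x _; rewrite lee_fin mulr_ge0 ?expR_ge0 ?exprn_ge0 ?sqn_ge0.
- have := measurableT_comp (measurable_radial d) (measurable_cmulD ((Num.sqrt t)%R, 0%R) (0,0)%R).
  by [].
apply: eq_integral => x _.
have -> : sqn (((cmul ((Num.sqrt t)%R, 0%R) x).1 + 0)%R, ((cmul ((Num.sqrt t)%R, 0%R) x).2 + 0)%R) = (t * sqn x)%R.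
  by rewrite !addr0 -[sqn (_, _)]/(sqn (cmul ((Num.sqrt t)%R, 0%R) x)) sqn_cmul sa.
rewrite exprMn.
rewrite -EFinM; congr EFin; rewrite (mulrC t (sqn x)).
have : (t ^+ d != 0)%R by rewrite expf_neq0// gt_eqF.
by move: (t ^+ d)%R => u u0; field.
Qed.

(* Substituting (g_0, g_0 z) for (g_0, g') in a Gaussian integral over C^(d+1)
   produces the chart density (1 + |z|^2)^-(d+1). *)
Lemma integral_wt_lift d (a : R * R) (w : seq (R * R)) (s : R) : size w = d ->
  \int[pw d.+1]_z wt s (lin (a :: w) z, nrm z) =
  radial_mass d * \int[pw d]_z
    ((s * (1 + nrm z) < sqn (a.1 + (lin w z).1, a.2 + (lin w z).2))%R%:R
     / (1 + nrm z) ^+ d.+1)%:E.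
Proof.
move=> sw.
rewrite ge0_integral_lin_nrmS//; [|exact: measurable_wt|exact: wt_ge0].
pose b (z : d.-tuple R2) := (s * (1 + nrm z) < sqn (a.1 + (lin w z).1, a.2 + (lin w z).2))%R.
have mn : measurable_fun setT (fun z : d.-tuple R2 => 1 + nrm z : mR)%R.
  by apply: measurable_funD => //; exact: measurable_nrm.
have mb : measurable_fun setT b.
  apply: measurable_fun_ltr; first exact: measurable_funM.
  apply: (measurableT_comp measurable_sqn).
  exact: (measurable_add2 (f := cst a) (measurable_cst _ ) (measurable_lin (n := d) w)).
have n1 (z : d.-tuple R2) : (0 < 1 + nrm z)%R by rewrite ltr_pwDl// nrm_ge0.
pose F (q : R2 * d.-tuple R2) : \bar R :=
  ((b q.2)%:R * (sqn q.1 ^+ d * expR (- (sqn q.1 * (1 + nrm q.2)))))%:E.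
have mF : measurable_fun setT F.
  apply/measurable_EFinP; apply: measurable_funM.
    apply: measurable_natr_bool; exact: (measurableT_comp mb measurable_snd).
  apply: measurable_funM.
    by apply: measurable_funX; exact: (measurableT_comp measurable_sqn measurable_fst).
  apply: measurable_expRN; apply: measurable_funM.
    exact: (measurableT_comp measurable_sqn measurable_fst).
  exact: (measurableT_comp mn measurable_snd).
have F0 q : 0 <= F q by rewrite lee_fin !mulr_ge0 ?expR_ge0 ?exprn_ge0 ?sqn_ge0.
transitivity (\int[leb2]_x \int[pw d]_z F (x, z)).
  (* The substitution by multiples of [x] fails at [x = 0], a null set, so the inner integrals agree
     only almost everywhere. *)
  pose N : set R2 := [set 0%R] `*` [set 0%R].
  have mN : measurable N by apply: measurableX; exact: measurable_set1.
  have N0 : leb2 N = 0.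
    apply: etrans (product_measure1E _ _ _ _) _; try exact: measurable_set1.
    by rewrite [X in X * _]lebesgue_measure_set1 mul0e.
  have mL : measurable_fun setT (fun q : R2 * d.-tuple R2 => wt s (lin (a :: w) (q.1 :: q.2), nrm (q.1 :: q.2))).
    have := measurableT_comp (measurable_wt s) (measurable_fun_pair (measurable_cons_lin (n := d) a w) (@measurable_cons_nrm d)).
    by apply: eq_measurable_fun => q _ /=; rewrite nrm_cons.
  apply: ge0_ae_eq_integral => //.
  - exact: (measurable_fun_fubini_tonelli_F _ mL (fun x => wt_ge0 _ _)).
  - exact: (measurable_fun_fubini_tonelli_F _ mF F0).
  - by move=> x _; apply: integral_ge0 => z _; exact: wt_ge0.
  - by move=> x _; exact: integral_ge0.
  exists N; split => // x /= /not_implyP[_]; apply: contra_notP => xN.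
  have sx : sqn x != 0%R.
    by apply/eqP => sx; apply: xN; move/eqP: sx; rewrite sqn_eq0 => /eqP ->; split.
  pose K (p : R2 * mR) := wt s (((cmul a x).1 + p.1.1, (cmul a x).2 + p.1.2)%R, (sqn x + p.2)%R).
  have mK : measurable_fun setT K.
    apply: (measurableT_comp (measurable_wt s)) => /=; apply: measurable_fun_pair => /=.
      exact: (measurable_add2 (f := cst (cmul a x)) (g := fst)).
    exact: measurable_funD.
  have K0 p : 0 <= K p by exact: wt_ge0.
  transitivity (\int[pw d]_z K (lin w z, nrm z)).
    by apply: eq_integral => z _; rewrite nrm_cons.
  apply: etrans (esym (ge0_integral_scale sw sx mK K0)) _.
  have mKs : measurable_fun setT (fun z : d.-tuple R2 => K (cmul x (lin w z), (sqn x * nrm z)%R)).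
    apply: (measurableT_comp mK) => /=; apply: measurable_fun_pair => /=.
      by apply: measurable_cmul; exact: measurable_lin.
    by apply: measurable_funM => //; exact: measurable_nrm.
  apply: etrans (mule_integral _ mKs (fun=> K0 _) (_ : 0 <= (sqn x ^+ d)%:E)) _; first by rewrite lee_fin exprn_ge0// sqn_ge0.
  apply: etrans (erefl _) _.
  apply: eq_integral => z _; rewrite /K /wt /F /= -EFinM; congr EFin.
  have -> : (((cmul a x).1 + (x.1 * (lin w z).1 - x.2 * (lin w z).2))%R,
     ((cmul a x).2 + (x.1 * (lin w z).2 + x.2 * (lin w z).1))%R) =
     cmul x ((a.1 + (lin w z).1)%R, (a.2 + (lin w z).2)%R).
    by rewrite /cmul /=; congr pair; ring.
  have -> : (sqn x + sqn x * nrm z = sqn x * (1 + nrm z))%R by rewrite mulrDr mulr1.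
  rewrite sqn_cmul [(s * _)%R]mulrCA ltr_pM2l; last by rewrite lt0r sx sqn_ge0.
  exact: mulrCA.
apply: etrans (fubini_tonelli (m1 := leb2) (m2 := pw d) F mF F0) _.
have mJ : measurable_fun setT (fun z : d.-tuple R2 => ((b z)%:R / (1 + nrm z) ^+ d.+1)%:E : \bar R).
  apply/measurable_EFinP; apply: measurable_funM; first exact: measurable_natr_bool.
  have -> : (fun z : d.-tuple R2 => ((1 + nrm z) ^+ d.+1)^-1)%R = (fun z : d.-tuple R2 => powR ((1 + nrm z) ^+ d.+1) (-1)).
    by apply/funext => z; rewrite powR_inv1// exprn_ge0// ltW.
  by apply: (measurableT_comp (measurable_powR _)); exact: measurable_funX.
have J0 (z : d.-tuple R2) : 0 <= ((b z)%:R / (1 + nrm z) ^+ d.+1)%:E.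
  by rewrite lee_fin mulr_ge0// invr_ge0 exprn_ge0// ltW.
apply: etrans _ (esym (mule_integral _ mJ J0 (ltW (radial_mass_gt0 d)))).
apply: eq_integral => z _.
rewrite EFinM muleCA -radial_mass_scale//.
have mR : measurable_fun setT (fun x : R2 => (sqn x ^+ d * expR (- (sqn x * (1 + nrm z))))%:E : \bar R).
  apply/measurable_EFinP; apply: measurable_funM.
    by apply: measurable_funX; exact: measurable_sqn.
  by apply: measurable_expRN; apply: measurable_funM => //; exact: measurable_sqn.
have R0 (x : R2) : 0 <= (sqn x ^+ d * expR (- (sqn x * (1 + nrm z))))%:E.
  by rewrite lee_fin mulr_ge0 ?expR_ge0 ?exprn_ge0 ?sqn_ge0.
apply: etrans _ (esym (mule_integral _ mR R0 (_ : 0 <= (b z)%:R%:E))); last by rewrite lee_fin.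
by apply: eq_integral => x _; rewrite -EFinM.
Qed.

End lift.

(** * The volume of a ball *)

Section ball_volume.
Context {R : realType}.
Local Notation mR := (measurableTypeR R).
Local Notation R2 := (measurableTypeR R * measurableTypeR R)%type.
Local Notation leb2 := (@leb2 R).
Local Notation pw := (power_measure leb2).

Section gauss.
Local Open Scope ereal_scope.

Definition gaussn (n : nat) : \bar R := \int[pw n]_z (expR (- nrm z))%:E.

Lemma measurable_gaussn n :
  measurable_fun setT (fun z : n.-tuple R2 => (expR (- nrm z))%:E : \bar R).
Proof. by apply/measurable_EFinP; apply: measurable_expRN; exact: measurable_nrm. Qed.

Lemma gaussn_gt0 n : 0 < gaussn n.
Proof.
apply: (@integral_gt0 _ _ _ _ setT) => //.
- exact: measurable_gaussn.
- by move=> x _; rewrite lte_fin expR_gt0.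
- exact: lebn_gt0.
Qed.

Lemma measurable_gauss2 :
  measurable_fun setT (fun x : R2 => (expR (- sqn x))%:E : \bar R).
Proof. by apply/measurable_EFinP; apply: measurable_expRN; exact: measurable_sqn. Qed.

Lemma expRN_ge0 (x : R) : 0 <= (expR (- x))%:E :> \bar R.
Proof. by rewrite lee_fin expR_ge0. Qed.

Lemma gauss2_ge0 : 0 <= @gauss2 R.
Proof. by apply: integral_ge0 => x _; exact: expRN_ge0. Qed.

Lemma gaussnS n : gaussn n.+1 = @gauss2 R * gaussn n.
Proof.
apply: etrans (ge0_integral_powerS leb2 (@measurable_gaussn n.+1) (fun=> expRN_ge0 _)) _.
transitivity (\int[leb2]_x (gaussn n * (expR (- sqn x))%:E)).
  apply: eq_integral => x _.
  rewrite muleC; apply: etrans _ (esym (mule_integral _ (@measurable_gaussn n) (fun=> expRN_ge0 _) (expRN_ge0 _))).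
  by apply: eq_integral => z _; rewrite nrm_cons opprD expRD EFinM.
rewrite muleC; apply/esym.
exact: (mule_integral _ measurable_gauss2 (fun=> expRN_ge0 _) (ltW (gaussn_gt0 n))).
Qed.

Lemma gaussn_lty n : gaussn n < +oo.
Proof.
elim: n => [|n IH]; last first.
  rewrite gaussnS lte_mul_pinfty// ?gauss2_ge0//.
  by rewrite ge0_fin_numE ?gauss2_lty// gauss2_ge0.
rewrite /gaussn integral_dirac//; last exact: measurable_gaussn.
by rewrite diracT mul1e ltry.
Qed.

Lemma gtail0 : @gtail R 0%R = @gauss2 R.
Proof.
apply: ge0_ae_eq_integral => //.
- apply/measurable_EFinP; apply: measurable_funM.
    by apply: measurable_natr_bool; apply: measurable_fun_ltr => //; exact: measurable_sqn.
  by apply: measurable_expRN; exact: measurable_sqn.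
- exact: measurable_gauss2.
exists ([set 0%R] `*` [set 0%R]); split.
- by apply: measurableX; exact: measurable_set1.
- apply: etrans (product_measure1E _ _ _ _) _; try exact: measurable_set1.
  by rewrite [X in X * _]lebesgue_measure_set1 mul0e.
move=> x /= /not_implyP[_]; apply: contra_notP => xN.
rewrite lt0r sqn_ge0 andbT (_ : sqn x != 0%R) ?mul1r//.
by apply/eqP => sx; apply: xN; move/eqP: sx; rewrite sqn_eq0 => /eqP ->; split.
Qed.

(** On the axis the condition reads [|x|^2 > s / (1 - s) |z|^2]. By [gtail_exp] integrating over [x]
    turns the Gaussian in [z] into [expR (- |z|^2 / (1 - s))], and dilating the remaining [d]
    coordinates yields [(1 - s)^d]. *)
Lemma integral_wt_axis d (s : R) : (0 <= s < 1)%R ->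
  \int[pw d.+1]_z wt s (lin [:: (1%R, 0%R)] z, nrm z) =
  ((1 - s) ^+ d)%:E * gaussn d.+1.
Proof.
move=> /andP[s0 s1]; have s1' : (0 < 1 - s)%R by rewrite subr_gt0.
apply: etrans (ge0_integral_lin_nrmS _ _ (measurable_wt s) (@wt_ge0 _ s)) _.
pose F (q : R2 * d.-tuple R2) := wt s (q.1, (sqn q.1 + nrm q.2)%R).
have mF : measurable_fun setT F.
  exact: (measurableT_comp (measurable_wt s) (measurable_fun_pair measurable_fst (@measurable_cons_nrm _ d))).
have F0 q : 0 <= F q by exact: wt_ge0.
transitivity (\int[leb2]_x \int[pw d]_z F (x, z)).
  apply: eq_integral => x _; apply: eq_integral => z _.
  rewrite /F nrm_cons; congr wt; congr pair.
  by rewrite [LHS]surjective_pairing /cmul /= !mul0r !mul1r !addr0 subr0 -surjective_pairing.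
apply: etrans (fubini_tonelli (m1 := leb2) (m2 := pw d) F mF F0) _.
transitivity (\int[pw d]_z (@gauss2 R * (expR (- (nrm z / (1 - s))))%:E)).
  apply: eq_integral => z _.
  have k0 : (0 <= s / (1 - s) * nrm z)%R by rewrite !mulr_ge0 ?nrm_ge0// invr_ge0 ltW.
  transitivity ((expR (- nrm z))%:E * gtail (s / (1 - s) * nrm z)).
    have mt : measurable_fun setT (fun x : R2 => ((s / (1 - s) * nrm z < sqn x)%R%:R * expR (- sqn x))%:E : \bar R).
      apply/measurable_EFinP; apply: measurable_funM.
        by apply: measurable_natr_bool; apply: measurable_fun_ltr => //; exact: measurable_sqn.
      by apply: measurable_expRN; exact: measurable_sqn.
    have t0 (x : R2) : 0 <= ((s / (1 - s) * nrm z < sqn x)%R%:R * expR (- sqn x))%:E :> \bar R.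
      by rewrite lee_fin mulr_ge0 ?expR_ge0.
    apply: etrans _ (esym (mule_integral _ mt t0 (expRN_ge0 _))).
    apply: eq_integral => x _; rewrite /F /wt /= -EFinM; congr EFin.
    rewrite opprD expRD [RHS]mulrCA [(expR (- nrm z) * _)%R]mulrC; congr ((nat_of_bool _)%:R * _)%R.
    rewrite mulrDr -ltrBrDl -[X in (X - _)%R]mul1r -mulrBl.
    by rewrite mulrAC ltr_pdivrMr// [(sqn x * _)%R]mulrC.
  rewrite gtail_exp// gtail0 muleA muleC -EFinM -expRD; congr (_ * (expR _)%:E).
  by field; rewrite gt_eqF.
have mG : measurable_fun setT (fun z : d.-tuple R2 => (expR (- (nrm z / (1 - s))))%:E : \bar R).
  apply/measurable_EFinP; apply: measurable_expRN; apply: measurable_funM => //.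
  exact: measurable_nrm.
apply: etrans (esym (mule_integral _ mG (fun=> expRN_ge0 _) gauss2_ge0)) _.
rewrite gaussnS muleCA; congr (_ * _).
pose a : R * R := (Num.sqrt (1 - s), 0)%R.
have sa : sqn a = (1 - s)%R by rewrite /sqn /= expr0n addr0 sqr_sqrtr// ltW.
pose K (p : R2 * mR) : \bar R := (expR (- (p.2 / (1 - s))))%:E.
have mK : measurable_fun setT K.
  by apply/measurable_EFinP; apply: measurable_expRN; apply: measurable_funM.
have K0 p : 0 <= K p by rewrite lee_fin expR_ge0.
have sa0 : sqn a != 0%R by rewrite sa gt_eqF.
apply: etrans (esym (ge0_integral_scale (size_nseq d (0%R, 0%R)) sa0 mK K0)) _.
rewrite sa; congr (_ * _); apply: eq_integral => z _; rewrite /K /=.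
by rewrite mulrAC mulfV ?mul1r// gt_eqF.
Qed.

End gauss.

(** The Hermitian product is antilinear in the chart variable while [lin] is linear. Conjugating the
    fixed vector makes [lin] compute the conjugate of that product, which has the same modulus. *)
Definition conjpair (x : R[i]) : R * R := (complex.Re x, - complex.Im x).

Lemma lin_sum n (v z : n.-tuple (R * R)) :
  lin v z = (\sum_(i < n) (cmul (tnth v i) (tnth z i)).1,
             \sum_(i < n) (cmul (tnth v i) (tnth z i)).2).
Proof.
elim: n v z => [|n IH] v z; first by rewrite tuple0 !big_ord0.
case/tupleP: v => a v; case/tupleP: z => x z.
rewrite !big_ord_recl /= IH /= !tnth0.
by congr (_ + _, _ + _); apply: eq_bigr => i _; rewrite !tnthS.
Qed.

Definition ov d (p q : CP R d) : R := complex.Re (overlap p q).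

Variable d : nat.

Definition ucoord (p : CP R d) : d.-tuple (R * R) :=
  [tuple conjpair (normalize (repr_vec p) 0 (lift ord0 i)) | i < d].

Definition ucoord0 (p : CP R d) : R * R := conjpair (normalize (repr_vec p) 0 ord0).

Lemma nrm_ucoord (p : CP R d) : nrm (ucoord0 p :: ucoord p) = 1.
Proof.
have /(congr1 (@complex.Re R)) := dotmx_normalize1 (repr_vec_neq0 p).
rewrite dotmxE mxE raddf_sum/= big_ord_recl => <-.
have e (x : R[i]) : complex.Re (x * x^*%C) = sqn (conjpair x).
  by case: x => a b; rewrite /sqn /=; ring.
rewrite nrm_cons /nrm (big_tuple _ _ (ucoord p)); congr (_ + _).
  by rewrite [X in _ * X]mxE [X in _ * X^*%C]mxE e.
by apply: eq_bigr => i _; rewrite tnth_mktuple [X in _ * X]mxE [X in _ * X^*%C]mxE e.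
Qed.

Lemma lt_ov2_chart (p : CP R d) (z : d.-tuple R2) (s : R) :
  (s < ov p (chart z) ^+ 2) =
  (s * (1 + nrm z) < sqn ((ucoord0 p).1 + (lin (ucoord p) z).1,
                          (ucoord0 p).2 + (lin (ucoord p) z).2)).
Proof.
rewrite /ov Re_overlap_chart.
set u := (X in complex.Re X).
have -> : (1 + \sum_(i < d) (((tnth z i).1 : R) ^+ 2 + ((tnth z i).2 : R) ^+ 2)) = 1 + nrm z.
  by rewrite /nrm big_tuple.
have n1 : 0 < 1 + nrm z by rewrite ltr_pwDl// nrm_ge0.
rewrite sqr_sqrtr; last by rewrite divr_ge0 ?(ltW n1)// addr_ge0 ?sqr_ge0.
rewrite ltr_pdivlMr//; congr (_ < _).
rewrite lin_sum /= -(sqrrN (complex.Im u)) /sqn /=; congr (_ ^+ 2 + _ ^+ 2).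
  rewrite /u raddfD raddf_sum /=; congr (_ + _); apply: eq_bigr => i _.
  by rewrite tnth_mktuple; case: (normalize _ _ _) => a b /=; ring.
rewrite /u raddfD raddf_sum /= opprD -sumrN; congr (_ + _); apply: eq_bigr => i _.
by rewrite tnth_mktuple; case: (normalize _ _ _) => a b /=; ring.
Qed.

Local Open Scope ereal_scope.

(** The lift makes the integrand a function of the linear form of [p] and of the norm; as the vector
    of [p] is a unit vector, rotation replaces it by the first basis vector and the dependence on
    [p] disappears. *)
Lemma FSvolume_ov2 (p : CP R d) (s : R) :
  radial_mass d * FSvolume [set q | (s < ov p q ^+ 2)%R] =
  \int[pw d.+1]_z wt s (lin [:: (1%R, 0%R)] z, nrm z).
Proof.
have sz : size (ucoord0 p :: ucoord p) = d.+1 by rewrite /= (size_tuple (ucoord p)).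
have := ge0_integral_rot sz (measurable_wt s) (@wt_ge0 _ s).
rewrite nrm_ucoord sqrtr1 => <-.
rewrite integral_wt_lift ?(size_tuple (ucoord p))//; congr (_ * _).
rewrite /FSvolume integral_mkcond; apply: eq_integral => z _.
rewrite patchE; have -> : (z \in @chart R d @^-1` [set q | (s < ov p q ^+ 2)%R]) = (s < ov p (chart z) ^+ 2)%R.
  by apply/idP/idP; rewrite inE.
rewrite lt_ov2_chart /FSdensity.
have -> : FSform z = (1 + nrm z)%R by congr (_ + _)%R; rewrite /nrm [RHS]big_tuple.
by case: (_ < _)%R; rewrite ?mul1r ?mul0r.
Qed.

(** The whole space is the case [s = -1], where the condition in [wt] fails only at the origin.
    Instead of discarding that point, the integral is squeezed between the one with [s = 0], known
    from [integral_wt_axis], and the full Gaussian. *)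
Lemma FSvolumeT : radial_mass d * FSvolume [set: CP R d] = gaussn d.+1.
Proof.
pose p : CP R d := point.
have -> : [set: CP R d] = [set q | (-1 < ov p q ^+ 2)%R].
  by apply/seteqP; split => q //= _; rewrite (lt_le_trans _ (sqr_ge0 _))// ltrN10.
have mw t : measurable_fun setT (fun z : d.+1.-tuple R2 => wt t (lin [:: (1%R, 0%R)] z, nrm z)).
  exact: measurable_lin_nrm (measurable_wt t).
rewrite FSvolume_ov2; apply/eqP; rewrite eq_le; apply/andP; split.
  apply: ge0_le_integral => //.
  - by move=> z _; exact: wt_ge0.
  - exact: measurable_gaussn.
  move=> z _; rewrite lee_fin ler_piMl ?expR_ge0//.
  by case: (_ < _)%R.
have -> : gaussn d.+1 = \int[pw d.+1]_z wt 0 (lin [:: (1%R, 0%R)] z, nrm z).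
  by rewrite integral_wt_axis ?lexx ?ltr01// subr0 expr1n mul1e.
apply: (ge0_le_integral _ measurableT (fun z _ => wt_ge0 0 _) (mw 0%R) (mw (-1)%R)).
move=> z _; rewrite /wt lee_fin ler_wpM2r ?expR_ge0// ler_nat.
rewrite mul0r; case: (ltP 0%R _) => //= h.
by rewrite (le_lt_trans _ h)// mulN1r oppr_le0 nrm_ge0.
Qed.

Lemma FSvolumeT_itv : 0 < FSvolume [set: CP R d] < +oo.
Proof.
have := FSvolumeT; have := gaussn_lty d.+1; have := gaussn_gt0 d.+1.
have r0 := radial_mass_gt0 (R := R) d.
have : 0 <= FSvolume [set: CP R d] by exact: measure_ge0.
case: (FSvolume _) => [v| |]//.
  rewrite lee_fin le_eqVlt => /predU1P[<-|v0 _ _ _]; last by rewrite lte_fin v0 ltry.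
  by rewrite mule0 => /[swap] _ /[swap] <-; rewrite ltxx.
by rewrite gt0_muley// => _ _ /[swap] <-; rewrite ltxx.
Qed.

(** The squared overlap with a fixed point has the Beta law with parameters 1 and [d]. The factor
    [radial_mass d] is common to the ball and to the whole space and cancels on normalization. *)
Lemma vol_ov2 (p : CP R d) (s : R) : (0 <= s < 1)%R ->
  vol R d [set q | (s < ov p q ^+ 2)%R] = ((1 - s) ^+ d)%:E.
Proof.
move=> s01; rewrite /vol /= /mnormalize.
have /andP[v0 voo] := FSvolumeT_itv.
have := FSvolumeT; have g0 := gaussn_gt0 d.+1; have goo := gaussn_lty d.+1.
have := FSvolume_ov2 p s; rewrite integral_wt_axis//.
rewrite (gt_eqF v0) (lt_eqF voo)/=.
have r0 := radial_mass_gt0 (R := R) d.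
have : 0 <= FSvolume [set q | (s < ov p q ^+ 2)%R] by exact: measure_ge0.
move: v0 voo g0 goo r0.
case: (FSvolume setT) => [v| |]//; case: (gaussn _) => [g| |]//.
case: (radial_mass d) => [r| |]//; last first.
  by move=> v0 _ _ _ _ _ _; rewrite gt0_mulye.
rewrite !lte_fin => v0 _ g0 _ r0.
case: (FSvolume _) => [u| |]//; last by rewrite gt0_muley.
rewrite -!EFinM. move=> _ [e1] [e2]; congr EFin => /=.
apply: (@mulfI _ (r * v)%R); first by rewrite mulf_neq0 ?gt_eqF.
have -> : (r * v * (u / v) = r * u)%R by field; rewrite gt_eqF.
by rewrite e1 e2 mulrC.
Qed.

End ball_volume.

(** * Tails, layers and moments of the overlap *)

Section overlap_law.
Context {R : realType} (d : nat).
Local Notation mu := (@lebesgue_measure R).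
Local Notation mR := (measurableTypeR R).
Local Notation CP := (CP R d).
Local Notation vol := (vol R d).
Implicit Types (p q : CP) (c : R).

Lemma ov_itv p q : 0 <= ov p q <= 1.
Proof. exact: Re_overlap_itv. Qed.

Lemma ov_ge0 p q : 0 <= ov p q.
Proof. by case/andP: (ov_itv p q). Qed.

Lemma ov_le1 p q : ov p q <= 1.
Proof. by case/andP: (ov_itv p q). Qed.

Lemma ov_itvN p q : -1 <= ov p q <= 1.
Proof. by rewrite ov_le1 andbT (le_trans _ (ov_ge0 p q))// lerN10. Qed.

(** Cosine is decreasing on [[0, pi]]. Radii outside that range give the empty set or the whole
    space, encoded by the levels 2 and -1, which no overlap can exceed and which every overlap
    exceeds. *)
Lemma metric_ball_ov (A : set CP) : metric_balls A ->
  exists p c, (-1 <= c <= 2) /\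
    (A = [set q | c < ov p q] \/ A = [set q | c <= ov p q]).
Proof.
have gt2 p q : (2 < ov p q) = false.
  by apply/negbTE; rewrite -leNgt (le_trans (ov_le1 p q))// ler1n.
have gtN1 p q : -1 < ov p q by rewrite (lt_le_trans _ (ov_ge0 p q))// ltrN10.
have c2 r : -1 <= cos r <= 2.
  by rewrite cos_geN1 (le_trans (cos_le1 _))// ler1n.
have N12 : -1 <= (2 : R) by rewrite (le_trans (lerN10 _)).
have acos_lt p q r : 0 <= r <= pi -> (acos (ov p q) < r) = (cos r < ov p q).
  move=> rpi; rewrite -ltr_cos ?in_itv//= ?acos_ge0 ?acos_lepi ?ov_itvN//.
  by rewrite acosK// in_itv/= ov_itvN.
have acos_le p q r : 0 <= r <= pi -> (acos (ov p q) <= r) = (cos r <= ov p q).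
  move=> rpi; rewrite [LHS]leNgt -ltr_cos ?in_itv//= ?acos_ge0 ?acos_lepi ?ov_itvN//.
  by rewrite acosK ?in_itv/= ?ov_itvN// -leNgt.
move=> [p [r [->|->]]].
- have [r0|r0] := leP r 0.
    exists p, 2; split; first by rewrite N12 lexx.
    left; apply/seteqP; split => q /=; rewrite gt2//.
    by rewrite /FSdist ltNge (le_trans r0)// acos_ge0 ?ov_itvN.
  have [rpi|rpi] := leP r pi; last first.
    exists p, (-1); split; first by rewrite N12 lexx.
    left; apply/seteqP; split => q //= _.
    by rewrite /FSdist (le_lt_trans _ rpi)// acos_lepi ?ov_itvN.
  exists p, (cos r); split => //; left; apply/seteqP; split => q /=;
  by rewrite /FSdist -/(ov p q) acos_lt// (ltW r0).
have [r0|r0] := ltP r 0.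
  exists p, 2; split; first by rewrite N12 lexx.
  left; apply/seteqP; split => q /=; rewrite gt2//.
  by rewrite /FSdist leNgt (lt_le_trans r0)// acos_ge0 ?ov_itvN.
have [rpi|rpi] := leP r pi; last first.
  exists p, (-1); split; first by rewrite N12 lexx.
  left; apply/seteqP; split => q //= _.
  by rewrite /FSdist (le_trans _ (ltW rpi))// acos_lepi ?ov_itvN.
exists p, (cos r); split => //; right; apply/seteqP; split => q /=;
by rewrite /FSdist -/(ov p q) acos_le// r0.
Qed.

Lemma measurable_metric_ball (A : set CP) : metric_balls A -> measurable A.
Proof. by move=> mA; exact: sub_sigma_algebra. Qed.

Lemma measurable_ov p : measurable_fun setT (ov p : CP -> mR).
Proof.
have mF : measurable_fun setT (FSdist p : CP -> R).
  apply: (measurability (@RGenInftyO.G R)) => [|/= _ [_] [r] -> <-].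
    exact: RGenInftyO.measurableE.
  rewrite setTI; apply: measurable_metric_ball; exists p, r; left.
  by apply/seteqP; split => q /=; rewrite in_itv.
have -> : ov p = (@cos R) \o (FSdist p).
  by apply/funext => q; rewrite /FSdist /= acosK// in_itv/= ov_itvN.
apply: (measurableT_comp _ mF).
by apply: continuous_measurable_fun; exact: continuous_cos.
Qed.

Lemma measurable_ov_gt p c : measurable [set q | c < ov p q].
Proof.
rewrite [X in measurable X](_ : _ = ov p @^-1` `]c, +oo[).
  by rewrite -[X in measurable X]setTI; exact: measurable_ov.
by apply/seteqP; split => q /=; rewrite in_itv/= andbT.
Qed.

Definition clamp c : R := Num.min (Num.max c 0) 1.

Lemma clamp_itv c : 0 <= clamp c <= 1.
Proof. by rewrite /clamp le_min ler01 le_max lexx orbT ge_min lexx orbT. Qed.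

Lemma clampB (a b : R) : a <= b -> 0 <= clamp b - clamp a <= b - a.
Proof.
have E c : clamp c = if c < 0 then 0 else if c < 1 then c else 1.
  rewrite /clamp; case: (ltP c 0) => h; first by rewrite min_l ?ler01.
  by case: (ltP c 1).
move=> ab; rewrite !E.
by case: (ltP a 0) => ?; case: (ltP b 0) => ?; case: (ltP a 1) => ?; case: (ltP b 1) => ?; lra.
Qed.

Hypothesis d0 : (0 < d)%N.

Lemma vol_ov_gt p c : vol [set q | c < ov p q] = ((1 - clamp c ^+ 2) ^+ d)%:E.
Proof.
have [c0|c0] := ltP c 0.
  rewrite (_ : [set _ | _] = setT) ?probability_setT; last first.
    by apply/seteqP; split => q //= _; rewrite (lt_le_trans c0)// ov_ge0.
  by rewrite /clamp (max_r (ltW c0)) min_l ?ler01// expr0n subr0 expr1n.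
have [c1|c1] := ltP c 1; last first.
  rewrite (_ : [set _ | _] = set0) ?measure0; last first.
    by apply/seteqP; split => q //=; rewrite ltNge (le_trans (ov_le1 _ _)).
  rewrite /clamp (max_l c0) min_r// expr1n subrr expr0n.
  by rewrite (gtn_eqF d0).
rewrite /clamp (max_l c0) min_l ?(ltW c1)// -(vol_ov2 p); last first.
  by rewrite sqr_ge0 expr_lt1.
by congr (vol _); apply/seteqP; split => q /=; rewrite ltr_pXn2r ?nnegrE ?ov_ge0.
Qed.

Lemma subX_le (x y : R) n : 0 <= y <= x -> x <= 1 -> x ^+ n - y ^+ n <= n%:R * (x - y).
Proof.
move=> /andP[y0 yx] x1; have x0 := le_trans y0 yx; have y1 := le_trans yx x1.
elim: n => [|n IH]; first by rewrite !expr0 mul0r subrr.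
have -> : x ^+ n.+1 - y ^+ n.+1 = x ^+ n * (x - y) + (x ^+ n - y ^+ n) * y.
  by rewrite !exprS; ring.
rewrite -natr1 [leRHS]mulrDl mul1r addrC lerD//.
  apply: le_trans IH; rewrite ler_piMr// subr_ge0.
  by rewrite lerXn2r ?nnegrE.
by rewrite ler_piMl ?subr_ge0// exprn_ile1.
Qed.

(** The function [(1 - c^2)^d] is [2 d]-Lipschitz on [[0, 1]], and [clamp] is 1-Lipschitz. *)
Lemma vol_layer p (a b : R) : a <= b ->
  (vol [set q | (a < ov p q)%R] <= vol [set q | (b < ov p q)%R] + (2 * d%:R * (b - a))%:E)%E.
Proof.
move=> ab; rewrite !vol_ov_gt -EFinD lee_fin -lerBlDl.
have /andP[a0 a1] := clamp_itv a; have /andP[b0 b1] := clamp_itv b.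
have /andP[ab0 ab1] := clampB ab.
apply: le_trans (subX_le d _ _) _.
- have cab : clamp a <= clamp b by rewrite -subr_ge0.
  by rewrite subr_ge0 expr_le1//= b1/= lerD2l lerN2 ler_pXn2r ?nnegrE.
- by rewrite gerBl sqr_ge0.
rewrite [leRHS](_ : _ = d%:R * (2 * (b - a))) ?ler_wpM2l//; last by ring.
have -> : 1 - clamp a ^+ 2 - (1 - clamp b ^+ 2) = (clamp b - clamp a) * (clamp b + clamp a) by ring.
rewrite mulrC.
by apply: ler_pM => //; [rewrite addr_ge0|lra].
Qed.

Local Open Scope ereal_scope.

Lemma integral_beta (a b : nat) :
  \int[mu]_t ((0 <= t)%R%:R * (t < 1)%R%:R * (t ^+ a * (1 - t) ^+ b))%:E =
  ((a`! * b`!)%:R / (a + b).+1`!%:R)%:E.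
Proof.
rewrite -beta_fun_fact EFin_beta_fun integral_XMonemX_restrict setTI.
rewrite -integral_itv_bndo_bndc; last first.
  by apply/measurable_EFinP; exact: measurable_XMonemX.
rewrite [RHS]integral_mkcond; apply: eq_integral => t _.
rewrite patchE.
have -> : (t \in `[0%R, 1%R[%classic) = (0 <= t < 1)%R by apply/idP/idP; rewrite inE /= in_itv.
by case: (0 <= t)%R => /=; case: (t < 1)%R; rewrite ?mul1r ?mul0r.
Qed.

(** With [u] the squared overlap, [u^(m+1) / (m+1)] is the integral of [t^m] over [[0, u)].
    Exchanging integrals leaves [t^m] times the tail [(1 - t)^d], a Beta integral. *)
Lemma moment_ov p m : \int[vol]_q ((ov p q ^+ 2) ^+ m.+1)%:E = ((m.+1`! * d`!)%:R / (m.+1 + d)`!%:R)%:E.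
Proof.
pose g (u t : R) := ((0 <= t)%R%:R * (t < u)%R%:R * t ^+ m)%R.
have mg2 (dT : measure_display) (T : measurableType dT) (u t : T -> mR) : measurable_fun setT u -> measurable_fun setT t ->
    measurable_fun setT (fun x => (g (u x) (t x))%:E : \bar R).
  move=> mu' mt; apply/measurable_EFinP; apply: measurable_funM; last exact: measurable_funX.
  apply: measurable_funM; apply: measurable_natr_bool.
    exact: measurable_fun_ler.
  exact: measurable_fun_ltr.
have g0 u t : 0 <= (g u t)%:E.
  by rewrite lee_fin /g; case: (leP 0%R t) => t0; rewrite ?mul0r// mul1r mulr_ge0// exprn_ge0.
have int_g u : (0 <= u)%R -> \int[mu]_t (g u t)%:E = (u ^+ m.+1 / m.+1%:R)%:E.
  rewrite le_eqVlt => /predU1P[<-|u0].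
    rewrite expr0n mul0r; apply: integral0_eq => t _; rewrite /g.
    by case: (leP 0%R t) => //= t0; rewrite ?ltNge ?t0 !(mul0r, mulr0).
  rewrite -(ge0_integral_affine 0%R (lt0r_neq0 u0) (mg2 _ mR (fun=> u) id (measurable_cst _) (@measurable_id _ mR setT)) (g0 u)).
  have E t : (g u (u * t + 0)%R)%:E = (u ^+ m)%:E * (g 1%R t)%:E.
    rewrite -EFinM /g addr0 pmulr_rge0// -[X in (_ < X)%R]mulr1 ltr_pM2l// exprMn; congr EFin; ring.
  under eq_integral do rewrite E.
  rewrite -(mule_integral _ (mg2 _ mR (fun=> 1%R) id (measurable_cst _) (@measurable_id _ mR setT)) (g0 1%R)); last first.
    by rewrite lee_fin exprn_ge0// ltW.
  have -> : \int[mu]_t (g 1%R t)%:E = (m.+1%:R^-1)%:E.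
    transitivity (\int[mu]_t ((0 <= t)%R%:R * (t < 1)%R%:R * (t ^+ m * (1 - t) ^+ 0))%:E).
      by apply: eq_integral => t _; rewrite expr0 mulr1.
    rewrite integral_beta addn0 fact0 muln1 factS natrM invfM mulrCA mulfV ?mulr1//.
  by rewrite -!EFinM gtr0_norm// exprS mulrA.
have mU : measurable_fun setT (fun q : CP => ov p q ^+ 2 : mR)%R.
  by apply: measurable_funX; exact: measurable_ov.
pose F (z : CP * mR) := (g (ov p z.1 ^+ 2) z.2)%:E.
have mF : measurable_fun setT F.
  apply: mg2; last exact: measurable_snd.
  exact: (measurableT_comp mU measurable_fst).
have F0 z : 0 <= F z by exact: g0.
transitivity (m.+1%:R%:E * \int[vol]_q \int[mu]_t F (q, t)).
  have mI : measurable_fun setT (fun q => \int[mu]_t F (q, t)).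
    exact: (measurable_fun_fubini_tonelli_F _ mF F0).
  apply: etrans _ (esym (mule_integral _ mI (fun=> integral_ge0 _ (fun _ _ => F0 _)) (_ : 0 <= m.+1%:R%:E))); last by rewrite lee_fin.
  apply: eq_integral => q _; rewrite /F/= int_g ?sqr_ge0// -EFinM mulrCA mulfV ?mulr1//.
have -> : \int[vol]_q \int[mu]_t F (q, t) = \int[mu]_t \int[vol]_q F (q, t).
  exact: (fubini_tonelli (m1 := vol) (m2 := mu) F mF F0).
have -> : \int[mu]_t \int[vol]_q F (q, t) = ((m`! * d`!)%:R / (m + d).+1`!%:R)%:E.
  rewrite -integral_beta; apply: eq_integral => t _.
  have [t0|t0] := leP 0%R t; last first.
    rewrite !mul0r; apply: integral0_eq => q _; rewrite /F /g /=.
    by rewrite leNgt t0 !mul0r.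
  rewrite mul1r.
  transitivity (\int[vol]_q ((t ^+ m)%:E * (\1_[set q | (t < ov p q ^+ 2)%R] q)%:E)).
    apply: eq_integral => q _; rewrite -EFinM /F /g /= t0 mul1r mulrC indicE; congr (_ * _%:R)%:E.
    by congr nat_of_bool; apply/idP/idP; rewrite inE.
  have mt : measurable [set q : CP | (t < ov p q ^+ 2)%R].
    rewrite [X in measurable X](_ : _ = (fun q : CP => ov p q ^+ 2 : mR)%R @^-1` `]t, +oo[).
      by rewrite -[X in measurable X]setTI; exact: mU.
    by apply/seteqP; split => q /=; rewrite in_itv/= andbT.
  rewrite -mule_integral//; last 2 first.
  - by apply/measurable_EFinP; exact: measurable_indic.
  - by rewrite lee_fin exprn_ge0.
  rewrite integral_indic// setIT; have [t1|t1] := ltP t 1%R.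
    by rewrite mul1r EFinM; congr (_ * _); apply: vol_ov2; rewrite t0.
  rewrite mul0r (_ : [set _ | _] = set0) ?measure0 ?mule0//.
  apply/seteqP; split => q //=; rewrite ltNge (le_trans _ t1)//.
  by rewrite expr_le1// ?ov_ge0// ov_le1.
by rewrite -EFinM mulrA -natrM mulnA -factS addSn.
Qed.

End overlap_law.

(** * Gram matrices of bounded kernels *)

Section bounded_measurable.
Context dT (T : measurableType dT) (R : realType).
Local Notation mR := (measurableTypeR R).

(** A class closed under the algebraic operations and made of integrable functions for any finite
    measure, so that the integrability side conditions below become structural. *)
Definition rbm (f : T -> R) : Prop :=
  measurable_fun setT (f : T -> mR) /\ exists M : R, forall x, `|f x| <= M.

Definition cbm (f : T -> R[i]) : Prop :=
  rbm (fun x => complex.Re (f x)) /\ rbm (fun x => complex.Im (f x)).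

Lemma rbm_cst (a : R) : rbm (fun=> a).
Proof. by split; [exact: measurable_cst|exists `|a|]. Qed.

Lemma rbmD f g : rbm f -> rbm g -> rbm (fun x => f x + g x).
Proof.
move=> [mf [M hM]] [mg [K hK]]; split; first exact: measurable_funD.
by exists (M + K) => x; rewrite (le_trans (ler_normD _ _))// lerD.
Qed.

Lemma rbmM f g : rbm f -> rbm g -> rbm (fun x => f x * g x).
Proof.
move=> [mf [M hM]] [mg [K hK]]; split; first exact: measurable_funM.
by exists (M * K) => x; rewrite normrM ler_pM.
Qed.

Lemma rbmN f : rbm f -> rbm (fun x => - f x).
Proof.
by move=> /(rbmM (rbm_cst (-1))); under eq_fun do rewrite mulN1r.
Qed.

Lemma rbm_sum (I : Type) (s : seq I) (P : pred I) (f : I -> T -> R) :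
  (forall i, P i -> rbm (f i)) -> rbm (fun x => \sum_(i <- s | P i) f i x).
Proof.
move=> h; elim: s => [|i s IH].
  by under eq_fun do rewrite big_nil; exact: rbm_cst.
have [Pi|Pi] := boolP (P i); last by under eq_fun do rewrite big_cons (negbTE Pi).
by under eq_fun do rewrite big_cons Pi; exact: rbmD (h _ Pi) IH.
Qed.

Lemma rbm_indic (A : set T) : measurable A -> rbm (\1_A).
Proof.
move=> mA; split; first exact: measurable_indic.
by exists 1 => x; rewrite indicE; case: (_ \in _); rewrite ?normr1 ?normr0.
Qed.

Lemma cbm_real f : rbm f -> cbm (fun x => (f x)%:C%C).
Proof. by move=> hf; split => //=; exact: rbm_cst. Qed.

Lemma cbm_cst (a : R[i]) : cbm (fun=> a).
Proof. by split; exact: rbm_cst. Qed.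

Lemma cbmD f g : cbm f -> cbm g -> cbm (fun x => f x + g x).
Proof.
move=> [f1 f2] [g1 g2]; split.
  by under eq_fun do rewrite raddfD; exact: rbmD.
by under eq_fun do rewrite raddfD; exact: rbmD.
Qed.

Lemma ReM (a b : R[i]) : complex.Re (a * b) =
  complex.Re a * complex.Re b - complex.Im a * complex.Im b.
Proof. by case: a b => ? ? [? ?]. Qed.

Lemma ImM (a b : R[i]) : complex.Im (a * b) =
  complex.Re a * complex.Im b + complex.Im a * complex.Re b.
Proof. by case: a b => ? ? [? ?]. Qed.

Lemma cbmM f g : cbm f -> cbm g -> cbm (fun x => f x * g x).
Proof.
move=> [f1 f2] [g1 g2]; split.
  under eq_fun do rewrite ReM.
  by apply: rbmD; [exact: rbmM|apply: rbmN; exact: rbmM].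
by under eq_fun do rewrite ImM; apply: rbmD; exact: rbmM.
Qed.

Lemma cbm_conj f : cbm f -> cbm (fun x => (f x)^*).
Proof.
move=> [f1 f2]; split.
  by have -> : (fun x => complex.Re (f x)^*) = (fun x => complex.Re (f x))
    by apply/funext => x; case: (f x).
have -> : (fun x => complex.Im (f x)^*) = (fun x => - complex.Im (f x)).
  by apply/funext => x; case: (f x).
exact: rbmN.
Qed.

Lemma cbm_sum (I : Type) (s : seq I) (P : pred I) (f : I -> T -> R[i]) :
  (forall i, P i -> cbm (f i)) -> cbm (fun x => \sum_(i <- s | P i) f i x).
Proof.
move=> h; elim: s => [|i s IH].
  by under eq_fun do rewrite big_nil; exact: cbm_cst.
have [Pi|Pi] := boolP (P i); last by under eq_fun do rewrite big_cons (negbTE Pi).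
by under eq_fun do rewrite big_cons Pi; exact: cbmD (h _ Pi) IH.
Qed.

Lemma cbm_prod (I : Type) (s : seq I) (P : pred I) (f : I -> T -> R[i]) :
  (forall i, P i -> cbm (f i)) -> cbm (fun x => \prod_(i <- s | P i) f i x).
Proof.
move=> h; elim: s => [|i s IH].
  by under eq_fun do rewrite big_nil; exact: cbm_cst.
have [Pi|Pi] := boolP (P i); last by under eq_fun do rewrite big_cons (negbTE Pi).
by under eq_fun do rewrite big_cons Pi; exact: cbmM (h _ Pi) IH.
Qed.

Variable m : {measure set T -> \bar R}.
Hypothesis mfin : (m setT < +oo)%E.

Lemma rbm_integrable f : rbm f -> m.-integrable setT (EFin \o f).
Proof.
move=> [mf [M hM]]; apply: measurable_bounded_integrable => //.
exists M; split; first exact: num_real.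
by move=> K MK x _ /=; rewrite (le_trans (hM x))// ltW.
Qed.

Definition cint (f : T -> R[i]) : R[i] :=
  Complex (\int[m]_x complex.Re (f x)) (\int[m]_x complex.Im (f x)).

Lemma eq_cint f g : f =1 g -> cint f = cint g.
Proof. by move=> fg; rewrite (_ : f = g)//; apply/funext. Qed.

Lemma cintD f g : cbm f -> cbm g -> cint (fun x => f x + g x) = cint f + cint g.
Proof.
move=> [f1 f2] [g1 g2]; rewrite /cint.
under eq_Rintegral do rewrite raddfD.
under [X in Complex _ X]eq_Rintegral do rewrite raddfD.
by rewrite !RintegralD//; exact: rbm_integrable.
Qed.

Lemma cint0 : cint (fun=> 0) = 0.
Proof. by rewrite /cint /= /Rintegral !integral_cst// mul0e. Qed.

Lemma cint_sum (I : Type) (s : seq I) (P : pred I) (f : I -> T -> R[i]) :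
  (forall i, P i -> cbm (f i)) ->
  cint (fun x => \sum_(i <- s | P i) f i x) = \sum_(i <- s | P i) cint (f i).
Proof.
move=> h; elim: s => [|i s IH].
  by rewrite big_nil -[RHS]cint0; apply: eq_cint => x; rewrite big_nil.
rewrite big_cons -IH; case: ifP => Pi.
  rewrite -cintD//; [|exact: h|exact: cbm_sum].
  by apply: eq_cint => x; rewrite big_cons Pi.
by apply: eq_cint => x; rewrite big_cons Pi.
Qed.

Lemma cintZ (a : R[i]) f : cbm f -> cint (fun x => a * f x) = a * cint f.
Proof.
move=> [f1 f2]; rewrite /cint.
under eq_Rintegral do rewrite ReM.
under [X in Complex _ X]eq_Rintegral do rewrite ImM.
rewrite RintegralB ?RintegralD ?RintegralZl//; first by case: a.
all: by apply: rbm_integrable; first [exact: f1|exact: f2|apply: rbmM => //; exact: rbm_cst].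
Qed.

Lemma cintZr (a : R[i]) f : cbm f -> cint (fun x => f x * a) = cint f * a.
Proof. by move=> hf; rewrite mulrC -cintZ//; apply: eq_cint => x; rewrite mulrC. Qed.

Lemma cint_conj f : cbm f -> cint (fun x => (f x)^*) = (cint f)^*.
Proof.
move=> [f1 f2]; rewrite /cint.
have -> : (fun x => complex.Re (f x)^*) = (fun x => complex.Re (f x)).
  by apply/funext => x; case: (f x).
have -> : (fun x => complex.Im (f x)^*) = (fun x => -1 * complex.Im (f x)).
  by apply/funext => x; rewrite mulN1r; case: (f x).
by rewrite RintegralZl ?mulN1r//; exact: rbm_integrable.
Qed.

Lemma cint_real f : cint (fun x => (f x)%:C%C) = (\int[m]_x f x)%:C%C.
Proof.
by rewrite /cint /=; congr Complex; rewrite /Rintegral integral_cst// mul0e.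
Qed.

Lemma Rint_EFin f : rbm f -> (\int[m]_x f x)%:E = (\int[m]_x (f x)%:E)%E.
Proof. by move=> hf; rewrite /Rintegral fineK//; apply: integrable_fin_num => //; exact: rbm_integrable. Qed.

End bounded_measurable.

(** * Integrals over tuples of points *)

Section power_bounded.
Context dT (T : measurableType dT) (R : realType) (m : probability T R).
Local Notation pw := (power_measure m).

Lemma rbm_comp dU (U : measurableType dU) (g : U -> T) (f : T -> R) :
  measurable_fun setT g -> rbm f -> rbm (f \o g).
Proof.
by move=> mg [mf [M hM]]; split; [exact: (measurableT_comp mf mg)|exists M => x; exact: hM].
Qed.

Lemma cbm_comp dU (U : measurableType dU) (g : U -> T) (f : T -> R[i]) :
  measurable_fun setT g -> cbm f -> cbm (f \o g).
Proof. by move=> mg [f1 f2]; split; [exact: (rbm_comp mg f1)|exact: (rbm_comp mg f2)]. Qed.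

Lemma power_measureT n : (pw n setT = 1)%E.
Proof.
elim: n => [|n IH]; first by rewrite /= diracT.
have m1 : measurable_fun setT (fun _ : n.+1.-tuple T => 1 : \bar R)%E by [].
have := ge0_integral_powerS m m1 (fun=> lee01).
rewrite integral_cst// mul1e => ->.
transitivity (\int[m]_x 1)%E; last by rewrite integral_cst// mul1e; exact: probability_setT.
by apply: eq_integral => x _; rewrite integral_cst// mul1e; exact: IH.
Qed.

Lemma power_measure_lty n : (pw n setT < +oo)%E.
Proof. by rewrite power_measureT ltry. Qed.

Lemma prob_lty : (m setT < +oo)%E.
Proof. by rewrite probability_setT ltry. Qed.

Lemma measurable_cons_pair n :
  measurable_fun setT (fun z : T * n.-tuple T => [tuple of z.1 :: z.2]).
Proof. exact: measurable_cons_tuple. Qed.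

Lemma integral_powerS n (f : n.+1.-tuple T -> R) : rbm f ->
  (\int[pw n.+1]_z (f z)%:E =
   \int[m]_x \int[pw n]_y (f [tuple of x :: y])%:E)%E.
Proof.
move=> rf; have [mf [M hM]] := rf.
have mf2 := measurableT_comp mf (@measurable_cons_pair n).
have ipw : (prod_measure m (pw n)) setT = 1%E.
  rewrite -setXTT; apply: etrans (product_measure1E _ _ measurableT measurableT) _.
  by rewrite [X in (X * _)%E]probability_setT mul1e; exact: power_measureT.
have rbf : rbm (fun z : T * n.-tuple T => f [tuple of z.1 :: z.2]).
  by split; [exact: mf2|exists M => z; exact: hM].
have int_f : (prod_measure m (pw n)).-integrable setT
    (fun z : T * n.-tuple T => (f [tuple of z.1 :: z.2])%:E).
  apply: rbm_integrable rbf; apply: (@le_lt_trans _ _ 1%E); last exact: ltry.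
  by rewrite le_eqVlt; apply/orP; left; apply/eqP; exact: ipw.
apply: etrans (esym (integral12_prod_meas1 int_f)).
have mEf : measurable_fun setT (fun z : n.+1.-tuple T => (f z)%:E : \bar R) by apply/measurable_EFinP.
exact: (integral_pushforward (@measurable_cons_tuple _ T n) mEf int_f measurableT).
Qed.

Lemma rbm_cons n (f : n.+1.-tuple T -> R) (x : T) : rbm f ->
  rbm (fun y : n.-tuple T => f [tuple of x :: y]).
Proof.
move=> [mf [M hM]]; split; last by exists M => y; exact: hM.
exact: (measurableT_comp (measurableT_comp mf (@measurable_cons_pair n)) (measurable_pair1 x)).
Qed.

Lemma Rintegral_powerS n (f : n.+1.-tuple T -> R) : rbm f ->
  \int[pw n.+1]_z f z = \int[m]_x \int[pw n]_y f [tuple of x :: y].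
Proof.
move=> rf; rewrite {1}/Rintegral integral_powerS// {1}/Rintegral; congr fine.
apply: eq_integral => x _; rewrite Rint_EFin//; first exact: power_measure_lty.
exact: rbm_cons.
Qed.

Lemma cint_powerS n (f : n.+1.-tuple T -> R[i]) : cbm f ->
  cint (pw n.+1) f = cint m (fun x => cint (pw n) (fun y => f [tuple of x :: y])).
Proof. by move=> [f1 f2]; rewrite /cint !Rintegral_powerS. Qed.

Lemma cbm_tnth n (h : 'I_n -> T -> R[i]) : (forall j, cbm (h j)) ->
  cbm (fun y : n.-tuple T => \prod_(j < n) h j (tnth y j)).
Proof.
move=> hh; apply: cbm_prod => j _.
exact: (cbm_comp (@measurable_tnth _ _ n j) (hh j)).
Qed.

Lemma cint_prod n (h : 'I_n -> T -> R[i]) : (forall j, cbm (h j)) ->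
  cint (pw n) (fun y => \prod_(j < n) h j (tnth y j)) = \prod_(j < n) cint m (h j).
Proof.
elim: n h => [|n IH] h hh.
  rewrite big_ord0; transitivity (cint (pw 0) (fun=> (1 : R)%:C%C)).
    by apply: eq_cint => y; rewrite big_ord0.
  rewrite cint_real /Rintegral integral_cst// mul1e.
  by rewrite [X in fine X](_ : _ = 1%E)//; exact: power_measureT.
rewrite cint_powerS; last exact: cbm_tnth.
rewrite big_ord_recl -IH; last by move=> j; exact: hh.
rewrite -cintZr//; last exact: prob_lty.
apply: eq_cint => x; rewrite -cintZ; [|exact: power_measure_lty|].
  apply: eq_cint => y; rewrite big_ord_recl tnth0; congr (_ * _).
  by apply: eq_bigr => j _; rewrite tnthS.
by apply: (@cbm_tnth n (fun j => h (lift ord0 j))) => j; exact: hh.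
Qed.

End power_bounded.

(** * Gram matrices and kernels of finite rank *)

Section gram.
Context dT (T : measurableType dT) (R : realType) (m : probability T R).
Local Notation pw := (power_measure m).
Local Notation C := R[i].

Definition sqc (z : C) : R := complex.Re z ^+ 2 + complex.Im z ^+ 2.

Lemma sqc_ge0 z : 0 <= sqc z.
Proof. by rewrite addr_ge0 ?sqr_ge0. Qed.

Lemma conjC_real (r : R) : (r%:C%C : C)^* = r%:C%C.
Proof. by apply/eqP; rewrite eq_complex /= oppr0 !eqxx. Qed.

Lemma mulcJ (z : C) : z * z^* = (sqc z)%:C%C.
Proof.
case: z => a b; apply/eqP; rewrite eq_complex /sqc /=; apply/andP; split; apply/eqP; ring.
Qed.

Lemma sqc_norm (z : C) : `|z| ^+ 2 = (sqc z)%:C%C.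
Proof. by rewrite normCK mulcJ. Qed.

Lemma rbm_sqc (f : T -> C) : cbm f -> rbm (fun x => sqc (f x)).
Proof. by move=> [f1 f2]; apply: rbmD; apply: rbmM. Qed.

Definition gram n (B : set T) (phi : 'I_n -> T -> C) : 'M[C]_n :=
  \matrix_(a, b) cint m (fun x => (\1_B x)%:C%C * (phi a x * (phi b x)^*)).

Definition fkernel n (phi : 'I_n -> T -> C) (x y : T) : C :=
  \sum_a phi a x * (phi a y)^*.

Lemma cbm_indicM (B : set T) (f : T -> C) : measurable B -> cbm f ->
  cbm (fun x => (\1_B x)%:C%C * f x).
Proof. by move=> mB hf; apply: cbmM => //; apply: cbm_real; exact: rbm_indic. Qed.

Lemma cbm_pair (f g : T -> C) : cbm f -> cbm g -> cbm (fun x => f x * (g x)^*).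
Proof. by move=> hf hg; apply: cbmM => //; exact: cbm_conj. Qed.

Section fixed_set.
Variables (n : nat) (B : set T) (mB : measurable B).
Variable phi : 'I_n -> T -> C.
Hypothesis hphi : forall a, cbm (phi a).

Lemma gram_conj a b : (gram B phi a b)^* = gram B phi b a.
Proof.
rewrite !mxE -cint_conj; [|exact: prob_lty|exact: cbm_indicM (cbm_pair _ _)].
apply: eq_cint => x; rewrite !rmorphM /= conjCK; congr (_ * _); last exact: mulrC.
exact: conjC_real.
Qed.

Lemma gram_transform (P : 'M[C]_n) :
  gram B (fun a x => \sum_b P a b * phi b x) = P *m gram B phi *m (P ^t*)%sesqui.
Proof.
apply/matrixP => a b; rewrite !mxE.
transitivity (cint m (fun x => \sum_c \sum_e
    (P a c * (P b e)^*) * ((\1_B x)%:C%C * (phi c x * (phi e x)^*)))).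
  apply: eq_cint => x; rewrite rmorph_sum/= mulr_suml mulr_sumr; apply: eq_bigr => c _.
  rewrite mulr_sumr mulr_sumr; apply: eq_bigr => e _; rewrite rmorphM/=; ring.
have hce c e : cbm (fun x => (\1_B x)%:C%C * (phi c x * (phi e x)^*)).
  exact: cbm_indicM (cbm_pair _ _).
rewrite cint_sum; [|exact: prob_lty|]; last first.
  by move=> c _; apply: cbm_sum => e _; apply: cbmM => //; exact: cbm_cst.
under eq_bigr => c _.
  rewrite cint_sum; [|exact: prob_lty|]; last first.
    by move=> e _; apply: cbmM => //; exact: cbm_cst.
  under eq_bigr => e _ do rewrite (cintZ (prob_lty m))//.
  over.
rewrite exchange_big; apply: eq_bigr => e _; rewrite !mxE mulr_suml.
by apply: eq_bigr => c _; rewrite mxE; ring.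
Qed.

Lemma integral_fkernel_sqr x : (\int[m]_y (\1_B y * sqc (fkernel phi x y)))%:C%C =
    \sum_a \sum_b (phi a x * (phi b x)^*) * gram B phi b a.
Proof.
have hce c e : cbm (fun x => (\1_B x)%:C%C * (phi c x * (phi e x)^*)).
  exact: cbm_indicM (cbm_pair _ _).
rewrite -cint_real.
transitivity (cint m (fun y => \sum_a \sum_b (phi a x * (phi b x)^*) *
    ((\1_B y)%:C%C * (phi b y * (phi a y)^*)))).
  apply: eq_cint => y; rewrite rmorphM/= -mulcJ /fkernel rmorph_sum mulr_suml mulr_sumr.
  apply: eq_bigr => a _; rewrite mulr_sumr mulr_sumr; apply: eq_bigr => b _.
  by rewrite rmorphM/= conjCK; ring.
rewrite cint_sum; [|exact: prob_lty|]; last first.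
  by move=> c _; apply: cbm_sum => e _; apply: cbmM => //; exact: cbm_cst.
apply: eq_bigr => a _; rewrite cint_sum; [|exact: prob_lty|]; last first.
  by move=> e _; apply: cbmM => //; exact: cbm_cst.
by apply: eq_bigr => b _; rewrite (cintZ (prob_lty m))// mxE.
Qed.

(** Both sides expand into the same double sum over indices. This is how [sum_a lam a ^+ 2] becomes
    an integral of the squared kernel over pairs of points in [B]. *)
Lemma sum_gram_sqr :
  \sum_a \sum_b gram B phi a b * (gram B phi a b)^* =
  (\int[m]_x (\1_B x * \int[m]_y (\1_B y * sqc (fkernel phi x y))))%:C%C.
Proof.
have hce c e : cbm (fun x => (\1_B x)%:C%C * (phi c x * (phi e x)^*)).
  exact: cbm_indicM (cbm_pair _ _).
rewrite -cint_real.
transitivity (cint m (fun x => \sum_a \sum_b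
   gram B phi b a * ((\1_B x)%:C%C * (phi a x * (phi b x)^*)))); last first.
  apply: eq_cint => x; rewrite rmorphM/= integral_fkernel_sqr mulr_sumr; apply: eq_bigr => a _.
  by rewrite mulr_sumr; apply: eq_bigr => b _; ring.
rewrite cint_sum; [|exact: prob_lty|]; last first.
  by move=> c _; apply: cbm_sum => e _; apply: cbmM => //; exact: cbm_cst.
apply: eq_bigr => a _; rewrite cint_sum; [|exact: prob_lty|]; last first.
  by move=> e _; apply: cbmM => //; exact: cbm_cst.
by apply: eq_bigr => b _; rewrite (cintZ (prob_lty m))// gram_conj mxE mulrC.
Qed.

Lemma gram_trace :
  \sum_a gram B phi a a = cint m (fun x => (\1_B x)%:C%C * fkernel phi x x).
Proof.
transitivity (cint m (fun x => \sum_a (\1_B x)%:C%C * (phi a x * (phi a x)^*))).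
  rewrite cint_sum; [|exact: prob_lty|].
    by apply: eq_bigr => a _; rewrite mxE.
  by move=> a _; exact: cbm_indicM (cbm_pair _ _).
by apply: eq_cint => x; rewrite /fkernel mulr_sumr.
Qed.

Lemma gram_hermitian : gram B phi \is hermsymmx.
Proof.
apply/is_hermitianmxP; rewrite expr0 scale1r; apply/matrixP => a b.
by rewrite [RHS]mxE [in RHS]mxE gram_conj.
Qed.

End fixed_set.

(* A Gram matrix of size n with trace n and squared Hilbert-Schmidt norm n is at
   distance 0 from the identity. *)
Lemma gram_eq1 n (phi : 'I_n -> T -> C) : (forall a, cbm (phi a)) ->
  cint m (fun x => fkernel phi x x) = n%:R ->
  \int[m]_x \int[m]_y sqc (fkernel phi x y) = n%:R ->
  gram setT phi = 1%:M.
Proof.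
move=> hphi tr1 tr2; set G := gram setT phi.
have e1 : \sum_a G a a = n%:R.
  rewrite gram_trace// -tr1; apply: eq_cint => x.
  by rewrite indicT mul1r.
have e2 : \sum_a \sum_b G a b * (G a b)^* = n%:R.
  rewrite sum_gram_sqr// -[RHS](rmorph_nat (@real_complex R)) -tr2; congr (_%:C%C).
  apply: eq_Rintegral => x _; rewrite indicT mul1r.
  by apply: eq_Rintegral => y _; rewrite /= mul1r.
have GJ a b : (G a b)^* = G b a by exact: gram_conj.
(* The squared Hilbert-Schmidt distance from the identity is [n - 2 n + n]. *)
have e3 : \sum_a \sum_b (G a b - (a == b)%:R) * (G a b - (a == b)%:R)^* = 0.
  transitivity (\sum_a ((\sum_b G a b * (G a b)^*) - G a a - G a a + 1)).
    apply: eq_bigr => a _.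
    transitivity (\sum_b (G a b * (G a b)^* +
        (a == b)%:R * (- G a a - G a a + 1))).
      apply: eq_bigr => b _; rewrite rmorphB rmorph_nat/=.
      have [<-|ab] := eqVneq a b; last by rewrite !subr0 mul0r addr0.
    by rewrite GJ (_ : true%:R = 1 :> C)//; ring.
    rewrite big_split/= -!addrA; congr (_ + _).
    rewrite (bigD1 a)//= eqxx mul1r big1 ?addr0// => b.
    by rewrite eq_sym => /negbTE ->; rewrite mul0r.
  rewrite big_split/= !sumrB e1 e2 sumr_const card_ord; ring.
apply/matrixP => a b; rewrite [RHS]mxE; apply/eqP; rewrite -subr_eq0.
have ge0 (c e : 'I_n) : 0 <= (G c e - (c == e)%:R) * (G c e - (c == e)%:R)^*.
  by rewrite mul_conjC_ge0.
have h1 : \sum_b (G a b - (a == b)%:R) * (G a b - (a == b)%:R)^* = 0.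
  by have /psumr_eq0P -> := e3 => // c _; apply: sumr_ge0.
have : (G a b - (a == b)%:R) * (G a b - (a == b)%:R)^* = 0.
  by have /psumr_eq0P -> := h1.
by move=> /eqP; rewrite mul_conjC_eq0.
Qed.

Section diagonalization.
Variables (n : nat) (phi : 'I_n -> T -> C) (B : set T).
Hypothesis hphi : forall a, cbm (phi a).
Hypothesis mB : measurable B.
Hypothesis ortho : gram setT phi = 1%:M.

(** A unitary change of the [phi a] leaves the kernel unchanged. Taking the unitary that
    diagonalizes the Gram matrix on [B] makes the new functions orthogonal on [B] while they stay
    orthonormal on the whole space, so [lam a], the mass of [|psi a|^2] in [B], is at most 1. *)
Lemma diagonalize : exists psi : 'I_n -> T -> C, exists lam : 'I_n -> R,
  [/\ forall a, cbm (psi a),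
      forall x y, fkernel psi x y = fkernel phi x y,
      forall a b, cint m (fun x => (\1_B x)%:C%C * (psi a x * (psi b x)^*)) =
         ((a == b)%:R * lam a)%:C%C &
      forall a, 0 <= lam a <= 1].
Proof.
set G := gram B phi; set P := spectralmx G.
have PU : P *m (P ^t*)%sesqui = 1%:M by apply/unitarymxP; exact: spectral_unitarymx.
have PU' : (P ^t*)%sesqui *m P = 1%:M by exact: mulmx1C.
have /orthomx_spectralP GE : G \is normalmx.
  by apply: hermitian_normalmx; exact: gram_hermitian.
rewrite -/P invmx_unitary ?spectral_unitarymx// in GE.
pose psi (a : 'I_n) (x : T) := \sum_b P a b * phi b x.
have hpsi a : cbm (psi a).
  by apply: cbm_sum => b _; apply: cbmM => //; exact: cbm_cst.
have G1 : gram B psi = diag_mx (spectral_diag G).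
  rewrite gram_transform// -/G GE !mulmxA PU mul1mx -mulmxA PU mulmx1.
  by rewrite -GE.
have G2 : gram setT psi = 1%:M.
  by rewrite gram_transform// ortho mulmx1 PU.
pose lam a := \int[m]_x (\1_B x * sqc (psi a x)).
have lamE a : cint m (fun x => (\1_B x)%:C%C * (psi a x * (psi a x)^*)) = (lam a)%:C%C.
  by rewrite -cint_real; apply: eq_cint => x; rewrite mulcJ -rmorphM.
exists psi, lam; split => //.
- move=> x y; rewrite /fkernel.
  transitivity (\sum_b \sum_c (\sum_a (P a c)^* * P a b) * (phi b x * (phi c y)^*)).
    under eq_bigr => a _ do rewrite /psi rmorph_sum/= mulr_suml.
    rewrite exchange_big; apply: eq_bigr => b _.
    under eq_bigr => a _ do rewrite mulr_sumr.
    rewrite exchange_big; apply: eq_bigr => c _; rewrite mulr_suml.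
    by apply: eq_bigr => a _; rewrite rmorphM/=; ring.
  have e b c : \sum_a (P a c)^* * P a b = (c == b)%:R.
    have /matrixP/(_ c b) := PU'; rewrite !mxE => <-.
    by apply: eq_bigr => a _; rewrite !mxE.
  apply: eq_bigr => b _; rewrite (bigD1 b)//= e eqxx mul1r big1 ?addr0// => c.
  by rewrite e => /negbTE ->; rewrite mul0r.
- move=> a b; have [<-|ab] := eqVneq a b; first by rewrite mul1r lamE.
  have /matrixP/(_ a b) := G1; rewrite !mxE => ->.
  by rewrite (negbTE ab) mulr0n mul0r.
move=> a; have rB := rbm_indic R mB; have rs := rbm_sqc (hpsi a).
apply/andP; split.
  by apply: Rintegral_ge0 => x _; rewrite mulr_ge0 ?sqc_ge0.
have <- : \int[m]_x sqc (psi a x) = 1.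
  have /matrixP/(_ a a) := G2; rewrite !mxE eqxx => e.
  apply: complexI; rewrite -cint_real -[RHS]e; apply: eq_cint => x.
  by rewrite indicT mul1r mulcJ.
apply: le_Rintegral => //.
- by apply: rbm_integrable; [exact: prob_lty|exact: rbmM].
- by apply: rbm_integrable; [exact: prob_lty|].
move=> x _; rewrite indicE; case: (_ \in _); rewrite ?mul1r// mul0r; exact: sqc_ge0.
Qed.

End diagonalization.

(** Expanding the determinant over permutations [s] and the kernels over index functions [f], each
    term factorizes over the points. Orthogonality on [B] keeps only the pairs in which [f] is
    invariant under [s]. *)
Lemma cint_det n k (psi : 'I_n -> T -> C) (B : set T) (lam : 'I_n -> R) :
  measurable B -> (forall a, cbm (psi a)) ->
  (forall a b, cint m (fun x => (\1_B x)%:C%C * (psi a x * (psi b x)^*)) =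
         ((a == b)%:R * lam a)%:C%C) ->
  cint (pw k) (fun y => (\prod_(j < k) (\1_B (tnth y j))%:C%C) *
     \det (\matrix_(i, j) fkernel psi (tnth y i) (tnth y j))) =
  (\sum_(f : {ffun 'I_k -> 'I_n} | injectiveb f) \prod_j lam (f j))%:C%C.
Proof.
move=> mB hpsi orth.
pose h (f : {ffun 'I_k -> 'I_n}) (s : {perm 'I_k}) (j : 'I_k) (x : T) : C :=
  (\1_B x)%:C%C * (psi (f j) x * (psi (f ((s^-1)%g j)) x)^*).
have hh f s j : cbm (h f s j) by exact: cbm_indicM (cbm_pair _ _).
have hprod f s : cbm (fun y : k.-tuple T => \prod_(j < k) h f s j (tnth y j)).
  exact: cbm_tnth.
transitivity (cint (pw k) (fun y => \sum_(f : {ffun 'I_k -> 'I_n}) \sum_(s : {perm 'I_k})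
    (-1) ^+ s * \prod_(j < k) h f s j (tnth y j))).
  apply: eq_cint => y; rewrite exchange_big /determinant mulr_sumr.
  apply: eq_bigr => s _; rewrite -mulr_sumr mulrCA; congr (_ * _).
  under [X in _ * X]eq_bigr do rewrite mxE.
  rewrite /fkernel bigA_distr_bigA/= mulr_sumr; apply: eq_bigr => f _.
  rewrite /h [RHS]big_split/=; congr (_ * _).
  rewrite big_split [RHS]big_split/=; congr (_ * _).
  rewrite (reindex_inj (@perm_inj _ (s^-1)%g))/=.
  by apply: eq_bigr => j _; rewrite permKV.
rewrite cint_sum; [|exact: power_measure_lty|]; last first.
  by move=> f _; apply: cbm_sum => s _; apply: cbmM => //; exact: cbm_cst.
have ifs f (s : {perm 'I_k}) : cint (pw k) (fun y => (-1) ^+ s * \prod_(j < k) h f s j (tnth y j)) =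
   (-1) ^+ s * \prod_(j < k) ((f j == f ((s^-1)%g j))%:R * lam (f j))%:C%C.
  rewrite cintZ; [|exact: power_measure_lty|by []]; congr (_ * _).
  by rewrite cint_prod//; apply: eq_bigr => j _; rewrite orth.
rewrite rmorph_sum/= [RHS]big_mkcond; apply: eq_bigr => f _.
rewrite cint_sum; [|exact: power_measure_lty|]; last first.
  by move=> s _; apply: cbmM => //; exact: cbm_cst.
(* For fixed [f] the signed sum over permutations is again a determinant: the identity matrix if [f]
   is injective, a matrix with two equal rows otherwise. *)
pose E : 'M[C]_k := \matrix_(i, j) (f i == f j)%:R.
transitivity ((\prod_j lam (f j))%:C%C * \det E).
  rewrite /determinant mulr_sumr; apply: eq_bigr => s _; rewrite ifs mulrCA; congr (_ * _).
  transitivity ((\prod_(j < k) ((f j == f ((s^-1)%g j))%:R * lam (f j)))%:C%C).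
    by rewrite rmorph_prod.
  rewrite big_split/= mulrC rmorphM; congr (_ * _); rewrite rmorph_prod.
  rewrite (reindex_inj (@perm_inj _ s))/=; apply: eq_bigr => j _.
  by rewrite permK mxE eq_sym rmorph_nat.
case: ifPn => [/injectiveP finj|].
  rewrite (_ : E = 1%:M) ?det1 ?mulr1//; apply/matrixP => i j; rewrite !mxE.
  by rewrite (inj_eq finj).
move=> /injectivePn [i [j ij fij]]; rewrite (determinant_alternate ij) ?mulr0//.
by move=> e; rewrite !mxE fij.
Qed.

End gram.

(** Injections are grouped by their image, each set of size [k] being the image of [k!] of them. *)
Lemma sum_inj_prod (R : comPzRingType) n k (lam : 'I_n -> R) :
  \sum_(f : {ffun 'I_k -> 'I_n} | injectiveb f) \prod_j lam (f j) =
  k`!%:R * \sum_(J : {set 'I_n} | #|J| == k) \prod_(a in J) lam a.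
Proof.
rewrite (partition_big (fun f : {ffun 'I_k -> 'I_n} => f @: 'I_k)
   (fun J : {set 'I_n} => #|J| == k))/=; last first.
  by move=> f /injectiveP finj; rewrite card_imset// card_ord.
rewrite mulr_sumr; apply: eq_bigr => J /eqP Jk.
transitivity (\sum_(f : {ffun 'I_k -> 'I_n} | injectiveb f && (f @: 'I_k == J))
    \prod_(a in J) lam a).
  apply: eq_bigr => f /andP[/injectiveP finj /eqP <-].
  by rewrite big_imset/=; last by move=> x y _ _; exact: finj.
rewrite (eq_bigl (mem [set f : {ffun 'I_k -> 'I_n} | injectiveb f & f @: 'I_k == J]%SET)); last first.
  by move=> f; rewrite !inE.
rewrite sumr_const -[LHS]mulr_natl; congr (_%:R * _).
have -> : k`! = #|J| ^_ #|'I_k| by rewrite Jk card_ord ffactnn.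
rewrite -(card_inj_ffuns_on 'I_k (mem J)).
apply: eq_card => f; rewrite !inE; apply/andP/andP.
  move=> [finj /eqP fJ]; split => //.
  by apply/ffun_onP => x; rewrite -fJ imset_f.
move=> [/ffun_onP fJ finj]; split => //.
rewrite eqEcard; apply/andP; split.
  by apply/fintype.subsetP => _ /imsetP[x _ ->]; exact: fJ.
by rewrite card_imset ?card_ord ?Jk//; exact/injectiveP.
Qed.

(** The generating function of the elementary symmetric polynomials; the factorial in the
    denominator removes the orderings counted by the injections. *)
Lemma sum_falling_prod (R : fieldType) n (lam : 'I_n -> R) (t : R) :
  (forall k, k`!%:R != 0 :> R) ->
  \sum_(k < n.+1) t ^+ k / k`!%:R *
    \sum_(f : {ffun 'I_k -> 'I_n} | injectiveb f) \prod_j lam (f j) =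
  \prod_a (1 + t * lam a).
Proof.
move=> fact0; under [RHS]eq_bigr do rewrite addrC.
rewrite bigA_distr/= (partition_big (fun J : {set 'I_n} => inord #|J| : 'I_n.+1) predT)//=.
apply: eq_bigr => k _; rewrite sum_inj_prod mulrA divfK//= mulr_sumr.
apply: eq_big => [J|J /eqP Jk].
  have Jn : (#|J| < n.+1)%N by rewrite ltnS -[X in (_ <= X)%N]card_ord max_card.
  by rewrite -(inj_eq val_inj)/= inordK.
transitivity (\prod_(a in J) (t * lam a)).
  by rewrite big_split/= prodr_const Jk.
by rewrite big_mkcond.
Qed.

(** * Overlaps in coordinates and the projective kernel *)

Section geometry.
Context {R : realType} (d : nat).
Local Notation CP := (CP R d).
Local Notation C := R[i].
Local Notation vol := (vol R d).
Local Notation mR := (measurableTypeR R).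
Implicit Types (p q x y : CP) (v w : 'rV[C]_d.+1).

Definition nc (z : C) : R := complex.Re `|z|.

Lemma ncE (z : C) : `|z| = (nc z)%:C%C.
Proof. by rewrite /nc normc_def. Qed.

Lemma nc_ge0 (z : C) : 0 <= nc z.
Proof. by rewrite -ler0c -ncE normr_ge0. Qed.

Lemma nc_sqr (z : C) : nc z ^+ 2 = sqc z.
Proof. by apply: complexI; rewrite rmorphXn/= -ncE sqc_norm. Qed.

Lemma ncM (a b : C) : nc (a * b) = nc a * nc b.
Proof. by apply: complexI; rewrite rmorphM/= -!ncE normrM. Qed.

Lemma ncJ (a : C) : nc a^* = nc a.
Proof. by apply: complexI; rewrite -!ncE norm_conjC. Qed.

Lemma ncB_ge (a b : C) : nc a - nc b <= nc (a - b).
Proof. by rewrite -lecR rmorphB/= -!ncE lerB_dist. Qed.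

Lemma nc_eq0 (a : C) : (nc a == 0) = (a == 0).
Proof. by rewrite -(inj_eq (@complexI R)) -ncE normr_eq0. Qed.

Lemma sqcM (a b : C) : sqc (a * b) = sqc a * sqc b.
Proof. by rewrite -!nc_sqr ncM exprMn. Qed.

Lemma sqcX (a : C) k : sqc (a ^+ k) = sqc a ^+ k.
Proof.
elim: k => [|k IH]; last by rewrite !exprS sqcM IH.
by rewrite !expr0 /sqc /= expr0n addr0 expr1n.
Qed.

Definition nsq v : R := \sum_j sqc (v 0 j).

Lemma rowB v w j : (v - w) 0 j = v 0 j - w 0 j.
Proof. by rewrite !mxE. Qed.

Lemma rowD v w j : (v + w) 0 j = v 0 j + w 0 j.
Proof. by rewrite mxE. Qed.

Lemma rowZ (a : C) v j : (a *: v) 0 j = a * v 0 j.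
Proof. by rewrite mxE. Qed.

Lemma dotE v w : dotmx v w = \sum_j v 0 j * (w 0 j)^*.
Proof. by rewrite dotmxE mxE; apply: eq_bigr => j _; rewrite !mxE. Qed.

Lemma dot_nsq v : dotmx v v = (nsq v)%:C%C.
Proof. by rewrite dotE rmorph_sum; apply: eq_bigr => j _; rewrite mulcJ. Qed.

Lemma nsq_ge0 v : 0 <= nsq v.
Proof. by apply: sumr_ge0 => j _; exact: sqc_ge0. Qed.

Lemma nsq_gt0 v : v != 0 -> 0 < nsq v.
Proof.
move=> v0; rewrite lt0r nsq_ge0 andbT; apply: contraNN v0 => /eqP h.
have <- : (dotmx v v == 0) = (v == 0) := dnorm_eq0 _ v.
by rewrite dot_nsq h.
Qed.

Lemma sqc_dot v w : sqc (dotmx v w) <= nsq v * nsq w.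
Proof.
have [cs _] := CauchySchwarz (@dotmx C d.+1) v w.
have {cs} : `|dotmx v w| ^+ 2 <= dotmx v v * dotmx w w := cs.
by rewrite sqc_norm !dot_nsq -rmorphM/= lecR.
Qed.

Fact uvec_key : unit. Proof. exact: tt. Qed.

(* Locked: mxE would otherwise unfold the coordinates of normalized vectors. *)
Definition uvec p : 'rV[C]_d.+1 := locked_with uvec_key (normalize (repr_vec p)).

Lemma uvecE p : uvec p = normalize (repr_vec p).
Proof. exact: unlock. Qed.

Lemma nsq_uvec p : nsq (uvec p) = 1.
Proof.
by apply: complexI; rewrite -dot_nsq uvecE dotmx_normalize1 ?repr_vec_neq0.
Qed.

(** The overlap with an arbitrary, not necessarily unit, vector: the grid vectors of the nets and
    the sums of basis vectors in the polarization argument are not normalized. *)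
Definition hv v q : R := nc (dotmx v (uvec q)).

Lemma hv_ge0 v q : 0 <= hv v q.
Proof. exact: nc_ge0. Qed.

Lemma ovE p q : ov p q = hv (uvec p) q.
Proof. by rewrite /hv !uvecE. Qed.

Lemma ler_sqr2 (r s : R) : 0 <= r -> 0 <= s -> r <= s -> r ^+ 2 <= s ^+ 2.
Proof. by move=> r0 s0 rs; rewrite ler_pXn2r. Qed.

Lemma sub_sqr2 (r : R) : 0 <= r <= 1 -> 2 - 2 * r <= 2 * (1 - r ^+ 2).
Proof. by move=> /andP[r0 r1]; nra. Qed.

Lemma dotJ v w : (dotmx v w)^* = dotmx w v.
Proof.
rewrite (dotE v w) (dotE w v) rmorph_sum; apply: eq_bigr => j _.
by rewrite rmorphM/= conjCK mulrC.
Qed.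

Lemma ovC p q : ov p q = ov q p.
Proof. by rewrite (ovE p q) (ovE q p) /hv -(dotJ (uvec p)) ncJ. Qed.

Lemma hv_lip v w q : `|hv v q - hv w q| <= Num.sqrt (nsq (v - w)).
Proof.
have h a b : hv a q - hv b q <= Num.sqrt (nsq (a - b)).
  rewrite (le_trans (ncB_ge _ _))//.
  have -> : dotmx a (uvec q) - dotmx b (uvec q) = dotmx (a - b) (uvec q).
    by rewrite !dotE -sumrB; apply: eq_bigr => j _; rewrite rowB mulrBl.
  rewrite -(@ler_pXn2r _ 2)// ?nnegrE ?nc_ge0 ?sqrtr_ge0// nc_sqr sqr_sqrtr ?nsq_ge0//.
  by rewrite (le_trans (sqc_dot _ _))// nsq_uvec mulr1.
rewrite ler_norml h andbT lerNl opprB (le_trans (h _ _))//.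
rewrite (_ : nsq _ = nsq (v - w))//; apply: eq_bigr => j _; rewrite !rowB -[w 0 j - _]opprB.
by rewrite /sqc !raddfN/= !sqrrN.
Qed.

(* The phase a aligns y with x, so that |x - a y|^2 = 2 - 2 |<x,y>|. *)
Lemma ov_lip p x y : (ov p x - ov p y) ^+ 2 <= 2 * (1 - ov x y ^+ 2).
Proof.
wlog le_xy : x y / ov p y <= ov p x => [hw|].
  have [?|/ltW le_yx] := leP (ov p y) (ov p x); first exact: hw.
  by rewrite -sqrrN opprB (ovC x y); exact: hw.
pose c := ov x y.
have [a a1 ac] : exists2 a : C, a * a^* = 1 & a^* * dotmx (uvec x) (uvec y) = c%:C%C.
  have [c0|c0] := eqVneq c 0.
    exists 1; first by rewrite conjC1 mulr1.
    by rewrite conjC1 mul1r c0; apply/eqP; rewrite -nc_eq0 -/(hv _ _) -ovE -/c c0.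
  have cC : c%:C%C != 0 :> C by rewrite -[0]/(0%:C%C) (inj_eq (@complexI R)).
  have e : dotmx (uvec x) (uvec y) * (dotmx (uvec x) (uvec y))^* = c%:C%C * c%:C%C.
    by rewrite mulcJ -nc_sqr -rmorphM /c ovE /hv expr2.
  exists (dotmx (uvec x) (uvec y) / c%:C%C); rewrite rmorphM fmorphV/= conjC_real.
    by rewrite mulrACA e mulrACA divff// mul1r.
  by rewrite mulrAC [X in X / _]mulrC e mulfK.
pose z := uvec x - a *: uvec y.
have nz : nsq z = 2 - 2 * c.
  apply: complexI; rewrite -dot_nsq dotE.
  transitivity (dotmx (uvec x) (uvec x) - a^* * dotmx (uvec x) (uvec y)
     - (a^* * dotmx (uvec x) (uvec y))^* + (a * a^*) * dotmx (uvec y) (uvec y)).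
    rewrite !dotE !mulr_sumr rmorph_sum -!sumrB -big_split/=; apply: eq_bigr => j _.
    rewrite rowB rowZ rmorphB !rmorphM/= !conjCK.
    have sqB (X Y A A' X' Y' : C) : (X - A * Y) * (X' - A' * Y') =
      X * X' - A' * (X * Y') - A * (X' * Y) + A * A' * (Y * Y') by ring.
    exact: sqB.
  rewrite ac a1 mul1r !dot_nsq !nsq_uvec conjC_real -!rmorphB -rmorphD/=.
  by congr (_%:C%C); ring.
have h : ov p x - ov p y <= nc (dotmx (uvec p) z).
  have e : ov p y = nc (dotmx (uvec p) (a *: uvec y)).
    rewrite dotmxZr ncM ncJ ovE /hv.
    suff -> : nc a = 1 by rewrite mul1r.
    by apply/eqP; rewrite -(@eqrXn2 _ 2)// ?nc_ge0// expr1n nc_sqr; apply/eqP/complexI; rewrite -mulcJ a1.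
  have zE : dotmx (uvec p) z = dotmx (uvec p) (uvec x) - dotmx (uvec p) (a *: uvec y).
    rewrite 3!dotE -sumrB; apply: eq_bigr => j _.
    by rewrite rowB rmorphB mulrBr.
  have ex : ov p x = nc (dotmx (uvec p) (uvec x)) := ovE p x.
  by rewrite ex e zE; exact: ncB_ge.
have hz : nc (dotmx (uvec p) z) ^+ 2 <= 2 - 2 * c.
  by rewrite nc_sqr -nz; have := sqc_dot (uvec p) z; rewrite nsq_uvec mul1r.
have d0 : 0 <= ov p x - ov p y by rewrite subr_ge0; exact: le_xy.
apply: (le_trans (le_trans (ler_sqr2 d0 (nc_ge0 _) h) hz)).
(* Since [0 <= c <= 1], the bound [2 - 2 c] is at most [2 (1 - c^2)], a form that the moments of the
   squared overlap can integrate. *)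
exact: sub_sqr2 (ov_itv x y).
Qed.

Lemma hv_line v : v != 0 -> exists p, forall q, hv v q = Num.sqrt (nsq v) * ov p q.
Proof.
move=> v0; exists (line_of v0) => q.
have /vlineP[a az] : repr_vec (line_of v0) \in <[v]>%VS by exact: memv_pick.
have [c uc] : exists c : C, uvec (line_of v0) = c *: v.
  by exists ((sqrtC (dotmx (a *: v) (a *: v)))^-1 * a); rewrite uvecE /normalize az scalerA.
have c1 : nc c ^+ 2 * nsq v = 1.
  rewrite -(nsq_uvec (line_of v0)) uc /nsq mulr_sumr; apply: eq_bigr => j _.
  by rewrite rowZ sqcM nc_sqr.
have nc1 : Num.sqrt (nsq v) * nc c = 1.
  apply/eqP; rewrite -(@eqrXn2 _ 2)// ?mulr_ge0 ?sqrtr_ge0 ?nc_ge0// exprMn.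
  by rewrite sqr_sqrtr ?nsq_ge0// mulrC c1 expr1n.
rewrite ovE /hv uc (_ : dotmx (c *: v) _ = c * dotmx v (uvec q)); last first.
  by rewrite !dotE mulr_sumr; apply: eq_bigr => j _; rewrite rowZ mulrA.
by rewrite ncM mulrA nc1 mul1r.
Qed.

Lemma measurable_hv v : measurable_fun setT (hv v : CP -> mR).
Proof.
have [->|v0] := eqVneq v 0.
  rewrite (_ : hv 0 = cst 0)//; apply/funext => q; apply/eqP.
  by rewrite nc_eq0 dotE big1// => j _; rewrite mxE mul0r.
have [p pE] := hv_line v0; rewrite (_ : hv v = (fun q => Num.sqrt (nsq v) * ov p q)).
  by apply: measurable_funM => //; exact: measurable_ov.
exact/funext.
Qed.

Local Notation u0 p := (uvec p 0 ord0).

(** The unit vector with the phase of its zeroth coordinate removed, that is, the normalized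
    representative [(1, z)]. On the hyperplane where that coordinate vanishes, division by zero
    gives the zero vector, in agreement with [affine_repr]. *)
Definition ecoord (j : 'I_d.+1) p : C := uvec p 0 j * (u0 p)^* / (nc (u0 p))%:C%C.

Lemma affine_ecoord p j : normalize (affine_repr p) 0 j = ecoord j p.
Proof.
rewrite /ecoord !uvecE /affine_repr; set r := repr_vec p.
have r0 : r != 0 by exact: repr_vec_neq0.
set D := dotmx r r.
have D0 : 0 < D by rewrite /D dot_nsq ltcR nsq_gt0.
have s0 : 0 < sqrtC D by rewrite sqrtC_gt0.
have nE i : normalize r 0 i = (sqrtC D)^-1 * r 0 i by exact: rowZ.
have [c0|c0] := eqVneq (r 0 ord0) 0.
  rewrite c0 invr0 scale0r {1}/normalize scaler0 [LHS]mxE !nE c0.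
  by rewrite mulr0 conjC0 mulr0 mul0r.
have n0 : `|r 0 ord0| != 0 by rewrite normr_eq0.
set a := (r 0 ord0)^-1.
have LE : normalize (a *: r) 0 j = (sqrtC (dotmx (a *: r) (a *: r)))^-1 * (a * r 0 j).
  exact: etrans (rowZ _ _ _) (congr1 _ (rowZ _ _ _)).
have dZ : dotmx (a *: r) (a *: r) = `|a| ^+ 2 * D := dnormZ (@dotmx C d.+1) a r.
rewrite LE dZ -ncE !nE.
have -> : sqrtC (`|a| ^+ 2 * D) = `|r 0 ord0|^-1 * sqrtC D.
  by rewrite rootCMl ?exprn_ge0// sqrCK ?normr_ge0// /a normfV.
rewrite normrM normfV (gtr0_norm s0) rmorphM fmorphV/= (conj_Creal (gtr0_real s0)).
have e : (r 0 ord0)^* = `|r 0 ord0| ^+ 2 / r 0 ord0.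
  by rewrite normCK mulrAC mulfV ?mul1r.
rewrite e /a; move: n0 c0 s0; move: `|r 0 ord0| (r 0 ord0) (sqrtC D) (r 0 j) => X Y Z W.
by move=> X0 Y0 Z0; field; rewrite X0 Y0 gt_eqF.
Qed.

End geometry.

Section kernel.
Context {R : realType} (d : nat).
Local Notation CP := (CP R d).
Local Notation C := R[i].
Local Notation vol := (vol R d).
Local Notation mR := (measurableTypeR R).
Implicit Types (p q x y : CP) (v w : 'rV[C]_d.+1).
Local Notation u0 p := (uvec p 0 ord0).

Lemma ncV (z : C) : nc z^-1 = (nc z)^-1.
Proof. by apply: complexI; rewrite fmorphV/= -!ncE normfV. Qed.

Lemma ncR (r : R) : 0 <= r -> nc (r%:C%C : C) = r.
Proof. by move=> r0; apply: complexI; rewrite -ncE ger0_norm// ler0c. Qed.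

Lemma hv_sqr v p : hv v p ^+ 2 = sqc (dotmx v (uvec p)).
Proof. exact: nc_sqr. Qed.

Lemma nc_sqr_ecoord0 p : (u0 p)^* * u0 p = ((nc (u0 p))%:C%C) ^+ 2.
Proof. by rewrite mulrC mulcJ -nc_sqr rmorphXn. Qed.

Lemma dot_ecoord p q :
  \sum_j ecoord j p * (ecoord j q)^* =
  ((u0 p)^* / (nc (u0 p))%:C%C) * (u0 q / (nc (u0 q))%:C%C) * dotmx (uvec p) (uvec q).
Proof.
rewrite dotE mulr_sumr; apply: eq_bigr => j _; rewrite /ecoord.
rewrite !rmorphM fmorphV/= conjC_real conjCK.
have AC (x y z x' y' z' : C) : x * y * z * (x' * y' * z') = y * z * (y' * z') * (x * x') by ring.
exact: AC.
Qed.

Lemma sqc_dot_ecoord p q : sqc (\sum_j ecoord j p * (ecoord j q)^*) =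
  (0 < nc (u0 p))%R%:R * (0 < nc (u0 q))%R%:R * ov p q ^+ 2.
Proof.
have e (a b : C) : nc a = nc b -> sqc (a / (nc b)%:C%C) = (0 < nc b)%R%:R.
  move=> ab; rewrite -nc_sqr ncM ab lt0r nc_ge0 andbT.
  have [->|b0] := eqVneq (nc b) 0; first by rewrite mul0r expr0n.
  by rewrite ncV (ncR (nc_ge0 b)) divff// expr1n.
have E1 := e _ _ (ncJ (u0 p)).
have E2 := e _ _ (erefl (nc (u0 q))).
have E3 : sqc (dotmx (uvec p) (uvec q)) = ov p q ^+ 2 by rewrite ovE hv_sqr.
have M3 (S X Y Z : C) : S = X * Y * Z -> sqc S = sqc X * sqc Y * sqc Z.
  by move=> ->; rewrite 2!sqcM.
have H := M3 _ _ _ _ (dot_ecoord p q).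
apply: (etrans H); exact: (f_equal2 _ (f_equal2 _ E1 E2) E3).
Qed.

Lemma polar_Re (X Y : C) (a b c : R) :
  a = sqc (X^* + 1 * Y^*) -> b = sqc X^* -> c = sqc Y^* ->
  complex.Re (X * Y^*) = 2^-1 * (a - b - c).
Proof.
by move=> -> -> ->; case: X => x x'; case: Y => y y'; rewrite mul1r /sqc /=; field.
Qed.

Lemma polar_Im (X Y : C) (a b c : R) :
  a = sqc (X^* + 'i%C * Y^*) -> b = sqc X^* -> c = sqc Y^* ->
  complex.Im (X * Y^*) = - 2^-1 * (a - b - c).
Proof.
by move=> -> -> ->; case: X => x x'; case: Y => y y'; rewrite /sqc /=; field.
Qed.

(** [uvec p] depends on an arbitrary choice of representative, but [uvec p 0 j] times the conjugate
    of [uvec p 0 ord0] does not depend on its phase. Polarization recovers this product from squared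
    overlaps with [e_j + e_0], [e_j + i e_0], [e_j] and [e_0], which are measurable because balls
    are. *)
Lemma measurable_ecoord j :
  measurable_fun setT (fun p => complex.Re (ecoord j p) : mR) /\
  measurable_fun setT (fun p => complex.Im (ecoord j p) : mR).
Proof.
pose e (k : 'I_d.+1) : 'rV[C]_d.+1 := delta_mx 0 k.
have dote k p : dotmx (e k) (uvec p) = (uvec p 0 k)^*.
  rewrite dotE (bigD1 k)//= [e k 0 _]mxE !eqxx mul1r big1 ?addr0// => i ik.
  by rewrite [e k 0 _]mxE (negbTE ik) andbF mul0r.
have dotDe (c : C) p : dotmx (e j + c *: e ord0) (uvec p) = (uvec p 0 j)^* + c * (u0 p)^*.
  rewrite -!dote !dotE mulr_sumr -big_split/=; apply: eq_bigr => i _.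
  by rewrite rowD rowZ mulrDl mulrA.
have h2 v : measurable_fun setT (fun p => hv v p ^+ 2 : mR).
  by apply: measurable_funX; exact: measurable_hv.
have h0E p : nc (u0 p) = hv (e ord0) p by rewrite /hv dote ncJ.
have h1 k p : hv (e k) p ^+ 2 = sqc (uvec p 0 k)^* := etrans (hv_sqr _ _) (congr1 (@sqc R) (dote k p)).
have h3 (c : C) p : hv (e j + c *: e ord0) p ^+ 2 = sqc ((uvec p 0 j)^* + c * (u0 p)^*) :=
  etrans (hv_sqr _ _) (congr1 (@sqc R) (dotDe c p)).
have reE p : complex.Re (uvec p 0 j * (u0 p)^*) =
   2^-1 * (hv (e j + 1 *: e ord0) p ^+ 2 - hv (e j) p ^+ 2 - hv (e ord0) p ^+ 2).
  exact: (polar_Re (h3 _ p) (h1 j p) (h1 ord0 p)).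
have imE p : complex.Im (uvec p 0 j * (u0 p)^*) =
   - 2^-1 * (hv (e j + 'i%C *: e ord0) p ^+ 2 - hv (e j) p ^+ 2 - hv (e ord0) p ^+ 2).
  exact: (polar_Im (h3 _ p) (h1 j p) (h1 ord0 p)).
have mV : measurable_fun setT (fun p => (nc (u0 p))^-1 : mR).
  have -> : (fun p => (nc (u0 p))^-1) = (fun p => powR (hv (e ord0) p) (-1)).
    by apply/funext => p; rewrite powR_inv1 ?hv_ge0// h0E.
  exact: (measurableT_comp (measurable_powR _) (measurable_hv _)).
have cRe (z : C) (r : R) : complex.Re (z / r%:C%C) = complex.Re z / r.
  by rewrite -fmorphV; case: z => a b; rewrite /= mulr0 subr0.
have cIm (z : C) (r : R) : complex.Im (z / r%:C%C) = complex.Im z / r.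
  by rewrite -fmorphV; case: z => a b; rewrite /= mulr0 add0r.
split.
  have -> : (fun p => complex.Re (ecoord j p)) =
     (fun p => 2^-1 * (hv (e j + 1 *: e ord0) p ^+ 2 - hv (e j) p ^+ 2 - hv (e ord0) p ^+ 2) * (nc (u0 p))^-1).
    by apply/funext => p; apply: etrans (cRe _ _) _; congr (_ / _); exact: reE.
  apply: measurable_funM => //; apply: measurable_funM => //.
  exact: (measurable_funB (measurable_funB (h2 _) (h2 _)) (h2 _)).
have -> : (fun p => complex.Im (ecoord j p)) =
   (fun p => - 2^-1 * (hv (e j + 'i%C *: e ord0) p ^+ 2 - hv (e j) p ^+ 2 - hv (e ord0) p ^+ 2) * (nc (u0 p))^-1).
  by apply/funext => p; apply: etrans (cIm _ _) _; congr (_ / _); exact: imE.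
apply: measurable_funM => //; apply: measurable_funM => //.
exact: (measurable_funB (measurable_funB (h2 _) (h2 _)) (h2 _)).
Qed.

Lemma cbm_ecoord j : cbm (ecoord j : CP -> C).
Proof.
have b p : sqc (ecoord j p) <= 1.
  have := sqc_dot_ecoord p p; set S := \sum_i _ => hS.
  have SE : S = (\sum_i sqc (ecoord i p))%:C%C.
    by rewrite rmorph_sum; apply: eq_bigr => i _; rewrite mulcJ.
  have T0 : 0 <= \sum_i sqc (ecoord i p) by apply: sumr_ge0 => i _; exact: sqc_ge0.
  apply: (@le_trans _ _ (\sum_i sqc (ecoord i p))).
    by rewrite (bigD1 j)//= lerDl sumr_ge0// => i _; exact: sqc_ge0.
  rewrite -(@ler_pXn2r _ 2)// ?nnegrE// expr1n.
  have <- : sqc S = (\sum_i sqc (ecoord i p)) ^+ 2.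
    by rewrite SE /sqc /= expr0n addr0.
  rewrite hS mulr_ile1 ?mulr_ge0 ?ov_ge0//; last by rewrite expr_le1// ?ov_ge0// ov_le1.
  by case: (0 < nc _) => /=; rewrite ?mul1r ?mul0r.
have [m1 m2] := measurable_ecoord j.
have n1 (r s : R) : r ^+ 2 + s ^+ 2 <= 1 -> `|r| <= 1.
  move=> h; rewrite -(@ler_pXn2r _ 2)// ?nnegrE// expr1n real_normK ?num_real//.
  by rewrite (le_trans _ h)// lerDl sqr_ge0.
split; split => //; exists 1 => p; first exact: n1 (b p).
by apply: (n1 _ (complex.Re (ecoord j p))); rewrite addrC; exact: b.
Qed.

Lemma kernel_ecoord L p q : projective_kernel L p q =
  'C(d + L, d)%:R * (\sum_j ecoord j p * (ecoord j q)^*) ^+ L.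
Proof.
rewrite /projective_kernel dotE; congr (_ * _ ^+ L); apply: eq_bigr => j _.
exact: f_equal2 (affine_ecoord p j) (congr1 _ (affine_ecoord q j)).
Qed.

Lemma sqc_kernel L p q : (0 < L)%N -> sqc (projective_kernel L p q) =
  (0 < nc (u0 p))%R%:R * (0 < nc (u0 q))%R%:R * ('C(d + L, d)%:R ^+ 2 * (ov p q ^+ 2) ^+ L).
Proof.
case: L => // L _.
rewrite kernel_ecoord sqcM sqcX sqc_dot_ecoord.
have -> : sqc ('C(d + L.+1, d)%:R) = 'C(d + L.+1, d)%:R ^+ 2 :> R.
  by rewrite -(rmorph_nat (@real_complex R)) /sqc /= expr0n addr0.
have key (a b : bool) (x y : R) :
    x * (a%:R * b%:R * y) ^+ L.+1 = a%:R * b%:R * (x * y ^+ L.+1).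
  by case: a; case: b; rewrite ?mul1r ?mul0r ?mulr1 ?expr0n ?mulr0 ?mul0r ?expr0n ?mulr0.
exact: key.
Qed.

Lemma kernel_diag L p : 0 < nc (u0 p) -> projective_kernel L p p = 'C(d + L, d)%:R.
Proof.
move=> p0; rewrite kernel_ecoord dot_ecoord dot_nsq nsq_uvec mulr1.
have n0 : (nc (u0 p))%:C%C != 0 :> C; last first.
  by rewrite mulrACA nc_sqr_ecoord0 expr2 mulrACA divff// mulr1 expr1n mulr1.
by apply/eqP => /(congr1 (@complex.Re R)) /= n0; rewrite n0 ltxx in p0.
Qed.

End kernel.

Section kernel.
Context {R : realType} (d : nat).
Local Notation CP := (CP R d).
Local Notation C := R[i].
Local Notation vol := (vol R d).
Implicit Types (p q x y : CP) (v w : 'rV[C]_d.+1).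

(** The L-th power of the Hermitian product is expanded over maps from L slots to coordinates, and
    equal monomials are collected. There are exactly N monomials of degree L in [d + 1] variables,
    so the index type has the size demanded by the trace computation. *)
Lemma kernel_fkernel L : exists phi : 'I_('C(d + L, d)) -> CP -> C,
  (forall a, cbm (phi a)) /\ forall p q, projective_kernel L p q = fkernel phi p q.
Proof.
pose S := [set t : d.+1.-tuple 'I_L.+1 | (\sum_(i <- t) i)%N == L]%SET.
suff : exists phi : 'I_(#|S|) -> CP -> C,
  (forall a, cbm (phi a)) /\ forall p q, projective_kernel L p q = fkernel phi p q.
  by rewrite card_ord_partitions.
pose N : R := 'C(d + L, d)%:R.
pose cnt (f : {ffun 'I_L -> 'I_d.+1}) (j : 'I_d.+1) : nat := #|[set i | f i == j]%SET|.
have cntL f j : (cnt f j < L.+1)%N.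
  by rewrite ltnS -[X in (_ <= X)%N]card_ord max_card.
pose ty (f : {ffun 'I_L -> 'I_d.+1}) : d.+1.-tuple 'I_L.+1 := [tuple inord (cnt f j) | j < d.+1].
have tyS f : ty f \in S.
  rewrite inE big_tuple; apply/eqP.
  transitivity (\sum_(j < d.+1) \sum_(i < L | f i == j) 1)%N.
    apply: eq_bigr => j _; rewrite tnth_mktuple inordK// sum1_card.
    by apply: eq_card => i; rewrite !inE.
  transitivity (\sum_(i < L) 1)%N; last by rewrite sum1_card card_ord.
  by rewrite [RHS](partition_big f predT).
pose M (t : d.+1.-tuple 'I_L.+1) p : C := \prod_j ecoord j p ^+ tnth t j.
have ME (f : {ffun 'I_L -> 'I_d.+1}) p : \prod_i ecoord (f i) p = M (ty f) p.
  rewrite (partition_big f predT)//= /M; apply: eq_bigr => j _.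
  rewrite (eq_bigr (fun=> ecoord j p)); last by move=> i /eqP ->.
  rewrite prodr_const tnth_mktuple inordK//; congr (_ ^+ _).
  by apply: eq_card => i; rewrite !inE.
(* A multinomial coefficient, kept as the cardinality of a fibre; its square root is shared between
   the two arguments of the kernel. *)
pose c (t : d.+1.-tuple 'I_L.+1) : R := #|[set f | ty f == t]%SET|%:R.
pose phi (a : 'I_(#|S|)) p : C := (Num.sqrt (N * c (enum_val a)))%:C%C * M (enum_val a) p.
exists phi; split.
  move=> a; apply: cbmM; first exact: cbm_cst.
  apply: cbm_prod => j _; elim: (nat_of_ord _) => [|k IH].
    by under eq_fun do rewrite expr0; exact: cbm_cst.
  by under eq_fun do rewrite exprS; exact: cbmM (cbm_ecoord _) IH.
move=> p q; rewrite kernel_ecoord -[X in _ ^+ X](card_ord L) -prodr_const bigA_distr_bigA/=.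
transitivity (N%:C%C * \sum_(t in S) (c t)%:C%C * (M t p * (M t q)^*)).
  rewrite -(rmorph_nat (@real_complex R)); congr (_ * _).
  rewrite (partition_big ty (mem S))/=; last by move=> f _; exact: tyS.
  apply: eq_bigr => t tS.
  rewrite (eq_bigr (fun=> M t p * (M t q)^*)); last first.
    by move=> f /eqP <-; rewrite big_split/= ME -rmorph_prod/= ME.
  rewrite sumr_const -mulr_natl rmorph_nat; congr (_%:R * _).
  by apply: eq_card => f; rewrite !inE.
rewrite mulr_sumr big_enum_val /fkernel; apply: eq_bigr => a _; rewrite /phi.
have e : N * c (enum_val a) = Num.sqrt (N * c (enum_val a)) * Num.sqrt (N * c (enum_val a)).
  by rewrite -expr2 sqr_sqrtr// mulr_ge0.
rewrite mulrA -rmorphM/= {1}e rmorphM/= [in RHS]rmorphM/= conjC_real.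
by move: (_%:C%C) (M _ p) (M _ q)^* => s X Y; ring.
Qed.

End kernel.

(** * Variance of the number of points in a ball *)

Section spectrum.
Context dT (T : measurableType dT) (R : realType) (m : probability T R).
Local Notation pw := (power_measure m).
Local Notation C := R[i].
Variables (n : nat) (phi : 'I_n -> T -> C).
Hypothesis hphi : forall a, cbm (phi a).
Hypothesis ortho : gram m setT phi = 1%:M.

Lemma reproducing x : \int[m]_y sqc (fkernel phi x y) = complex.Re (fkernel phi x x).
Proof.
have h := integral_fkernel_sqr m (@measurableT _ T) hphi x.
rewrite (_ : \int[m]_y _ = \int[m]_y (\1_setT y * sqc (fkernel phi x y))); last first.
  by apply: eq_Rintegral => y _; rewrite indicT mul1r.
suff <- : (\int[m]_y (\1_setT y * sqc (fkernel phi x y)))%:C%C = fkernel phi x x by [].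
rewrite h /fkernel; apply: eq_bigr => a _; rewrite (bigD1 a)//= ortho mxE eqxx mulr1.
by rewrite big1 ?addr0// => b /negbTE ba; rewrite mxE ba mulr0.
Qed.

Variables (B : set T) (mB : measurable B).

(** By finite rank the inner integral is a finite combination of the products of [phi a] with
    conjugates of [phi b]. *)
Lemma rbm_integral_fkernel : rbm (fun x => \int[m]_y (\1_B y * sqc (fkernel phi x y))).
Proof.
have h x := integral_fkernel_sqr m mB hphi x.
have -> : (fun x => \int[m]_y (\1_B y * sqc (fkernel phi x y))) =
   (fun x => complex.Re (\sum_a \sum_b (phi a x * (phi b x)^*) * gram m B phi b a)).
  by apply/funext => x; rewrite -h.
have [] // : cbm (fun x => \sum_a \sum_b (phi a x * (phi b x)^*) * gram m B phi b a).
apply: cbm_sum => a _; apply: cbm_sum => b _; apply: cbmM; last exact: cbm_cst.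
exact: cbm_pair.
Qed.

Lemma rbm_fkernel_diag : rbm (fun x => complex.Re (fkernel phi x x)).
Proof.
have [] // : cbm (fun x => fkernel phi x x).
by apply: cbm_sum => a _; exact: cbm_pair.
Qed.

Lemma rbm_fkernel_sqr x : rbm (fun y => sqc (fkernel phi x y)).
Proof.
apply: rbm_sqc; apply: cbm_sum => a _; apply: cbmM; first exact: cbm_cst.
exact: cbm_conj.
Qed.

(** The sum of [lam a - lam a ^+ 2] is the integral of the diagonal over [B] minus that of the
    squared kernel over [B x B]. The reproducing property writes the diagonal as an integral over
    all [y], and only [y] outside [B] survives. *)
Lemma spectrum : exists lam : 'I_n -> R,
  [/\ forall a, 0 <= lam a <= 1,
      forall k, cint (pw k) (fun y => (\prod_(j < k) (\1_B (tnth y j))%:C%C) *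
         \det (\matrix_(i, j) fkernel phi (tnth y i) (tnth y j))) =
         (\sum_(f : {ffun 'I_k -> 'I_n} | injectiveb f) \prod_j lam (f j))%:C%C,
      \sum_a lam a = \int[m]_x (\1_B x * complex.Re (fkernel phi x x)) &
      \sum_a lam a * (1 - lam a) =
      \int[m]_x (\1_B x * \int[m]_y ((1 - \1_B y) * sqc (fkernel phi x y)))].
Proof.
have [psi [lam [hpsi Kpsi orthoB lam01]]] := diagonalize hphi mB ortho.
have rB := rbm_indic R mB.
have s1 : \sum_a lam a = \int[m]_x (\1_B x * complex.Re (fkernel phi x x)).
  have e : (\sum_a lam a)%:C%C = cint m (fun x => (\1_B x)%:C%C * fkernel phi x x).
    transitivity (cint m (fun x => (\1_B x)%:C%C * fkernel psi x x)).
      rewrite -gram_trace// rmorph_sum; apply: eq_bigr => a _.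
      by rewrite mxE orthoB eqxx mul1r.
    by apply: eq_cint => x; rewrite Kpsi.
  rewrite -[LHS]/(complex.Re (\sum_a lam a)%:C%C) e /cint /=.
  by apply: eq_Rintegral => x _; case: (fkernel phi x x) => a b; rewrite /= mul0r subr0.
exists lam; split => //.
  move=> k; rewrite -(cint_det k mB hpsi orthoB); apply: eq_cint => y; congr (_ * \det _).
  by apply/matrixP => i j; rewrite !mxE Kpsi.
have s2 : \sum_a lam a ^+ 2 = \int[m]_x (\1_B x * \int[m]_y (\1_B y * sqc (fkernel phi x y))).
  apply: complexI; transitivity
    (\int[m]_x (\1_B x * \int[m]_y (\1_B y * sqc (fkernel psi x y))))%:C%C; last first.
    apply: (congr1 (fun r : R => r%:C%C)); apply: eq_Rintegral => x _; congr (_ * _).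
    by apply: eq_Rintegral => y _; rewrite Kpsi.
  rewrite -sum_gram_sqr// rmorph_sum; apply: eq_bigr => a _.
  rewrite (bigD1 a)//= big1 ?addr0 => [|b /negbTE ba].
    by rewrite mxE orthoB eqxx mul1r mulcJ /sqc /= expr0n addr0.
  by rewrite mxE orthoB eq_sym ba mul0r mul0r.
rewrite (eq_bigr (fun a => lam a - lam a ^+ 2)); last by move=> a _; ring.
rewrite sumrB s1 s2; apply: etrans (esym (RintegralB measurableT _ _)) _.
- by apply: rbm_integrable; [exact: prob_lty|exact: rbmM rbm_fkernel_diag].
- by apply: rbm_integrable; [exact: prob_lty|exact: rbmM rbm_integral_fkernel].
apply: eq_Rintegral => x _; rewrite -mulrBr; congr (_ * _).
rewrite -reproducing -RintegralB//; last 2 first.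
- by apply: rbm_integrable; [exact: prob_lty|exact: rbm_fkernel_sqr].
- by apply: rbm_integrable; [exact: prob_lty|apply: rbmM => //; exact: rbm_fkernel_sqr].
by apply: eq_Rintegral => y _; rewrite mulrBl mul1r.
Qed.

End spectrum.

(** * The projective kernel as an orthogonal projection *)

Section projective_spectrum.
Context {R : realType} (d : nat).
Local Notation CP := (CP R d).
Local Notation C := R[i].
Local Notation vol := (vol R d).
Local Notation pw := (power_measure vol).
Implicit Types (p q x y : CP) (v w : 'rV[C]_d.+1).
Local Notation u0 p := (uvec p 0 ord0).
Hypothesis d0 : (0 < d)%N.
Variable L : nat.
Hypothesis L0 : (0 < L)%N.
Local Notation K := (@projective_kernel R d L).
Local Notation N := ('C(d + L, d)).

Definition affine_ind (p : CP) : R := (0 < nc (u0 p))%R%:R.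

(** The modulus of the zeroth coordinate is the overlap with a fixed point, so the hyperplane where
    the kernel degenerates is controlled by the ball formula and has volume zero. *)
Lemma nc_u0_ov : exists p0, forall q, (0 < nc (u0 q)) = (0 < ov p0 q).
Proof.
pose e : 'rV[C]_d.+1 := delta_mx 0 ord0.
have e0 : e != 0.
  apply/eqP => /matrixP /(_ 0 ord0) /eqP.
  by rewrite !mxE !eqxx oner_eq0.
have [p hp] := hv_line e0; exists p => q.
have <- : hv e q = nc (u0 q).
  rewrite /hv dotE (bigD1 ord0)//= [e 0 _]mxE !eqxx mul1r big1 ?addr0 ?ncJ// => i i0.
  by rewrite [e 0 _]mxE (negbTE i0) andbF mul0r.
by rewrite hp pmulr_rgt0// sqrtr_gt0 nsq_gt0.
Qed.

Lemma rbm_affine_ind : rbm affine_ind.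
Proof.
have [p0 hp0] := nc_u0_ov.
have -> : affine_ind = \1_[set q | 0 < ov p0 q].
  apply/funext => q; rewrite /affine_ind hp0 indicE; congr (_%:R).
  by congr nat_of_bool; apply/idP/idP; rewrite inE.
exact: rbm_indic (measurable_ov_gt _ _).
Qed.

Lemma affine_ind_ae (f : CP -> R) : rbm f ->
  \int[vol]_q (affine_ind q * f q) = \int[vol]_q f q.
Proof.
move=> rf; have [p0 hp0] := nc_u0_ov; congr fine.
have [mf _] := rf; have [mg _] := rbmM rbm_affine_ind rf.
apply: ae_eq_integral => //.
- by apply/measurable_EFinP; exact: mg.
- by apply/measurable_EFinP; exact: mf.
exists (~` [set q | 0 < ov p0 q]); split.
- by apply: measurableC; exact: measurable_ov_gt.
- apply: etrans (probability_setC vol (measurable_ov_gt p0 0)) _.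
  rewrite vol_ov_gt// /clamp maxxx min_l ?ler01// expr0n subr0 expr1n.
  by rewrite subee.
move=> q /= h q0; apply: h => _; rewrite /affine_ind hp0 q0.
by rewrite mul1r.
Qed.

Definition moment (m : nat) : R := (m`! * d`!)%:R / (m + d)`!%:R.

Lemma rbm_ov p : rbm (ov p).
Proof.
by split; [exact: measurable_ov|exists 1 => q; rewrite ger0_norm ?ov_ge0// ov_le1].
Qed.

Lemma rbmX (f : CP -> R) k : rbm f -> rbm (fun q => f q ^+ k).
Proof.
move=> rf; elim: k => [|k IH]; first by under eq_fun do rewrite expr0; exact: rbm_cst.
by under eq_fun do rewrite exprS; exact: rbmM.
Qed.

Lemma rbm_ovX p k : rbm (fun q => (ov p q ^+ 2) ^+ k).
Proof. exact: rbmX (rbmX _ (rbm_ov p)). Qed.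

Lemma Rmoment_ov p m : \int[vol]_q (ov p q ^+ 2) ^+ m.+1 = moment m.+1.
Proof. by rewrite /Rintegral moment_ov. Qed.

Lemma binN_moment : N%:R * moment L = 1 :> R.
Proof.
rewrite /moment mulrA -natrM.
have -> : (N * (L`! * d`!) = (L + d)`!)%N.
  have := bin_fact (leq_addr L d); rewrite addKn addnC => <-.
  by rewrite [(L`! * _)%N]mulnC.
by rewrite divff// pnatr_eq0 -lt0n fact_gt0.
Qed.

Lemma momentS m : moment m.+1 = moment m * (m.+1%:R / (m.+1 + d)%:R).
Proof.
rewrite /moment addSn !factS.
have f0 k : k`!%:R != 0 :> R by rewrite pnatr_eq0 -lt0n fact_gt0.
have n0 k : k.+1%:R != 0 :> R by rewrite pnatr_eq0.
rewrite -mulnA !natrM; move: (f0 (m + d)%N) (n0 (m + d)%N).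
move: (m.+1%:R) (m`!%:R) (d`!%:R) ((m + d)`!%:R) ((m + d).+1%:R) => a b c e f e0 g0.
by field; rewrite e0 g0.
Qed.

Lemma sqc_kernelE x y : sqc (K x y) =
  affine_ind x * (affine_ind y * (N%:R ^+ 2 * (ov x y ^+ 2) ^+ L)).
Proof. by rewrite mulrA; exact: sqc_kernel. Qed.

Lemma integral_sqc_kernel x : \int[vol]_y sqc (K x y) = affine_ind x * N%:R.
Proof.
have rN : rbm (fun y => N%:R ^+ 2 * (ov x y ^+ 2) ^+ L).
  by apply: rbmM; [exact: rbm_cst|exact: rbm_ovX].
transitivity (\int[vol]_y (affine_ind x * (affine_ind y * (N%:R ^+ 2 * (ov x y ^+ 2) ^+ L)))).
  by apply: eq_Rintegral => y _; exact: sqc_kernelE.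
rewrite RintegralZl//; last first.
  by apply: rbm_integrable; [exact: prob_lty|exact: rbmM rbm_affine_ind rN].
congr (_ * _); apply: etrans (affine_ind_ae rN) _.
rewrite RintegralZl//; last first.
  by apply: rbm_integrable; [exact: prob_lty|exact: rbm_ovX].
have -> : \int[vol]_y (ov x y ^+ 2) ^+ L = moment L.
  by move: L0; case: (L) => // l _; exact: Rmoment_ov.
by rewrite expr2 -mulrA binN_moment mulr1.
Qed.

Lemma kernel_diagE p : K p p = (affine_ind p * N%:R)%:C%C.
Proof.
rewrite /affine_ind; have [h|h] := ltP 0 (nc (u0 p)).
  by rewrite kernel_diag// mul1r rmorph_nat.
have /eqP : sqc (K p p) = 0.
  by rewrite sqc_kernelE /affine_ind ltNge h mul0r.
rewrite mul0r paddr_eq0 ?sqr_ge0// !sqrf_eq0 => /andP[/eqP a /eqP b].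
by apply/eqP; rewrite eq_complex a b !eqxx.
Qed.

Lemma integral_affine_ind : \int[vol]_x affine_ind x = 1.
Proof.
transitivity (\int[vol]_x (affine_ind x * 1)).
  by apply: eq_Rintegral => x _; rewrite mulr1.
rewrite (affine_ind_ae (@rbm_cst _ CP R 1)) Rintegral_cst// mul1r.
by rewrite [X in fine X](probability_setT vol).
Qed.

(** Up to the null hyperplane the diagonal is N, and so is the integral of the squared kernel over
    its second argument because [N * moment L = 1]. Both inputs of [gram_eq1] therefore equal N. *)
Lemma kernel_spectrum (B : set CP) : measurable B -> exists lam : 'I_N -> R,
  [/\ forall a, 0 <= lam a <= 1,
      forall k, cint (pw k) (fun y : k.-tuple CP => (\prod_(j < k) (\1_B (tnth y j))%:C%C) *
         \det (\matrix_(i, j) K (tnth y i) (tnth y j))) =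
         (\sum_(f : {ffun 'I_k -> 'I_N} | injectiveb f) \prod_j lam (f j))%:C%C,
      \sum_a lam a = N%:R * fine (vol B) &
      \sum_a lam a * (1 - lam a) =
      \int[vol]_x (\1_B x * \int[vol]_y ((1 - \1_B y) * sqc (K x y)))].
Proof.
move=> mB; have [phi [hphi Kphi]] := @kernel_fkernel R d L.
have rI := rbm_affine_ind.
have hI : \int[vol]_x (affine_ind x * N%:R) = N%:R.
  transitivity (\int[vol]_x (N%:R * affine_ind x)).
    by apply: eq_Rintegral => x _; rewrite mulrC.
  rewrite RintegralZl ?integral_affine_ind ?mulr1//.
  by apply: rbm_integrable; [exact: prob_lty|].
have ortho : gram vol setT phi = 1%:M.
  apply: gram_eq1 => //.
    transitivity (cint vol (fun x => (affine_ind x * N%:R)%:C%C)).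
      by apply: eq_cint => x; rewrite -Kphi; exact: kernel_diagE.
    by rewrite cint_real hI rmorph_nat.
  rewrite -[RHS]hI; apply: eq_Rintegral => x _.
  by rewrite -integral_sqc_kernel; apply: eq_Rintegral => y _; rewrite Kphi.
have [lam [l01 ldet lsum lvar]] := spectrum hphi ortho mB.
exists lam; split; first exact: l01.
- move=> k; apply: etrans _ (ldet k); apply: eq_cint => y; congr (_ * \det _).
  by apply/matrixP => i j; rewrite !mxE Kphi.
- apply: etrans lsum _; transitivity (\int[vol]_x (affine_ind x * (N%:R * \1_B x))).
    apply: eq_Rintegral => x _; rewrite -Kphi kernel_diagE /=.
    by rewrite mulrC mulrA.
  rewrite affine_ind_ae; last by apply: rbmM; [exact: rbm_cst|exact: rbm_indic].
  rewrite RintegralZl//; last first.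
    by apply: rbm_integrable; [exact: prob_lty|exact: rbm_indic].
  by congr (_ * fine _); rewrite integral_indic// setIT.
apply: etrans lvar _; apply: eq_Rintegral => x _; congr (_ * _).
by apply: eq_Rintegral => y _; rewrite Kphi.
Qed.

End projective_spectrum.

Lemma Rintegral_rbm_sum dT (T : measurableType dT) (R : realType)
    (m : probability T R) n (f : 'I_n -> T -> R) : (forall k, rbm (f k)) ->
  \int[m]_x \sum_(k < n) f k x = \sum_(k < n) \int[m]_x f k x.
Proof.
elim: n f => [|n IH] f hf.
  under eq_Rintegral do rewrite big_ord0.
  by rewrite big_ord0 Rintegral_cst// mul0r.
under eq_Rintegral do rewrite big_ord_recl.
rewrite big_ord_recl -IH// RintegralD//; apply: rbm_integrable => //.
- exact: prob_lty.
- exact: prob_lty.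
- by apply: rbm_sum => k _; exact: hf.
Qed.

Section ball_variance.
Context {R : realType} (d : nat).
Local Notation CP := (CP R d).
Local Notation vol := (vol R d).
Local Notation mR := (measurableTypeR R).
Implicit Types (p q x y : CP).
Hypothesis d0 : (0 < d)%N.

Lemma measurable_shell p (c r : R) : measurable [set q | `|ov p q - c| < r].
Proof.
rewrite [X in measurable X](_ : _ = (fun q => `|ov p q - c| : mR) @^-1` `]-oo, r[).
  rewrite -[X in measurable X]setTI.
  have : measurable_fun setT (fun q => `|ov p q - c| : mR); last exact.
  apply: measurableT_comp => //; apply: measurable_funB => //; exact: measurable_ov.
by apply/seteqP; split => q /=; rewrite in_itv.
Qed.

Lemma vol_shell p (c r : R) : 0 <= r -> fine (vol [set q | `|ov p q - c| < r]) <= 4 * d%:R * r.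
Proof.
move=> r0; set S := [set q | _]; set E := [set q | c + r < ov p q].
have mS : measurable S := measurable_shell p c r.
have mE : measurable E := measurable_ov_gt p _.
have SE : [disjoint S & E]%classic.
  apply/disj_setPS => q [] /=; rewrite /S /E /= ltr_norml => /andP[_]; lra.
have le : c - r <= c + r by lra.
have h : (vol S + vol E <= vol E + (4 * d%:R * r)%:E)%E.
  apply: (@le_trans _ _ (vol [set q | c - r < ov p q])); last first.
    apply: le_trans (vol_layer d0 p le) _; rewrite leeD2l// lee_fin.
    by rewrite le_eqVlt; apply/orP; left; apply/eqP; ring.
  have e : vol (S `|` E) = (vol S + vol E)%E.
    by apply: measureU => //; apply/eqP.
  rewrite -e; apply: le_measure; rewrite ?inE//; first exact: measurableU.
    exact: measurable_ov_gt.
  move=> q [] /=; rewrite /S /E /=; last lra.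
  by rewrite ltr_norml => /andP[+ _]; lra.
have fS : vol S \is a fin_num by apply: fin_num_measure.
have fE : vol E \is a fin_num by apply: fin_num_measure.
move: h fS fE; move: (vol S) (vol E) => [s| |] [e| |]//= + _ _.
by rewrite -!EFinD lee_fin addrC lerD2l.
Qed.

(** If [2^n <= u < 2^(n+1)], the single term of index [n + 1] equals [4^(-n)], which is at least
    [u^(-2)]. *)
Lemma dyadic_majorant (u : R) n : 0 <= u -> u < 2 ^+ n ->
  (1 + u ^+ 2)^-1 <= \sum_(k < n.+1) (4 / 4 ^+ k) * (u < 2 ^+ k)%R%:R.
Proof.
move=> u0; elim: n => [|n IH] un.
  rewrite big_ord1 un expr0 divr1 mulr1.
  rewrite (@le_trans _ _ 1) ?ler1n// invf_le1 ?lerDl ?sqr_ge0//.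
  by rewrite (lt_le_trans (@ltr01 R))// lerDl sqr_ge0.
rewrite big_ord_recr/=; have [lt|ge] := ltP u (2 ^+ n).
  rewrite (le_trans (IH lt))// lerDl mulr_ge0// divr_ge0// exprn_ge0//.
apply: ler_wpDl.
  by apply: sumr_ge0 => k _; rewrite mulr_ge0// divr_ge0// exprn_ge0.
rewrite un mulr1 (exprS 4 n) invfM mulrA divff// mul1r.
have p4 : 0 < 4 ^+ n :> R by rewrite exprn_gt0.
have u4 : 4 ^+ n <= u ^+ 2.
  have -> : 4 ^+ n = (2 ^+ n) ^+ 2 :> R by rewrite -exprM mulnC exprM; congr (_ ^+ _); ring.
  by rewrite ler_pXn2r// nnegrE// exprn_ge0.
by rewrite lef_pV2 ?posrE//; lra.
Qed.

Lemma sum_geo_half n : \sum_(k < n) (2 ^+ k)^-1 <= 2 :> R.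
Proof.
suff -> : \sum_(k < n) (2 ^+ k)^-1 = 2 - 2 / 2 ^+ n :> R.
  by rewrite gerBl divr_ge0// exprn_ge0.
elim: n => [|n IH]; first by rewrite big_ord0 expr0 divr1 subrr.
rewrite big_ord_recr/= IH exprS.
have : 2 ^+ n != 0 :> R by rewrite expf_neq0.
by move: (2 ^+ n) => a a0; field.
Qed.

Variables (p : CP) (c : R) (L : nat).
Hypothesis L0 : (0 < L)%N.
Hypothesis c12 : -1 <= c <= 2.
Let s : R := Num.sqrt L%:R.

Let s_gt0 : 0 < s. Proof. by rewrite sqrtr_gt0 ltr0n. Qed.
Let s_sqr : s ^+ 2 = L%:R. Proof. by rewrite sqr_sqrtr. Qed.

(** A weight concentrated within [L^(-1/2)] of the boundary sphere, the scale on which the kernel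
    decays. *)
Let w q : R := (1 + (s * `|ov p q - c|) ^+ 2)^-1.

Let den_gt0 (u : R) : 0 < 1 + u ^+ 2.
Proof. by rewrite (lt_le_trans (@ltr01 R))// lerDl sqr_ge0. Qed.

Let w_ge0 q : 0 <= w q.
Proof. by rewrite invr_ge0 ltW. Qed.

Let rbm_w : rbm w.
Proof.
split; last first.
  exists 1 => q; rewrite ger0_norm// invf_le1//.
  by rewrite lerDl sqr_ge0.
have -> : w = (fun q => powR (1 + (s * `|ov p q - c|) ^+ 2) (-1)).
  by apply/funext => q; rewrite powR_inv1// ltW.
apply: (measurableT_comp (measurable_powR _)).
apply: measurable_funD => //; apply: measurable_funX; apply: measurable_funM => //.
apply: measurableT_comp => //; apply: measurable_funB => //; exact: measurable_ov.
Qed.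

(* Dyadic shells of radius 2^k / s around the sphere ov p = c. *)
Lemma integral_lorentzian : \int[vol]_q w q <= 32 * d%:R / s.
Proof.
(* Overlaps lie in [[0, 1]] and [c] in [[-1, 2]], so the rescaled distance to the sphere never
   exceeds [2 s] and finitely many shells suffice. *)
have [n hn] : exists n, 2 * s < 2 ^+ n.
  exists (Num.truncn (2 * s)).+1; rewrite (lt_le_trans (truncnS_gt _))//.
  by rewrite -natrX ler_nat ltnW// ltn_expl.
pose B k := [set q | `|ov p q - c| < 2 ^+ k / s].
have mB k : measurable (B k) := measurable_shell p c _.
have rB k : rbm (fun q => 4 / 4 ^+ k * \1_(B k) q : R).
  by apply: rbmM; [exact: rbm_cst|exact: rbm_indic].
pose g q : R := \sum_(k < n.+1) 4 / 4 ^+ k * \1_(B k) q.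
have rg : rbm g by apply: rbm_sum => k _; exact: rB.
apply: (@le_trans _ _ (\int[vol]_q g q)).
  apply: le_Rintegral => //; try by apply: rbm_integrable => //; exact: prob_lty.
  move=> q _; apply: le_trans (dyadic_majorant (n := n) _ _) _.
  - by rewrite mulr_ge0// ltW.
  - apply: le_lt_trans hn; rewrite mulrC ler_pM2r// ler_norml.
    have := ov_itv p q; move: c12 => /andP[? ?] /andP[? ?].
    by apply/andP; split; lra.
  apply: ler_sum => k _; rewrite ler_wpM2l ?divr_ge0 ?exprn_ge0//.
  rewrite indicE /B; case: ltP => // h.
  by rewrite mem_set//= ltr_pdivlMr// mulrC.
have IB k : \int[vol]_q (4 / 4 ^+ k * \1_(B k) q) = 4 / 4 ^+ k * fine (vol (B k)).
  rewrite RintegralZl//; last by apply: rbm_integrable; [exact: prob_lty|exact: rbm_indic].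
  by congr (_ * fine _); rewrite integral_indic// setIT.
rewrite /g Rintegral_rbm_sum; last by move=> k; exact: rB.
under eq_bigr do rewrite IB.
(* A shell of radius [2^k / s] has volume at most [4 d 2^k / s]; with the weight [4 / 4^k] this is
   [16 d / s] times [2^(-k)], and the geometric sum contributes the last factor 2 of 32. *)
apply: (@le_trans _ _ (\sum_(k < n.+1) (16 * d%:R / s) * (2 ^+ k)^-1)).
  apply: ler_sum => k _.
  have r0 : 0 <= 2 ^+ k / s by rewrite divr_ge0 ?exprn_ge0// ltW.
  apply: le_trans (ler_wpM2l _ (vol_shell p c r0)) _.
    by rewrite divr_ge0// exprn_ge0.
  rewrite le_eqVlt; apply/orP; left; apply/eqP.
  have -> : 4 ^+ k = 2 ^+ k * 2 ^+ k :> R by rewrite -exprMn; congr (_ ^+ _); ring.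
  have : 2 ^+ k != 0 :> R by rewrite expf_neq0.
  have := lt0r_neq0 s_gt0.
  by move: s (2 ^+ k) (d%:R) => a b e a0 b0; field; rewrite a0 b0.
rewrite -mulr_sumr; apply: le_trans (ler_wpM2l _ (sum_geo_half _)) _.
  by rewrite divr_ge0 ?mulr_ge0// ltW.
by rewrite le_eqVlt; apply/orP; left; apply/eqP; ring.
Qed.

Local Notation K := (@projective_kernel R d L).
Local Notation N := ('C(d + L, d)).
Variable B : set CP.
Hypothesis mB : measurable B.
(** The level [c] lies between the overlaps of an inner and an outer point. The squares make the
    condition insensitive to the direction, so it holds for a ball and for its complement alike. *)
Hypothesis hB : forall x y, B x -> ~ B y -> (ov p x - c) ^+ 2 <= (ov p x - ov p y) ^+ 2.

Lemma affine_ind_itv q : 0 <= affine_ind q <= 1.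
Proof. by rewrite /affine_ind; case: (0 < nc _); rewrite ?lexx ler01. Qed.

(** Under the density [N * ov^(2 L)] the mean of [1 - ov^2] is [d / (L + 1 + d)], of order [1 / L].
    This pays for the factor [2 L] and leaves a constant depending on [d] only. *)
Lemma integral_weighted_kernel x :
  \int[vol]_y (N%:R ^+ 2 * ((1 + 2 * L%:R * (1 - ov x y ^+ 2)) * (ov x y ^+ 2) ^+ L)) <=
  N%:R * (1 + 2 * d%:R).
Proof.
have -> : \int[vol]_y (N%:R ^+ 2 * ((1 + 2 * L%:R * (1 - ov x y ^+ 2)) * (ov x y ^+ 2) ^+ L)) =
  \int[vol]_y (N%:R ^+ 2 * (1 + 2 * L%:R) * (ov x y ^+ 2) ^+ L -
               N%:R ^+ 2 * (2 * L%:R) * (ov x y ^+ 2) ^+ L.+1).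
  apply: eq_Rintegral => y _; rewrite (exprS (ov x y ^+ 2) L).
  by move: (ov x y ^+ 2) (N%:R) (L%:R) ((_ ^+ L)) => a b e f; ring.
have I a k : vol.-integrable setT (EFin \o (fun y => a * (ov x y ^+ 2) ^+ k)).
  by apply: rbm_integrable; [exact: prob_lty|apply: rbmM; [exact: rbm_cst|exact: rbm_ovX]].
have I1 k : vol.-integrable setT (EFin \o (fun y => (ov x y ^+ 2) ^+ k)).
  by apply: rbm_integrable; [exact: prob_lty|exact: rbm_ovX].
have Z (a : R) k : \int[vol]_y (a * (ov x y ^+ 2) ^+ k) = a * \int[vol]_y (ov x y ^+ 2) ^+ k.
  by rewrite RintegralZl.
apply: le_trans (_ : _ <= N%:R ^+ 2 * (1 + 2 * L%:R) * moment d L -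
   N%:R ^+ 2 * (2 * L%:R) * moment d L.+1) _.
  rewrite le_eqVlt; apply/orP; left; apply/eqP.
  apply: etrans (RintegralB measurableT (I _ _) (I _ _)) _; congr (_ - _).
    apply: etrans (Z _ _) _; congr (_ * _).
    by move: L0; case: (L) => // l _; exact: Rmoment_ov.
  apply: etrans (Z _ _) _; congr (_ * _).
  exact: Rmoment_ov.
have NM : N%:R * moment d L = 1 :> R := @binN_moment R d L.
rewrite momentS.
have -> : N%:R ^+ 2 * (1 + 2 * L%:R) * moment d L -
   N%:R ^+ 2 * (2 * L%:R) * (moment d L * (L.+1%:R / (L.+1 + d)%:R)) =
   N%:R * (N%:R * moment d L) * (1 + 2 * (L%:R * (1 - L.+1%:R / (L.+1 + d)%:R))) :> R.
  by move: (N%:R) (moment d L) (L%:R) (_ / _) => a b e f; ring.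
rewrite NM mulr1 ler_wpM2l// lerD2l ler_wpM2l//.
have D0 : 0 < (L.+1 + d)%:R :> R by rewrite ltr0n.
have -> : 1 - L.+1%:R / (L.+1 + d)%:R = d%:R / (L.+1 + d)%:R :> R.
  apply: (mulIf (lt0r_neq0 D0)); rewrite mulrBl mul1r !divfK ?lt0r_neq0//.
  by rewrite natrD addrC addKr.
rewrite mulrCA ler_piMr// ler_pdivrMr// mul1r ler_nat.
by rewrite addSn leqW// leq_addr.
Qed.

(* For x in B and y outside B, s |ov p x - c| <= s |ov p x - ov p y|, whose square
   is at most 2 L (1 - ov x y ^ 2): this trades the boundary constraint for the
   weight w x. *)
Lemma ball_variance :
  \int[vol]_x (\1_B x * \int[vol]_y ((1 - \1_B y) * sqc (K x y))) <=
  N%:R * (1 + 2 * d%:R) * (32 * d%:R / s).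
Proof.
have [phi [hphi Kphi]] := @kernel_fkernel R d L.
have rB := rbm_indic R mB.
have rC : rbm (fun y => 1 - \1_B y : R) by apply: rbmD; [exact: rbm_cst|exact: rbmN].
have C0 y : 0 <= 1 - \1_B y :> R by rewrite indicE subr_ge0; case: (_ \in _); rewrite ?lexx ?ler01.
have rS x : rbm (fun y => (1 - \1_B y) * sqc (K x y)).
  apply: rbmM => //; have := rbm_fkernel_sqr hphi x.
  by congr rbm; apply/funext => y; rewrite Kphi.
have rW x : rbm (fun y => N%:R ^+ 2 *
    ((1 + 2 * L%:R * (1 - ov x y ^+ 2)) * (ov x y ^+ 2) ^+ L)).
  apply: rbmM; first exact: rbm_cst.
  apply: rbmM; last exact: rbm_ovX.
  apply: rbmD; first exact: rbm_cst.
  apply: rbmM; first exact: rbm_cst.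
  apply: rbmD; first exact: rbm_cst.
  by apply: rbmN; exact: rbmX (rbm_ov x).
have inner x : B x -> \int[vol]_y ((1 - \1_B y) * sqc (K x y)) <= w x * (N%:R * (1 + 2 * d%:R)).
  move=> Bx; apply: (@le_trans _ _ (\int[vol]_y (w x * (N%:R ^+ 2 *
     ((1 + 2 * L%:R * (1 - ov x y ^+ 2)) * (ov x y ^+ 2) ^+ L))))); last first.
    rewrite RintegralZl//; last first.
      by apply: rbm_integrable; [exact: prob_lty|exact: rW].
    by rewrite ler_wpM2l// integral_weighted_kernel.
  apply: le_Rintegral => //.
  - by apply: rbm_integrable; [exact: prob_lty|exact: rS].
  - by apply: rbm_integrable; [exact: prob_lty|apply: rbmM (rW x); exact: rbm_cst].
  move=> y _; set O := ov x y ^+ 2.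
  have O0 : 0 <= O by exact: sqr_ge0.
  have O1 : O <= 1 by rewrite expr_le1 ?ov_ge0 ?ov_le1.
  have OL : 0 <= O ^+ L by exact: exprn_ge0.
  have [By|By] := pselect (B y).
    rewrite indicE mem_set// subrr mul0r mulr_ge0// mulr_ge0 ?exprn_ge0// mulr_ge0//.
    by rewrite addr_ge0// mulr_ge0 ?mulr_ge0// subr_ge0.
  rewrite indicE memNset// subr0 mul1r sqc_kernelE// -/O.
  apply: (@le_trans _ _ (N%:R ^+ 2 * O ^+ L)).
    have NO : 0 <= N%:R ^+ 2 * O ^+ L :> R by rewrite mulr_ge0// exprn_ge0.
    have /andP[a0 a1] := affine_ind_itv x; have /andP[b0 b1] := affine_ind_itv y.
    have key (u v z : R) : 0 <= u -> u <= 1 -> 0 <= v -> v <= 1 -> 0 <= z -> u * (v * z) <= z.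
      by move=> *; rewrite mulrA ler_piMl// mulr_ile1.
    exact: key.
  have key : 1 <= w x * (1 + 2 * L%:R * (1 - O)).
    rewrite /w mulrC ler_pdivlMr// mul1r lerD2l exprMn s_sqr real_normK ?num_real//.
    rewrite mulrAC [leRHS]mulrC ler_wpM2l// (le_trans (hB Bx By))//; exact: ov_lip.
  have -> : w x * (N%:R ^+ 2 * ((1 + 2 * L%:R * (1 - O)) * O ^+ L)) =
     w x * (1 + 2 * L%:R * (1 - O)) * (N%:R ^+ 2 * O ^+ L).
    by move: (w x) (N%:R ^+ 2) (_ + _) (O ^+ L) => a b e f; ring.
  by rewrite ler_peMl// mulr_ge0// exprn_ge0.
have rbB : rbm (fun x => \1_B x * \int[vol]_y ((1 - \1_B y) * sqc (K x y))).
  apply: rbmM => //.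
  (* Measurability in [x] comes from the reproducing property: the integral over the complement is
     the diagonal minus the integral over [B]. *)
  have -> : (fun x => \int[vol]_y ((1 - \1_B y) * sqc (K x y))) =
    (fun x => complex.Re (fkernel phi x x) - \int[vol]_y (\1_B y * sqc (fkernel phi x y))).
    apply/funext => x.
    transitivity (\int[vol]_y (sqc (fkernel phi x y) - \1_B y * sqc (fkernel phi x y))).
      by apply: eq_Rintegral => y _; rewrite Kphi mulrBl mul1r.
    apply: etrans (RintegralB measurableT _ _) _.
    - by apply: rbm_integrable; [exact: prob_lty|exact: rbm_fkernel_sqr].
    - by apply: rbm_integrable; [exact: prob_lty|apply: rbmM rB _; exact: rbm_fkernel_sqr].
    congr (_ - _); rewrite -Kphi kernel_diagE//= -integral_sqc_kernel//.
    by apply: eq_Rintegral => y _; rewrite Kphi.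
  apply: rbmD; first exact: rbm_fkernel_diag.
  by apply: rbmN; exact: rbm_integral_fkernel.
apply: (@le_trans _ _ (\int[vol]_x (N%:R * (1 + 2 * d%:R) * w x))).
  apply: le_Rintegral => //.
  - by apply: rbm_integrable; [exact: prob_lty|].
  - by apply: rbm_integrable; [exact: prob_lty|apply: rbmM => //; exact: rbm_cst].
  move=> x _; have N0 : 0 <= N%:R * (1 + 2 * d%:R) * w x :> R by rewrite mulr_ge0.
  have [Bx|Bx] := pselect (B x); last by rewrite indicE memNset// mul0r.
  by rewrite indicE mem_set// mul1r mulrC inner.
rewrite RintegralZl//; last by apply: rbm_integrable; [exact: prob_lty|].
by rewrite ler_wpM2l// integral_lorentzian.
Qed.

End ball_variance.

Lemma bin_le_pow (d L : nat) : (0 < L)%N -> ('C(d + L, d) <= (2 * L) ^ d)%N.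
Proof.
move=> L0; elim: d => [|d IH]; first by rewrite bin0.
rewrite -(leq_pmul2l (ltn0Sn d)) addSn.
rewrite -mul_bin_diag /= expnS mulnA leq_mul// mulSn addnC -addSn leq_add ?leq_pmulr ?muln_gt0//.
by rewrite mul2n -addnn -addn1 leq_add2l.
Qed.

(** Converts the scale L into N: from [N <= (2 L)^d] follows
    [N^(1/(2 d)) <= sqrt (2 L) <= 2 sqrt L]. *)
Lemma bin_power_le (R : realType) (d L : nat) (N := 'C(d + L, d)%:R : R) :
  (0 < d)%N -> (0 < L)%N ->
  N / Num.sqrt L%:R <= 2 * N `^ (1 - (2 * d)%:R^-1).
Proof.
move=> d0 L0; have N0 : 0 < N by rewrite ltr0n bin_gt0 leq_addr.
have s0 : 0 < Num.sqrt L%:R :> R by rewrite sqrtr_gt0 ltr0n.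
set e : R := (2 * d)%:R^-1.
have h : N `^ e <= 2 * Num.sqrt L%:R.
  apply: (@le_trans _ _ (((2 * L)%:R ^+ d) `^ e)).
    apply: ge0_ler_powR; rewrite ?nnegrE ?invr_ge0 ?exprn_ge0 ?(ltW N0)//.
    by rewrite -natrX ler_nat bin_le_pow.
  rewrite -powR_mulrn// -powRrM.
  have -> : d%:R * e = 2^-1.
    by rewrite /e natrM invfM mulrCA mulfV ?mulr1// pnatr_eq0 -lt0n.
  rewrite powR12_sqrt// natrM sqrtrM// ler_wpM2r ?sqrtr_ge0//.
  by rewrite -[leRHS]ger0_norm// -sqrtr_sqr ler_wsqrtr// expr2 ler_peMl// ler1n.
rewrite powRB ?(gt_eqF N0)// ?implybT// powRr1 ?(ltW N0)//.
have e0 : 0 < N `^ e by rewrite powR_gt0.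
by rewrite mulrCA ler_wpM2l ?(ltW N0)// ler_pdivlMr// mulrC ler_pdivrMr.
Qed.

(** * Factorial moments and exponential tails *)

Section factorial_moments.
Context dO (Omega : measurableType dO) dT (T : measurableType dT) (R : realType).
Variables (P : probability Omega R) (X : Omega -> {fset T}) (n : nat).
Hypothesis hX : simple_point_process R X n.

Lemma count_inE (x : {fset T}) (A : set T) :
  count_in x A = count (fun y => y \in A) (enum_fset x).
Proof.
rewrite -size_filter /count_in; apply: perm_size; apply: uniq_perm.
- exact: fset_uniq.
- by rewrite filter_uniq// fset_uniq.
by move=> y; rewrite mem_filter !inE andbC.
Qed.

Variable S : nat -> set T.
Hypothesis mS : forall i, measurable (S i).
Hypothesis sepS : forall x y, (forall i, S i x <-> S i y) -> x = y.

(** Membership in the first [m] sets of a countable separating family; equal codes define the atoms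
    of an increasingly fine finite partition. *)
Definition bitcode m (x : T) : {ffun 'I_m -> bool} := [ffun i : 'I_m => `[< S i x >]].

Lemma bitcode_sep (s : seq T) : exists m0, forall m, (m0 <= m)%N ->
  {in s &, injective (bitcode m)}.
Proof.
have h (z : T * T) : exists i, z.1 <> z.2 -> ~ (S i z.1 <-> S i z.2).
  have [e|ne] := pselect (z.1 = z.2); first by exists 0%N.
  apply: contrapT => /forallNP hi; apply: ne; apply: sepS => i.
  by apply: contrapT => ni; apply: (hi i).
have [f hf] := choice h.
exists (\max_(x <- s) \max_(y <- s) (f (x, y)).+1)%N => m le x y xs ys e.
apply: contrapT => xy; apply: (hf (x, y) xy) => /=.
have lt : (f (x, y) < m)%N.
  apply: leq_trans le; apply: leq_trans (leq_bigmax_seq _ xs _) => //.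
  exact: (@leq_bigmax_seq _ s (fun=> true) (fun y => (f (x, y)).+1) y ys).
have /ffunP/(_ (Ordinal lt)) := e; rewrite !ffunE /= => ab.
by split=> h'; apply/asboolP; [rewrite -ab|rewrite ab]; exact/asboolP.
Qed.

Lemma measurable_bitcode m (c : {ffun 'I_m -> bool}) : measurable [set x | bitcode m x = c].
Proof.
have -> : [set x | bitcode m x = c] =
    \bigcap_(i : 'I_m) (if c i then S i else ~` S i).
  apply/seteqP; split => x /=.
    by move=> <- i _; rewrite ffunE; case: asboolP.
  move=> h; apply/ffunP => i; rewrite ffunE; have := h i I.
  by case: (c i) => ?; [exact/asboolP|apply/asboolP].
apply: fin_bigcap_measurable => [|i _]; first exact: finite_finset.
by case: (c i); [|apply: measurableC].
Qed.

Variables (A : set T) (mA : measurable A).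

Definition cell m (c : {ffun 'I_m -> bool}) : set T := A `&` [set x | bitcode m x = c].

Lemma measurable_cell m (c : {ffun 'I_m -> bool}) : measurable (cell c).
Proof. by apply: measurableI => //; exact: measurable_bitcode. Qed.

(** Once the finitely many points of [x] have distinct codes, every cell holds at most one of them,
    and a choice of [k] distinct occupied cells is an ordered choice of [k] distinct points in
    [A]. *)
Lemma sum_cells (x : {fset T}) k : exists m0, forall m, (m0 <= m)%N ->
  (\sum_(f : {ffun 'I_k -> {ffun 'I_m -> bool}} | injectiveb f)
    \prod_i count_in x (cell (f i)) = count_in x A ^_ k)%N.
Proof.
pose s := [seq y <- enum_fset x | y \in A].
have us : uniq s by rewrite filter_uniq// fset_uniq.
have [m0 hm0] := bitcode_sep s; exists m0 => m /hm0 inj.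
pose t := [seq bitcode m y | y <- s].
have ut : uniq t by rewrite map_inj_in_uniq.
have cE c : count_in x (cell c) = (c \in t).
  rewrite count_inE -(count_uniq_mem c ut) count_map count_filter.
  apply: eq_in_count => y _ /=; rewrite /cell in_setI andbC; congr (_ && _).
  by apply/idP/eqP; rewrite inE.
pose J := [set c in t]%SET.
have cJ : #|J| = count_in x A.
  rewrite cardsE count_inE -size_filter -/s; have /card_uniqP -> := ut.
  by rewrite size_map.
rewrite -cJ -[in RHS](card_ord k) -card_inj_ffuns_on -sum1_card.
rewrite [RHS](eq_bigl (fun f => (f \in ffun_on (mem J)) && injectiveb f)); last first.
  by move=> f; rewrite !inE.
rewrite big_mkcondl/=; apply: eq_bigr => f _; case: ifPn => [/ffun_onP fJ|/ffun_onP fJ].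
  by apply: big1 => i _; rewrite cE; have := fJ i; rewrite !inE => ->.
have [i fi] : exists i, f i \notin J.
  apply/existsP; rewrite -negb_forall; apply/negP => /forallP h; exact: fJ.
by rewrite (bigD1 i)//= cE; move: fi; rewrite inE => /negbTE ->.
Qed.

Variables (k : nat) (mu : probability T R) (rho : k.-tuple T -> R).
Hypothesis hrho : joint_intensity P X mu rho.
Local Notation pw := (power_measure mu).
Local Open Scope ereal_scope.

Definition box (B : 'I_k -> set T) : set (k.-tuple T) := [set y | forall i, B i (tnth y i)].

Lemma measurable_box B : (forall i, measurable (B i)) -> measurable (box B).
Proof.
move=> mB; have -> : box B = \bigcap_(i : 'I_k) (fun y => tnth y i) @^-1` B i.
  by apply/seteqP; split => y /= h i; [move=> _; exact: h|exact: h].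
apply: fin_bigcap_measurable => [|i _]; first exact: finite_finset.
by rewrite -[X in measurable X]setTI; exact: (measurable_tnth i).
Qed.

(** Distinct cells are disjoint, so the joint intensity applies to each injective [f]. The resulting
    boxes are pairwise disjoint inside [A^k]; those with a repeated cell are missing, whence an
    inequality only. *)
Lemma expectation_cells m :
  \int[P]_w (\sum_(f : {ffun 'I_k -> {ffun 'I_m -> bool}} | injectiveb f)
     (\prod_i count_in (X w) (cell (f i)))%:R%:E)%E <=
  \int[pw k]_(y in box (fun=> A)) (rho y)%:E.
Proof.
have [mrho rho0 hrho'] := hrho.
have mE : measurable_fun setT (fun y => (rho y)%:E) by apply/measurable_EFinP.
pose F := {ffun 'I_k -> {ffun 'I_m -> bool}}.
pose s : seq F := seq.filter (fun f : F => injectiveb f) (index_enum _).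
have sE (g : F -> \bar R) : \sum_(f : F | injectiveb f) g f = \sum_(f <- s) g f.
  by rewrite big_filter.
have mB (f : F) : measurable (box (fun i => cell (f i))).
  by apply: measurable_box => i; exact: measurable_cell.
have cnt (f : F) : measurable_fun setT (fun w => (\prod_i count_in (X w) (cell (f i)))%:R%:E : \bar R).
  apply/measurable_EFinP; under eq_fun do rewrite natr_prod.
  apply: measurable_prod => i _; exact: (hX.2 _ (measurable_cell _)).
under eq_integral do rewrite sE.
rewrite ge0_integral_sum//.
have e (f : F) : f \in s -> \int[P]_w (\prod_i count_in (X w) (cell (f i)))%:R%:E =
   \int[pw k]_y ((fun y => (rho y)%:E) \_ (box (fun i => cell (f i)))) y.
  rewrite mem_filter => /andP[/injectiveP finj _].
  rewrite -integral_mkcond.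
  have := hrho' (fun i => cell (f i)); rewrite unlock => <-.
  - by apply: eq_integral => w _; rewrite natr_prod.
  - by move=> i; exact: measurable_cell.
  apply/trivIsetP => i j _ _ ij; apply/seteqP; split => y //= [[_ +] [_ +]] /=.
  by move=> yi yj; have /finj ji := etrans (esym yi) yj; rewrite ji eqxx in ij.
rewrite (eq_big_seq _ e).
rewrite -ge0_integral_sum//; last 2 first.
- move=> f; apply/measurable_restrict => //; apply: measurable_funS mE => //.
- by move=> f y _; rewrite patchE; case: ifP => // _; rewrite lee_fin.
rewrite [leRHS]integral_mkcond; apply: ge0_le_integral => //.
- by move=> y _; apply: sume_ge0 => f _; rewrite patchE; case: ifP => // _; rewrite lee_fin.
- apply: emeasurable_sum => f; apply/measurable_restrict => //; exact: measurable_funS mE.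
- have mbA : measurable (box (fun=> A)) by exact: measurable_box.
  apply/measurable_restrict => //; exact: measurable_funS mE.
move=> y _; rewrite -sE.
have [[f [finj hy]]|no] := pselect (exists f : F, injectiveb f /\ box (fun i => cell (f i)) y).
  rewrite (bigD1 f)//= big1 ?adde0.
    rewrite !patchE !mem_set// => i; by have [] := hy i.
  move=> g /andP[_ gf]; rewrite patchE memNset// => hg; move/eqP: gf; apply.
  apply/ffunP => i; have [_ /= <-] := hg i; by have [_ /= <-] := hy i.
rewrite big1; last first.
  by move=> f finj; rewrite patchE memNset// => hf; apply: no; exists f.
by rewrite patchE; case: ifP => // _; rewrite lee_fin.
Qed.

(* Joint intensities only see disjoint sets: cut A into the cells of an ever finer
   partition, apply the definition to k distinct cells, and use Fatou. *)
Lemma factorial_moment_le :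
  \int[P]_w ((count_in (X w) A) ^_ k)%:R%:E <= \int[pw k]_(y in box (fun=> A)) (rho y)%:E.
Proof.
pose g m w : \bar R := (\sum_(f : {ffun 'I_k -> {ffun 'I_m -> bool}} | injectiveb f)
     (\prod_i count_in (X w) (cell (f i)))%:R%:E)%E.
have g0 m w : 0 <= g m w by apply: sume_ge0 => f _; rewrite lee_fin.
have mg m : measurable_fun setT (g m).
  rewrite /g; under eq_fun do rewrite -big_filter.
  apply: emeasurable_sum => f; apply/measurable_EFinP; under eq_fun do rewrite natr_prod.
  apply: measurable_prod => i _; exact: (hX.2 _ (measurable_cell _)).
apply: (@le_trans _ _ (\int[P]_w limn_einf (g ^~ w))).
  rewrite le_eqVlt; apply/orP; left; apply/eqP; apply: eq_integral => w _.
  have [m0 hm0] := sum_cells (X w) k.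
  have /cvg_limn_einf_sup[-> _] // : g ^~ w @ \oo --> ((count_in (X w) A) ^_ k)%:R%:E.
  apply: cvg_near_cst; exists m0 => // m /= /hm0 <-.
  by rewrite natr_sum -sumEFin.
apply: le_trans (fatou P measurableT mg (fun m w _ => g0 m w)) _.
rewrite limn_einf_lim; apply: lime_le; first exact: is_cvg_einfs.
apply: nearW => m; apply: le_trans (_ : _ <= \int[P]_w g m w) (expectation_cells m).
by apply: ereal_inf_lbound; exists m => //=.
Qed.

End factorial_moments.

(** * The generating function and Chernoff's bound *)

Section determinantal_tail.
Context dO (Omega : measurableType dO) dT (T : measurableType dT) (R : realType).
Local Notation C := R[i].
Variables (P : probability Omega R) (X : Omega -> {fset T}) (N : nat).
Hypothesis hX : simple_point_process R X N.
Variable S : nat -> set T.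
Hypothesis mS : forall i, measurable (S i).
Hypothesis sepS : forall x y, (forall i, S i x <-> S i y) -> x = y.
Variables (mu : probability T R) (K : T -> T -> C) (r : nat) (phi : 'I_r -> T -> C).
Local Notation pw := (power_measure mu).
Hypothesis hphi : forall a, cbm (phi a).
Hypothesis Kphi : forall x y, K x y = fkernel phi x y.
Hypothesis hK : determinantal P X mu K.
Variables (A : set T) (mA : measurable A).
Variable lam : 'I_N -> R.
Hypothesis lam01 : forall a, 0 <= lam a <= 1.
Hypothesis lamdet : forall k,
  cint (pw k) (fun y : k.-tuple T => (\prod_(j < k) (\1_A (tnth y j))%:C%C) *
     \det (\matrix_(i, j) K (tnth y i) (tnth y j))) =
  (\sum_(f : {ffun 'I_k -> 'I_N} | injectiveb f) \prod_j lam (f j))%:C%C.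

Local Notation cnt w := (count_in (X w) A).

Lemma cnt_le w : (cnt w <= N)%N.
Proof. by rewrite -(hX.1 w) count_inE; exact: count_size. Qed.

Lemma measurable_cnt (g : nat -> R) : measurable_fun setT (fun w => g (cnt w)).
Proof.
pose E j := [set w | cnt w = j].
have mE j : measurable (E j).
  have -> : E j = (fun w => (cnt w)%:R : R) @^-1` [set j%:R].
    by apply/seteqP; split => w /= => [->//|/eqP]; rewrite eqr_nat => /eqP.
  by rewrite -[X in measurable X]setTI; exact: (hX.2 A mA).
have -> : (fun w => g (cnt w)) = (fun w => \sum_(j < N.+1) g j * \1_(E j) w).
  apply/funext => w; have lt : (cnt w < N.+1)%N by rewrite ltnS cnt_le.
  rewrite (bigD1 (Ordinal lt))//= indicE mem_set// mulr1 big1 ?addr0// => j jc.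
  rewrite indicE memNset ?mulr0// => h; move/eqP: jc; apply.
  by apply: val_inj; rewrite /= h.
apply: measurable_sum => j; apply: measurable_funM => //; exact: measurable_indic.
Qed.

Lemma cbm_det k : cbm (fun y : k.-tuple T => \det (\matrix_(i, j) K (tnth y i) (tnth y j))).
Proof.
rewrite /determinant; apply: cbm_sum => s _; apply: cbmM; first exact: cbm_cst.
apply: cbm_prod => i _; under eq_fun do rewrite mxE Kphi.
apply: cbm_sum => a _; apply: cbmM; first exact: (cbm_comp (measurable_tnth i) (hphi a)).
apply: cbm_conj; exact: (cbm_comp (measurable_tnth (s i)) (hphi a)).
Qed.

Lemma falling_moment_le k :
  (\int[P]_w ((cnt w) ^_ k)%:R%:E <=
   (\sum_(f : {ffun 'I_k -> 'I_N} | injectiveb f) \prod_j lam (f j))%:E)%E.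
Proof.
(* [determinantal] speaks of positive [k] only; for [k = 0] the left side is the total mass and the
   right side is 1. *)
case: k => [|k].
  have -> : \sum_(f : {ffun 'I_0 -> 'I_N} | injectiveb f) \prod_j lam (f j) = 1.
    apply: complexI; rewrite -lamdet.
    transitivity (cint (pw 0) (fun=> (1 : R)%:C%C)).
      by apply: eq_cint => y; rewrite big_ord0 det_mx00 mulr1.
    rewrite cint_real /Rintegral integral_cst// mul1e.
    by rewrite [X in fine X](_ : _ = 1%E)//; exact: power_measureT.
  under eq_integral do rewrite ffactn0.
  by rewrite integral_cst// mul1e probability_le1.
have [rho [hrho rhoE]] := hK (ltn0Sn k).
apply: le_trans (factorial_moment_le hX mS sepS mA hrho) _.
have [mrho rho0 _] := hrho.
set B := box _.
have mB : measurable B by exact: measurable_box.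
have BE y : \1_B y = \prod_(j < k.+1) \1_A (tnth y j) :> R.
  rewrite indicE; have [By|By] := pselect (B y).
    by rewrite mem_set// big1// => j _; rewrite indicE mem_set//; exact: By.
  rewrite memNset//; have [j Aj] : exists j, ~ A (tnth y j) by apply/existsNP.
  by rewrite (bigD1 j)//= indicE memNset// mul0r.
have rr : rbm (fun y => \1_B y * rho y).
  apply: rbmM; first exact: rbm_indic.
  have [h _] := cbm_det k.+1; suff -> : rho = (fun y => complex.Re (\det (\matrix_(i, j) K (tnth y i) (tnth y j)))) by [].
  by apply/funext => y; rewrite -rhoE.
have -> : \sum_(f : {ffun 'I_k.+1 -> 'I_N} | injectiveb f) \prod_j lam (f j) =
    \int[pw k.+1]_y (\1_B y * rho y).
  apply: complexI; rewrite -lamdet -cint_real; apply: eq_cint => y.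
  by rewrite -rhoE BE rmorphM rmorph_prod.
rewrite (Rint_EFin (power_measure_lty _ _) rr) [leLHS]integral_mkcond.
rewrite le_eqVlt; apply/orP; left; apply/eqP; apply: eq_integral => y _.
by rewrite patchE indicE; case: (y \in B); rewrite ?mul1r ?mul0r.
Qed.

Lemma ffact_expansion (t : R) n : (n <= N)%N ->
  (1 + t) ^+ n = \sum_(k < N.+1) t ^+ k / k`!%:R * (n ^_ k)%:R.
Proof.
move=> nN; rewrite exprDn (big_ord_widen N.+1 (fun i => (1 ^+ (n - i) * t ^+ i) *+ 'C(n, i)))//.
rewrite big_mkcond; apply: eq_bigr => k _; case: ifPn => [_|].
  rewrite expr1n mul1r -bin_ffact natrM -[RHS]mulrA [_^-1 * _]mulrCA mulVf ?mulr1 ?mulr_natr//.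
by rewrite -leqNgt => nk; rewrite ffact_small// mulr0.
Qed.

(** The falling factorial moments are bounded from above only, so they can be summed because the
    coefficients [t^k / k!] are nonnegative. *)
Lemma mgf_le (t : R) : 0 <= t ->
  (\int[P]_w ((1 + t) ^+ cnt w)%:E <= (\prod_a (1 + t * lam a))%:E)%E.
Proof.
move=> t0.
have f0 k : k`!%:R != 0 :> R by rewrite pnatr_eq0 -lt0n fact_gt0.
rewrite -(sum_falling_prod lam t f0) -sumEFin.
have c0 k : 0 <= t ^+ k / k`!%:R by rewrite divr_ge0// exprn_ge0.
have -> : (\int[P]_w ((1 + t) ^+ cnt w)%:E =
   \int[P]_w \sum_(k < N.+1) (t ^+ k / k`!%:R)%:E * ((cnt w) ^_ k)%:R%:E)%E.
  apply: eq_integral => w _; rewrite (ffact_expansion t (cnt_le w)) -sumEFin.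
  by apply: eq_bigr => k _; rewrite EFinM.
have mf k : measurable_fun setT (fun w => ((cnt w) ^_ k)%:R%:E : \bar R).
  by apply/measurable_EFinP; exact: (measurable_cnt (fun n => (n ^_ k)%:R)).
rewrite ge0_integral_sum//; last 2 first.
- by move=> k; apply: emeasurable_funM.
- by move=> k w _; rewrite mule_ge0 ?lee_fin.
apply: lee_sum => k _; rewrite ge0_integralZl//; last by rewrite lee_fin.
by rewrite [leRHS]EFinM lee_wpmul2l ?lee_fin// falling_moment_le.
Qed.

(** From [expR (- x) >= 1 - x] and [(1 - x) (1 + x + 2 x^2) = 1 + x^2 (1 - 2 x)]. *)
Lemma expR_le_quadratic (x : R) : -2^-1 <= x <= 2^-1 -> expR x <= 1 + x + 2 * x ^+ 2.
Proof.
move=> /andP[x1 x2]; have x0 : 0 < 1 - x by lra.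
have h : expR x <= (1 - x)^-1.
  by rewrite -[leLHS]invrK lef_pV2 ?posrE ?invr_gt0 ?expR_gt0// -expRN expR_ge1Dx.
apply: (le_trans h); rewrite -div1r ler_pdivrMr//; nra.
Qed.

(* After centering, the terms of first order in theta cancel. *)
Lemma bernoulli_mgf_le (l theta : R) : 0 <= l <= 1 -> 0 <= theta <= 2^-1 ->
  1 + (expR theta - 1) * l <= expR (theta * l + 2 * theta ^+ 2 * (l * (1 - l))).
Proof.
move=> /andP[l0 l1] /andP[t0 t1].
have e1 : expR (- (theta * l)) <= 1 + - (theta * l) + 2 * (- (theta * l)) ^+ 2.
  by apply: expR_le_quadratic; nra.
have e2 : expR (theta * (1 - l)) <= 1 + theta * (1 - l) + 2 * (theta * (1 - l)) ^+ 2.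
  by apply: expR_le_quadratic; nra.
have e3 := expR_ge1Dx (2 * theta ^+ 2 * (l * (1 - l))).
rewrite expRD -ler_pdivrMl ?expR_gt0// -expRN.
(* The centered variable takes the value [- l] with weight [1 - l] and [1 - l] with weight [l]. Its
   quadratic terms add up to [2 theta^2 l (1 - l)]. *)
have -> : expR (- (theta * l)) * (1 + (expR theta - 1) * l) =
    (1 - l) * expR (- (theta * l)) + l * expR (theta * (1 - l)).
  rewrite mulrBr mulr1 expRD; move: (expR theta) (expR _) => a b; ring.
apply: le_trans e3.
have : (1 - l) * expR (- (theta * l)) <= (1 - l) * (1 + - (theta * l) + 2 * (- (theta * l)) ^+ 2).
  by rewrite ler_wpM2l// subr_ge0.
have : l * expR (theta * (1 - l)) <= l * (1 + theta * (1 - l) + 2 * (theta * (1 - l)) ^+ 2).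
  by rewrite ler_wpM2l.
move: (expR _) (expR _) => a b; nra.
Qed.

(** Markov's inequality for [(1 + t)^cnt] with [1 + t = expR theta]; the range of [theta] is the one
    in which the quadratic bound on the exponential is available. *)
Lemma upper_tail (theta s : R) : 0 <= theta <= 2^-1 ->
  (P [set w : Omega | (\sum_a lam a + s <= (cnt w)%:R)%R] <=
   (expR (- (theta * s) + 2 * theta ^+ 2 * \sum_a (lam a * (1 - lam a))))%:E)%E.
Proof.
move=> theta01; have /andP[th0 th1] := theta01.
set E := [set w | _]; set a := \sum_a lam a + s.
have mE : measurable E.
  rewrite [E](_ : _ = (fun w => (cnt w)%:R : R) @^-1` `[a, +oo[).
    by rewrite -[X in measurable X]setTI; exact: (hX.2 A mA).
  by apply/seteqP; split => w /=; rewrite in_itv/= andbT.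
have t0 : 0 <= expR theta - 1 by rewrite subr_ge0 -expR0 ler_expR.
have h1 : (P E * (expR (theta * a))%:E <= (\prod_a (1 + (expR theta - 1) * lam a))%:E)%E.
  apply: le_trans (mgf_le t0).
  have -> : (P E * (expR (theta * a))%:E = \int[P]_w (expR (theta * a) * \1_E w)%:E)%E.
    under eq_integral do rewrite EFinM.
    apply: etrans _ (mule_integral P _ _ _); last first.
    - by rewrite lee_fin expR_ge0.
    - by move=> w; rewrite lee_fin.
    - by apply/measurable_EFinP; exact: measurable_indic.
    by rewrite integral_indic// setIT muleC.
  apply: ge0_le_integral => //.
  - by apply/measurable_EFinP; apply: measurable_funM => //; exact: measurable_indic.
  - by apply/measurable_EFinP; exact: (measurable_cnt (fun n => (1 + (expR theta - 1)) ^+ n)).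
  move=> w _; rewrite lee_fin addrCA subrr addr0 -expRM_natl indicE.
  have [Ew|Ew] := pselect (E w); last by rewrite memNset// mulr0 expR_ge0.
  by rewrite mem_set// mulr1 ler_expR mulrC ler_wpM2r.
have h2 : \prod_a (1 + (expR theta - 1) * lam a) <=
    expR (theta * \sum_a lam a + 2 * theta ^+ 2 * \sum_a lam a * (1 - lam a)).
  rewrite 2!mulr_sumr -big_split/= expR_sum; apply: ler_prod => b _.
  rewrite bernoulli_mgf_le// andbT.
  by have /andP[l0 _] := lam01 b; rewrite addr_ge0// mulr_ge0.
rewrite -(@lee_pmul2r _ (expR (theta * a))%:E) ?lte_fin ?expR_gt0//.
apply: (le_trans h1); rewrite -EFinM lee_fin -expRD; apply: (le_trans h2).
rewrite ler_expR /a le_eqVlt; apply/orP; left; apply/eqP.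
by move: (\sum_a lam a) (\sum_a lam a * _) => u v; ring.
Qed.

End determinantal_tail.

(** * Nets of balls *)

Section nets.
Context {R : realType} (d : nat).
Local Notation CP := (CP R d).
Local Notation C := R[i].
Local Notation vol := (vol R d).
Implicit Types (p q x y : CP) (v w : 'rV[C]_d.+1).
Local Notation grid m := {ffun 'I_d.+1 -> 'I_(2 * m).+1 * 'I_(2 * m).+1}.

Lemma ov_gt_clamp p (c : R) : exists2 c' : R, -1 <= c' <= 1 &
  forall q, (c < ov p q) = (c' < ov p q).
Proof.
exists (Num.max (-1) (Num.min c 1)).
  by rewrite le_max lexx/= ge_max ge_min lexx orbT andbT (le_trans (lerN10 _) ler01).
move=> q; have /andP[v0 v1] := ov_itv p q.
by rewrite gt_max (lt_le_trans (ltrN10 _) v0) gt_min [1 < _]ltNge v1 orbF.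
Qed.

Lemma metric_ball_gt p (c : R) : metric_balls [set q | c < ov p q].
Proof.
have [c' c'1 co] := ov_gt_clamp p c.
have -> : [set q | c < ov p q] = [set q | c' < ov p q].
  by apply/seteqP; split => q /=; rewrite co.
exists p, (acos c'); left; apply/seteqP; split => q /=; rewrite /FSdist -/(ov p q).
  move=> cq; rewrite -ltr_cos ?in_itv/= ?acos_ge0 ?acos_lepi ?ov_itvN//.
  by rewrite !acosK ?in_itv/= ?ov_itvN.
rewrite -ltr_cos ?in_itv/= ?acos_ge0 ?acos_lepi ?ov_itvN//.
by rewrite !acosK ?in_itv/= ?ov_itvN.
Qed.

Lemma ov_refl p : ov p p = 1.
Proof.
rewrite ovE /hv dot_nsq nsq_uvec.
by rewrite /nc normr1.
Qed.

(** The equality case of Cauchy-Schwarz makes the two unit vectors span the same line. *)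
Lemma ov_eq1 p q : ov p q = 1 -> p = q.
Proof.
move=> h.
have u0 x : uvec x != 0.
  apply/eqP => ux; have := nsq_uvec x; rewrite ux /nsq big1.
    by move/eqP; rewrite eq_sym oner_eq0.
  by move=> j _; rewrite mxE /sqc /= expr0n addr0.
have e x : val x = <[uvec x]>%VS.
  apply/eqP; rewrite eq_sym eqEdim (eqP (valP x)) dim_vline u0 andbT -memvE.
  by rewrite uvecE memvZ// memv_pick.
have [_ eqv] := CauchySchwarz (@dotmx C d.+1) (uvec p) (uvec q).
have E (u v : 'rV[C]_d.+1) : (`|dotmx u v| ^+ 2 == dotmx u u * dotmx v v) = (sqc (dotmx u v) == nsq u * nsq v).
  by rewrite sqc_norm !dot_nsq -rmorphM (inj_eq (@complexI R)).
have := etrans (esym (E _ _)) eqv.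
rewrite !nsq_uvec mulr1 -hv_sqr -ovE h expr1n eqxx => /esym.
rewrite free_cons seq1_free u0 andbT negbK span_seq1 => pq.
have H : <[uvec p]>%VS = <[uvec q]>%VS.
  have line_eq (u v : 'rV[C]_d.+1) : u != 0 -> v != 0 -> u \in <[v]>%VS -> <[u]>%VS = <[v]>%VS.
    by move=> nu nv uv; apply/eqP; rewrite eqEdim !dim_vline nu nv andbT -memvE.
  exact: line_eq (u0 p) (u0 q) pq.
exact: (val_inj (etrans (e p) (etrans H (esym (e q))))).
Qed.

Definition grid_vec (m : nat) (f : grid m) : 'rV[C]_d.+1 :=
  \row_j Complex (((f j).1%:R - m%:R) / m%:R) (((f j).2%:R - m%:R) / m%:R).

(** Rounding all [2 (d + 1)] real coordinates to multiples of [1 / m] moves a unit vector by at most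
    [sqrt (2 (d + 1)) / m], hence by at most [net_width / m]. *)
Definition net_width : nat := 2 * d.+1.
Local Notation E := net_width.

(** Levels in steps of [1 / m]. The offset [m + E + 1] lets index [k] equal to the integer part of
    [(c + 1) m] fall strictly below [c - E / m]. *)
Definition threshold (m k : nat) : R := (k%:R - (m + E.+1)%:R) / m%:R.

Lemma grid1 m (x : R) : (0 < m)%N -> -1 <= x <= 1 ->
  exists k : 'I_(2 * m).+1, (x - (k%:R - m%:R) / m%:R) ^+ 2 <= m%:R^-1 ^+ 2.
Proof.
move=> m0 /andP[x1 x2]; have m0' : 0 < m%:R :> R by rewrite ltr0n.
pose y := (x + 1) * m%:R.
have y0 : 0 <= y by rewrite mulr_ge0 ?(ltW m0')//; lra.
have lt : (Num.truncn y < (2 * m).+1)%N.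
  have /andP[ty _] := truncn_itv y0.
  rewrite ltnS -(ler_nat R) (le_trans ty)// natrM /y ler_wpM2r ?(ltW m0')//; lra.
exists (Ordinal lt) => /=.
have /andP[] := truncn_itv y0; rewrite -natr1.
move: (Num.truncn y)%:R => k k2 k1.
have -> : x - (k - m%:R) / m%:R = (y - k) / m%:R by rewrite /y; field; rewrite gt_eqF.
rewrite exprMn ler_piMl ?sqr_ge0// expr_le1//; lra.
Qed.

Lemma grid_approx m p : (0 < m)%N -> exists f : grid m,
  forall q, `|ov p q - hv (grid_vec f) q| <= E%:R / m%:R.
Proof.
move=> m0; have m0' : 0 < m%:R :> R by rewrite ltr0n.
have coord j : sqc (uvec p 0 j) <= 1.
  rewrite -(nsq_uvec p) /nsq (bigD1 j)//= lerDl sumr_ge0// => i _; exact: sqc_ge0.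
have itv (a b : R) : a ^+ 2 + b ^+ 2 <= 1 -> -1 <= a <= 1 by move=> h; apply/andP; split; nra.
have ex j : exists k : 'I_(2 * m).+1 * 'I_(2 * m).+1,
   sqc (uvec p 0 j - Complex ((k.1%:R - m%:R) / m%:R) ((k.2%:R - m%:R) / m%:R)) <= 2 * m%:R^-1 ^+ 2.
  have := coord j; case: (uvec p 0 j) => a b; rewrite /sqc/= => ab.
  have [k1 h1] := grid1 m0 (itv a b ab).
  have [k2 h2] := grid1 m0 (itv b a (etrans (congr1 (fun t => t <= 1) (addrC _ _)) ab)).
  by exists (k1, k2) => /=; lra.
have [f hf] := choice ex; exists (finfun f) => q.
apply: le_trans (le_trans (hv_lip (uvec p) _ q) _).
  by rewrite ovE.
have -> : E%:R / m%:R = Num.sqrt ((E%:R / m%:R) ^+ 2) :> R.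
  by rewrite sqrtr_sqr ger0_norm// divr_ge0.
apply: ler_wsqrtr; apply: (@le_trans _ _ (\sum_(j < d.+1) 2 * m%:R^-1 ^+ 2)).
  by apply: ler_sum => j _; rewrite rowB [grid_vec _ 0 j]mxE ffunE; exact: hf.
rewrite sumr_const card_ord exprMn -mulrnAl ler_wpM2r ?sqr_ge0//.
rewrite /net_width natrM -mulr_natr.
have : 1 <= d.+1%:R :> R by rewrite ler1n.
by move: (d.+1%:R) => t t1; nra.
Qed.

Definition net_set m (f : grid m) (k : nat) : set CP :=
  [set q | threshold m k < hv (grid_vec f) q].

(** The norm of a grid vector rescales the level. A zero grid vector gives the whole space or the
    empty set, realized by the levels -1 and 1 about any point. *)
Lemma net_set_ov m (f : grid m) k :
  exists p c, net_set f k = [set q | c < ov p q].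
Proof.
have [g0|g0] := eqVneq (grid_vec f) 0.
  have hv0 q : hv (grid_vec f) q = 0.
    by rewrite g0; apply/eqP; rewrite nc_eq0 dotE big1// => j _; rewrite mxE mul0r.
  have [t0|t0] := ltP (threshold m k) 0.
    exists point, (-1); apply/seteqP; split => q /=; rewrite /net_set /= hv0// => _.
    by rewrite (lt_le_trans (ltrN10 _))// ov_ge0.
  exists point, 1; apply/seteqP; split => q /=; rewrite /net_set /= hv0; first by rewrite ltNge t0.
  by rewrite ltNge ov_le1.
have [p hp] := hv_line g0; have s0 : 0 < Num.sqrt (nsq (grid_vec f)) by rewrite sqrtr_gt0 nsq_gt0.
exists p, (threshold m k / Num.sqrt (nsq (grid_vec f))).
have e q : (threshold m k < hv (grid_vec f) q) = (threshold m k / Num.sqrt (nsq (grid_vec f)) < ov p q).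
  by rewrite hp (ltr_pdivrMr _ _ s0) mulrC.
by apply/seteqP; split => q; rewrite /net_set /= e.
Qed.

Lemma measurable_net_set m (f : grid m) k :
  measurable (net_set f k).
Proof. by have [p [c ->]] := net_set_ov f k; exact: measurable_ov_gt. Qed.

Hypothesis d0 : (0 < d)%N.

Lemma net_sandwich m (A : set CP) : (0 < m)%N -> metric_balls A ->
  exists f : grid m,
  exists k1 k2 : 'I_(3 * m + 2 * E + 4),
  [/\ net_set f k1 `<=` A, A `<=` net_set f k2 &
      (vol (net_set f k2) <= vol (net_set f k1) + ((2 * d * (4 * E + 2))%:R / m%:R)%:E)%E].
Proof.
move=> m0 /metric_ball_ov[p [c [/andP[c1 c2] AE]]].
have m0' : 0 < m%:R :> R by rewrite ltr0n.
have [f hf] := grid_approx p m0.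
pose y := (c + 1) * m%:R.
have y0 : 0 <= y by rewrite mulr_ge0 ?(ltW m0')//; lra.
pose i := Num.truncn y.
have i3 : (i <= 3 * m)%N.
  have /andP[ty _] := truncn_itv y0.
  rewrite -(ler_nat R) (le_trans ty)// natrM /y ler_wpM2r ?(ltW m0')//; lra.
have lt2 : (i < 3 * m + 2 * E + 4)%N.
  by rewrite -addnA (leq_ltn_trans i3)// -[X in (X < _)%N]addn0 ltn_add2l addn_gt0 orbT.
have lt1 : (i + 2 * E + 2 < 3 * m + 2 * E + 4)%N.
  by rewrite -addnA -[X in (_ < X)%N]addnA (leq_ltn_trans (leq_add i3 (leqnn _)))// ltn_add2l ltn_add2l.
(* The index [i] has its level just below [c - E / m], the index [i + 2 E + 2] just above
   [c + E / m], where [E / m] is the error of [grid_approx]. Replacing the grid vector by [p] costs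
   [E / m] on each side, so the layer has width [(4 E + 2) / m]. *)
exists f, (Ordinal lt1), (Ordinal lt2).
set e := E%:R / m%:R in hf.
have t2 : threshold m i < c - e.
  rewrite /threshold /e ltr_pdivrMr// mulrBl divfK ?gt_eqF//.
  have /andP[+ _] := truncn_itv y0; rewrite -/i /y natrD -natr1; lra.
have t1 : c + e < threshold m (i + 2 * E + 2).
  rewrite /threshold /e ltr_pdivlMr// mulrDl divfK ?gt_eqF//.
  have := truncnS_gt y; rewrite -/i /y -natr1 !natrD natrM -natr1; lra.
have t12 : threshold m (i + 2 * E + 2) + e - (threshold m i - e) = (4 * E + 2)%:R / m%:R.
  rewrite /threshold /e !natrD !natrM; field; rewrite gt_eqF//.
have dist (a b : R) : `|a - b| <= e -> b - e <= a /\ a <= b + e.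
  by rewrite ler_norml => /andP[? ?]; split; lra.
have d1 q : hv (grid_vec f) q - e <= ov p q by have [] := dist _ _ (hf q).
have d2 q : ov p q <= hv (grid_vec f) q + e by have [] := dist _ _ (hf q).
split.
- move=> q h.
  have : c < ov p q.
    by apply: lt_le_trans (d1 q); rewrite ltrBrDr; exact: lt_trans t1 h.
  by move=> cq; case: AE => ->; [exact: cq|exact: ltW cq].
- move=> q Aq; apply: lt_le_trans t2 _; rewrite lerBlDr.
  have : c <= ov p q by case: AE Aq => -> => [/ltW|].
  by move=> h; exact: le_trans h (d2 q).
apply: (@le_trans _ _ (vol [set q | threshold m i - e < ov p q])).
  apply: le_measure; rewrite ?inE; [exact: measurable_net_set|exact: measurable_ov_gt|].
  by move=> q /= h; apply: lt_le_trans (d1 q); rewrite ltrD2r; exact: h.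
have le : threshold m i - e <= threshold m (i + 2 * E + 2) + e.
  have e0 : 0 <= e by rewrite divr_ge0.
  lra.
apply: le_trans (vol_layer d0 p le) _; rewrite t12.
apply: leeD; last first.
  by rewrite lee_fin !natrM mulrA.
apply: le_measure; rewrite ?inE; [exact: measurable_ov_gt|exact: measurable_net_set|].
by move=> q /= h; rewrite /net_set /= -(ltrD2r e); exact: lt_le_trans h (d2 q).
Qed.

End nets.

(** * A countable family of balls separating points *)

Section separation.
Context {R : realType} (d : nat).
Local Notation CP := (CP R d).
Implicit Types (p q x y : CP).
Local Notation E := (net_width d).
Local Notation grid m := {ffun 'I_d.+1 -> 'I_(2 * m).+1 * 'I_(2 * m).+1}.

Definition net_index := {m : nat & (grid m * nat)%type}.

(** Enumerates the net sets of all meshes; numbers that encode nothing give the empty set. This is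
    the separating family behind the cells of the factorial moment bound. *)
Definition net_family (n : nat) : set CP :=
  if choice.unpickle n is Some i then net_set (tagged (i : net_index)).1 (tagged i).2 else set0.

Lemma measurable_net_family n : measurable (net_family n).
Proof.
by rewrite /net_family; case: choice.unpickle => [i|//]; exact: measurable_net_set.
Qed.

Lemma squeeze_lt (a b c t e e' : R) : `|1 - a| <= e -> `|c - b| <= e ->
  2 * e + e' < 1 - c -> t <= b + e' -> t < a.
Proof. by rewrite !ler_norml => /andP[? ?] /andP[? ?] ? ?; lra. Qed.

Lemma net_family_sep x y : (forall n, net_family n x <-> net_family n y) -> x = y.
Proof.
move=> h; apply: ov_eq1; apply/eqP; rewrite eq_le ov_le1/= leNgt; apply/negP => lt1.
pose D := 1 - ov x y; have D0 : 0 < D by rewrite subr_gt0.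
(* The mesh is fine enough for two rounding errors and one level step to fit into the gap
   [1 - ov x y]. *)
pose m := (Num.truncn ((2 * E + 1)%:R / D)).+1.
have m0 : 0 < m%:R :> R by rewrite ltr0n.
have hm : (2 * E + 1)%:R / m%:R < D.
  by rewrite ltr_pdivrMr// mulrC -ltr_pdivrMr// truncnS_gt.
have [f hf] := grid_approx x (ltn0Sn _ : (0 < m)%N).
have hx := hf x; have hy := hf y; rewrite ov_refl in hx.
pose z := hv (grid_vec f) y * m%:R + (m + E.+1)%:R.
have z0 : 0 <= z by rewrite addr_ge0 ?mulr_ge0 ?hv_ge0// ltW.
pose k := (Num.truncn z).+1.
have /andP[z1 z2] := truncn_itv z0.
have t1 : hv (grid_vec f) y < @threshold R d m k.
  by rewrite /threshold ltr_pdivlMr// ltrBrDr.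
have t2 : @threshold R d m k < hv (grid_vec f) x.
  have : @threshold R d m k <= hv (grid_vec f) y + m%:R^-1.
    rewrite /threshold ler_pdivrMr// lerBlDr mulrDl mulVf ?gt_eqF// addrAC.
    by rewrite -/z /k -natr1 lerD2r.
  apply: squeeze_lt hx hy _.
  have e (a : nat) (b : R) : 2 * (a%:R / b) + b^-1 = (2 * a + 1)%:R / b.
    by rewrite natrD natrM; ring.
  by rewrite e.
have [hxy _] := h (choice.pickle (existT _ m (f, k) : net_index)).
move: hxy; rewrite /net_family choice.pickleK /= => /(_ t2).
by rewrite /net_set /= ltNge (ltW t1).
Qed.

End separation.

(** * Two-sided tails for a single ball *)

Section deviation.
Context {R : realType} (d L : nat) (d0 : (0 < d)%N) (L0 : (0 < L)%N).
Context dO (Omega : measurableType dO).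
Variables (P : probability Omega R) (X : Omega -> {fset CP R d}).
Hypothesis hX : projective_ensemble L P X.
Local Notation vol := (vol R d).
Local Notation N := ('C(d + L, d)).

Definition variance_bound : R := N%:R * (1 + 2 * d%:R) * (32 * d%:R / Num.sqrt L%:R).

Lemma set_tail (B : set (CP R d)) p (c theta s : R) :
  measurable B -> -1 <= c <= 2 ->
  (forall x y, B x -> ~ B y -> (ov p x - c) ^+ 2 <= (ov p x - ov p y) ^+ 2) ->
  0 <= theta <= 2^-1 ->
  (P [set w | (N%:R * fine (vol B) + s <= (count_in (X w) B)%:R)%R] <=
   (expR (- (theta * s) + 2 * theta ^+ 2 * variance_bound))%:E)%E.
Proof.
move=> mB c12 hB th; have [hX1 hX2] := hX.
have [phi [hphi Kphi]] := @kernel_fkernel R d L.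
have [lam [l01 ldet lsum lvar]] := kernel_spectrum d0 L0 mB.
have := upper_tail hX1 (@measurable_net_family R d) (@net_family_sep R d) hphi Kphi hX2 mB l01 ldet s th.
rewrite lsum => h; apply: (le_trans h).
rewrite lee_fin ler_expR lerD2l ler_wpM2l//.
  by rewrite mulr_ge0// sqr_ge0.
have e := ball_variance d0 L0 c12 mB hB.
by move: e; rewrite -lvar; exact.
Qed.

Lemma count_inC (x : {fset CP R d}) (A : set (CP R d)) :
  (count_in x A + count_in x (~` A) = #|` x|)%N.
Proof.
rewrite !count_inE -[RHS](count_predC (fun y => y \in A) (enum_fset x)); congr addn.
by apply: eq_count => y /=; rewrite in_setC.
Qed.

Lemma deviation_tail p (c theta s : R) (B := [set q | c < ov p q]) :
  0 <= theta <= 2^-1 ->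
  (P [set w | (s < `|(count_in (X w) B)%:R - N%:R * fine (vol B)|)%R] <=
   (2 * expR (- (theta * s) + 2 * theta ^+ 2 * variance_bound))%:E)%E.
Proof.
move=> th; have [hX1 hX2] := hX.
have mB : measurable B := measurable_ov_gt p c.
have [c' /andP[c1 c2] hc'] := ov_gt_clamp p c.
have c12 : -1 <= c' <= 2 by rewrite c1 (le_trans c2)// ler1n.
have sq (a b : R) : 0 <= a -> a <= b -> a ^+ 2 <= b ^+ 2 by move=> a0 ab; rewrite lerXn2r ?nnegrE// (le_trans a0).
have BE q : B q = (c' < ov p q) :> Prop by rewrite /B /= hc'.
have up := @set_tail B p c' theta s mB c12 _ th.
have lo := @set_tail (~` B) p c' theta s (measurableC mB) c12 _ th.
have volC : fine (vol (~` B)) = 1 - fine (vol B).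
  rewrite probability_setC// fineB//; last exact: fin_num_measure.
set U := [set w | _] in up; set D := [set w | _] in lo.
have mcnt (A : set (CP R d)) (a : R) : measurable A -> measurable [set w | (a <= (count_in (X w) A)%:R)%R].
  move=> mA; rewrite [X in measurable X](_ : _ = (fun w => (count_in (X w) A)%:R : R) @^-1` `[a, +oo[).
    by rewrite -[X in measurable X]setTI; exact: (hX1.2 A mA).
  by apply/seteqP; split => w /=; rewrite in_itv/= andbT.
have mU : measurable U by exact: mcnt.
have mD : measurable D by apply: mcnt; exact: measurableC.
have mdev : measurable [set w | (s < `|(count_in (X w) B)%:R - N%:R * fine (vol B)|)%R].
  rewrite [X in measurable X](_ : _ = (fun w => `|(count_in (X w) B)%:R - N%:R * fine (vol B)| : R) @^-1` `]s, +oo[).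
    rewrite -[X in measurable X]setTI.
    exact: (measurable_cnt hX1 mB (fun n => `|n%:R - N%:R * fine (vol B)|)).
  by apply/seteqP; split => w /=; rewrite in_itv/= andbT.
apply: (@le_trans _ _ (P (U `|` D))).
  apply: le_measure; rewrite ?inE//; first exact: measurableU.
  move=> w /=; rewrite ltNge ler_norml negb_and -!ltNge => /orP[h|h]; last first.
    by left; rewrite /U /= -lerBrDl ltW.
  right; rewrite /D /= volC.
  have : (count_in (X w) B)%:R + (count_in (X w) (~` B))%:R = N%:R :> R.
    by rewrite -natrD count_inC hX1.1.
  by move: (count_in _ _)%:R (count_in _ _)%:R h => a b h; lra.
apply: le_trans (measureU2 _ mU mD) _.
rewrite mulr_natl mulr2n EFinD leeD//.
- apply: up => x y; rewrite !BE => hx /negP; rewrite -leNgt => hy.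
  by apply: sq; [rewrite subr_ge0 ltW|rewrite lerD2l lerN2].
- apply: lo => x y /=; rewrite !BE => /negP; rewrite -leNgt => hx /contrapT hy.
  (* For the complement the order of the overlaps around [c'] is reversed; changing the sign under
     both squares restores it. *)
  rewrite -[X in X <= _]sqrrN -[X in _ <= X]sqrrN !opprB.
  by apply: sq; [rewrite subr_ge0|rewrite lerD2r ltW].
Qed.

End deviation.

(** * From nets to the discrepancy *)

Section discrepancy_event.
Context {R : realType} (d : nat) (d0 : (0 < d)%N).
Local Notation CP := (CP R d).
Local Notation vol := (vol R d).
Local Notation E := (net_width d).
Implicit Types (x : {fset CP}) (A B : set CP).
Local Notation grid m := {ffun 'I_d.+1 -> 'I_(2 * m).+1 * 'I_(2 * m).+1}.

Definition net_slack : R := (2 * d * (4 * E + 2))%:R.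

Definition count_dev x A : R := `|(count_in x A)%:R - (#|` x|)%:R * fine (vol A)|.

Lemma count_in_sub x A B : A `<=` B -> (count_in x A <= count_in x B)%N.
Proof. by move=> AB; rewrite !count_inE; apply: sub_count => y; rewrite !inE; exact: AB. Qed.

Lemma fin_vol A : measurable A -> vol A = (fine (vol A))%:E.
Proof. by move=> mA; rewrite fineK//; exact: fin_num_measure. Qed.

Lemma discrepancy_leP x (s : R) :
  (discrepancy x <= s%:E)%E <-> forall A, metric_balls A -> count_dev x A <= s.
Proof.
have devE A : metric_balls A ->
    `|(count_in x A)%:R%:E - (#|` x|)%:R%:E * vol A|%E = (count_dev x A)%:E.
  by move=> mA; rewrite (fin_vol (measurable_metric_ball mA)) -EFinM -EFinB.
split=> h.
  move=> A mA; rewrite -lee_fin -devE//; apply: le_trans h.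
  by apply: ereal_sup_ubound; exists A.
by apply: ge_ereal_sup => _ [A mA <-]; rewrite devE// lee_fin h.
Qed.

Lemma sandwich_dev (a a1 a2 v v1 v2 n s e : R) : 0 <= n ->
  a1 <= a -> a <= a2 -> v1 <= v -> v <= v2 -> v2 <= v1 + e ->
  `|a1 - n * v1| <= s -> `|a2 - n * v2| <= s -> `|a - n * v| <= s + n * e.
Proof. by move=> n0 ? ? ? ? ?; rewrite !ler_norml => /andP[? ?] /andP[? ?]; apply/andP; split; nra. Qed.

Lemma net_dev x m (s : R) : (0 < m)%N ->
  (forall (f : grid m) (k : 'I_(3 * m + 2 * E + 4)),
     count_dev x (net_set f k) <= s) ->
  forall A, metric_balls A -> count_dev x A <= s + (#|` x|)%:R * (net_slack / m%:R).
Proof.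
move=> m0 h A mA; have [f [k1 [k2 [s1 s2 le]]]] := net_sandwich d0 m0 mA.
have mA' := measurable_metric_ball mA.
have m1 : measurable (net_set f k1 : set CP) := measurable_net_set f k1.
have m2 : measurable (net_set f k2 : set CP) := measurable_net_set f k2.
apply: (@sandwich_dev _ _ _ _ _ _ _ _ _ _ _ _ _ _ _ (h f k1) (h f k2)) => //.
- by rewrite ler_nat; exact: count_in_sub.
- by rewrite ler_nat; exact: count_in_sub.
- by apply: fine_le; rewrite ?fin_num_measure//; apply: le_measure; rewrite ?inE.
- by apply: fine_le; rewrite ?fin_num_measure//; apply: le_measure; rewrite ?inE.
by move: le; rewrite (fin_vol m1) (fin_vol m2) -EFinD lee_fin.
Qed.

Context dO (Omega : measurableType dO) (X : Omega -> {fset CP}) (N : nat).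
Hypothesis hX : simple_point_process R X N.

Definition good_event (s : R) m
    (i : grid m * 'I_(3 * m + 2 * E + 4)) : set Omega :=
  [set w | count_dev (X w) (net_set i.1 i.2) <= s].

Lemma measurable_good_event s m i : measurable (@good_event s m i).
Proof.
have -> : good_event s i = (fun w => `|(count_in (X w) (net_set i.1 i.2))%:R -
    N%:R * fine (vol (net_set i.1 i.2))| : R) @^-1` `]-oo, s].
  by apply/seteqP; split => w /=; rewrite /good_event /count_dev /= (hX.1 w) in_itv.
rewrite -[X in measurable X]setTI.
exact: (measurable_cnt hX (measurable_net_set i.1 i.2) (fun n => `|n%:R - N%:R * fine (vol (net_set i.1 i.2))|)).
Qed.

(* Measurability of the discrepancy event: the supremum over all balls is a
   supremum over the countable family of all nets. *)
Lemma discrepancy_eventE (s : R) : [set w | (discrepancy (X w) <= s%:E)%E] =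
  \bigcap_m \bigcap_i good_event s (i : grid m.+1 * 'I_(3 * m.+1 + 2 * E + 4)).
Proof.
apply/seteqP; split => w /=.
  move=> /discrepancy_leP h m _ [f k] _; rewrite /good_event /=.
  have [p [c e]] : exists (p : CP) c, net_set f k = [set q | c < ov p q] := net_set_ov f k.
  by apply: h; rewrite e; exact: metric_ball_gt.
move=> h; apply/discrepancy_leP => A mA; apply/ler_addgt0Pr => e e0.
(* With this mesh the error [N * net_slack / m.+1] of the net is at most [e]. *)
pose m := Num.truncn (N%:R * net_slack / e).
apply: le_trans (@net_dev (X w) m.+1 s isT _ A mA) _.
  by move=> f k; exact: (h m I (f, k) I).
rewrite lerD2l (hX.1 w) mulrA ler_pdivrMr// [e * _]mulrC -ler_pdivrMr//.
by rewrite ltW// truncnS_gt.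
Qed.

Lemma measurable_discrepancy_event (s : R) :
  measurable [set w | (discrepancy (X w) <= s%:E)%E].
Proof.
rewrite discrepancy_eventE; apply: bigcapT_measurable => m.
apply: fin_bigcap_measurable => [|i _]; first exact: finite_finset.
exact: measurable_good_event.
Qed.

End discrepancy_event.

Lemma probability_forall_ge dO (Omega : measurableType dO) (R : realType)
    (P : probability Omega R) (I : finType) (F : I -> set Omega) (tau : R) :
  (forall i, measurable (F i)) -> (forall i, (P (~` F i) <= tau%:E)%E) ->
  ((1 - #|I|%:R * tau)%:E <= P (\bigcap_i F i))%E.
Proof.
move=> mF hF.
have mB : measurable (\bigcap_i F i).
  by apply: fin_bigcap_measurable => [|i _]; [exact: finite_finset|exact: mF].
suff h : (P (~` \bigcap_i F i) <= (#|I|%:R * tau)%:E)%E.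
  have := probability_setC P mB; move: h.
  have : P (\bigcap_i F i) \is a fin_num by exact: fin_num_measure.
  move: (P (\bigcap_i F i)) (P (~` _)) => [a| |]// [b| |]//= _.
  by rewrite -EFinB !lee_fin => h [e]; lra.
have U (s : seq I) : measurable (\big[setU/set0]_(i <- s) ~` F i) /\
    (P (\big[setU/set0]_(i <- s) ~` F i) <= ((size s)%:R * tau)%:E)%E.
  elim: s => [|i s [ms IH]]; first by rewrite big_nil measure0 mul0r; split.
  rewrite big_cons; split; first by apply: measurableU => //; exact: measurableC.
  apply: le_trans (measureU2 _ (measurableC (mF i)) ms) _.
  by rewrite /= -natr1 mulrDl mul1r EFinD addeC leeD.
have [_ h] := U (enum I); rewrite -cardE in h; apply: le_trans h.
rewrite le_eqVlt; apply/orP; left; apply/eqP; congr (P _).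
rewrite setC_bigcap -bigcup_seq; apply: eq_bigcupl; split => i //= _.
by rewrite mem_enum.
Qed.

Lemma bin_gt1 d L : (0 < d)%N -> (0 < L)%N -> (1 < 'C(d + L, d))%N.
Proof.
case: d => // d' _ L0; rewrite addSn binS -[2%N]/(1 + 1)%N leq_add// bin_gt0 ?leq_addr//.
by rewrite -addn1 leq_add2l.
Qed.

Section union_bound_constants.
Context {R : realType}.
Local Notation E := net_width.

(** With mesh N, each complex coordinate of a grid vector has at most [N^6] values and there are at
    most [N^(2 E + 7)] levels; the last unit of the exponent pays for the factor 2 of the two
    tails. *)
Definition net_exponent (d : nat) : nat := 6 * d.+1 + (2 * E d + 8).

Lemma pow2_ge (n : nat) : (n <= 2 ^ n)%N.
Proof. by rewrite ltnW// ltn_expl. Qed.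

Lemma leq_add_mul (a b : nat) : (1 < a)%N -> (1 < b)%N -> (a + b <= a * b)%N.
Proof.
case: a => [|[|a]]//; case: b => [|[|b]]// _ _.
by rewrite !mulSn addnC leq_add2l -[a.+2]add2n leq_add// leq_pmulr.
Qed.

Lemma net_card_le (d N : nat) : (1 < N)%N ->
  (2 * #|{: {ffun 'I_d.+1 -> 'I_(2 * N).+1 * 'I_(2 * N).+1} * 'I_(3 * N + 2 * E d + 4)}| <=
   N ^ net_exponent d)%N.
Proof.
move=> N1; rewrite card_prod card_ffun card_prod !card_ord.
have N0 : (0 < N)%N by exact: ltnW.
have h1 : ((2 * N).+1 <= N ^ 3)%N.
  have : (2 * 2 * N <= N ^ 3)%N by rewrite expnS mulnC expnS expn1 leq_mul2l leq_mul ?orbT.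
  by apply: leq_trans; rewrite -mulnA [X in (_ <= X)%N]mul2n -addnn -addn1 leq_add2l muln_gt0.
have g k : (0 < k)%N -> (1 < N ^ k)%N by move=> k0; rewrite -{1}(exp1n k) ltn_exp2r.
have h2 : (3 * N + 2 * E d + 4 <= N ^ (2 * E d + 7))%N.
  have -> : (2 * E d + 7 = 3 + (2 * E d + 4))%N by rewrite addnCA.
  have e0 : (0 < 2 * E d + 4)%N by rewrite addnS.
  rewrite -addnA expnD; apply: leq_trans (leq_add_mul _ _).
  - rewrite leq_add//; last by rewrite (leq_trans (pow2_ge _))// leq_exp2r.
    by rewrite expnSr leq_mul2r -mulnn (leq_trans _ (leq_mul N1 N1)) ?orbT.
  - exact: g.
  - exact: g.
have h3 : ((2 * N).+1 * (2 * N).+1 <= N ^ 6)%N by rewrite (expnD N 3 3) leq_mul.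
have h4 : (((2 * N).+1 * (2 * N).+1) ^ d.+1 <= N ^ (6 * d.+1))%N by rewrite expnM leq_exp2r.
have -> : net_exponent d = (1 + (6 * d.+1 + (2 * E d + 7)))%N.
  by rewrite /net_exponent add1n -!addnS.
rewrite expnD expn1 expnD leq_mul// leq_mul//.
Qed.

(** With [y = ln x], the root is the square of [expR (y / 4)], which is at least [(1 + y / 4)^2],
    and this is at least [y] by the inequality of means. *)
Lemma ln_le_sqrt (x : R) : 0 < x -> ln x <= Num.sqrt x.
Proof.
move=> x0; set y := ln x.
have [yn|y0] := leP y 0; first by rewrite (le_trans yn)// sqrtr_ge0.
have xE : x = expR (y / 4) ^+ 4.
  by rewrite -expRM_natl mulrCA divff// mulr1 lnK.
have h : 1 + y / 4 <= expR (y / 4) := expR_ge1Dx _.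
have -> : Num.sqrt x = expR (y / 4) ^+ 2.
  rewrite xE (exprM _ 2 2) sqrtr_sqr ger0_norm// sqr_ge0//.
have h2 : (1 + y / 4) ^+ 2 <= expR (y / 4) ^+ 2.
  by rewrite lerXn2r ?nnegrE ?expR_ge0// addr_ge0// divr_ge0// ltW.
have := sqr_ge0 (y / 4 - 1); move: h2; move: (expR _ ^+ 2) => e; lra.
Qed.

Lemma ln2_ge : 2^-1 <= ln (2 : R).
Proof.
have := @expR_ge1Dx R (- ln 2); rewrite expRN lnK ?posrE//; lra.
Qed.

Lemma powR_expR (N : R) (a : R) : 0 < N -> N `^ a = expR (a * ln N).
Proof. by move=> N0; rewrite /powR gt_eqF. Qed.

(* theta = l / (2 sigma) is the Chernoff parameter for deviations of size a sigma l. *)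
Lemma chernoff_exponent (sigma l a C V : R) : 0 < sigma -> V <= C * sigma ^+ 2 ->
  - (l / (2 * sigma) * (a * sigma * l)) + 2 * (l / (2 * sigma)) ^+ 2 * V <=
  - ((a - C) / 2 * l ^+ 2).
Proof.
move=> s0 hV; have sn : sigma != 0 by rewrite gt_eqF.
apply: (@le_trans _ _ (- (l / (2 * sigma) * (a * sigma * l)) +
    2 * (l / (2 * sigma)) ^+ 2 * (C * sigma ^+ 2))).
  by rewrite lerD2l ler_wpM2l// mulr_ge0// sqr_ge0.
by rewrite le_eqVlt; apply/orP; left; apply/eqP; field.
Qed.

End union_bound_constants.

Theorem corollary1p7 (R : realType) (d : nat) (hd : (1 <= d)%N)
    (M : R) (hM : 0 < M) :
  exists2 C : R, 0 < C &
    forall (L : nat), (1 <= L)%N ->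
    forall (dO : measure_display) (Omega : measurableType dO)
      (P : probability Omega R) (X : Omega -> {fset CP R d}),
    projective_ensemble L P X ->
    let N : R := 'C(d + L, d)%:R in
    ((1 - N `^ (- M))%:E <=
     P [set w | discrepancy (X w) <=
          (C * Num.sqrt (N `^ (1 - (2 * d)%:R^-1)) * Num.sqrt (ln N))%:E])%E.
Proof.
(* The factor 64 joins 32 from [integral_lorentzian] to 2 from [bin_power_le]; [1 + 2 d] comes from
   [integral_weighted_kernel]. Then [a] is chosen so that [(a - C1) / 2 = M + kappa], with [kappa]
   covering the size of the net. *)
pose C1 : R := 64 * d%:R * (1 + 2 * d%:R).
pose kappa : R := (net_exponent d)%:R.
pose a : R := C1 + 2 * (M + kappa).
pose slack : R := @net_slack R d.
have C10 : 0 <= C1 by rewrite !mulr_ge0// addr_ge0.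
have kappa0 : 0 <= kappa by exact: ler0n.
have slack0 : 0 <= slack by exact: ler0n.
have a0 : 0 < a by rewrite ltr_wpDl// mulr_gt0// ltr_wpDr.
(* The net costs the additive constant [slack], absorbed as [2 * slack * (sigma * l)] because
   [sigma * l >= 2^-1]. *)
exists (a + 2 * slack); first by rewrite ltr_wpDr// mulr_ge0.
move=> L hL dO Omega P X hX; cbv zeta.
have [hX1 _] := hX.
set n := 'C(d + L, d) in hX1 *.
set N : R := n%:R.
have n1 : (1 < n)%N by exact: bin_gt1.
have n0 : (0 < n)%N := ltnW n1.
have N1 : 1 <= N by rewrite ler1n.
have N0 : 0 < N by rewrite ltr0n.
set e : R := 1 - (2 * d)%:R^-1.
have e12 : 2^-1 <= e.
  have : (2 * d)%:R^-1 <= 2^-1 :> R by rewrite lef_pV2 ?posrE ?ltr0n ?muln_gt0// (ler_nat R 2) leq_pmulr.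
  by rewrite /e; lra.
set sigma := Num.sqrt (N `^ e); set l := Num.sqrt (ln N).
have Ne0 : 0 < N `^ e by rewrite powR_gt0.
have sigma0 : 0 < sigma by rewrite sqrtr_gt0.
have sigma2 : sigma ^+ 2 = N `^ e by rewrite sqr_sqrtr// ltW.
have lnN : 4^-1 <= ln N.
  apply: (@le_trans _ _ (ln 2)); first by have := @ln2_ge R; lra.
  by rewrite ler_ln ?posrE// (ler_nat R 2).
have l2 : l ^+ 2 = ln N by rewrite sqr_sqrtr// (le_trans _ lnN)// invr_ge0.
have l12 : 2^-1 <= l.
  have -> : 2^-1 = Num.sqrt (4^-1) :> R.
    rewrite -[LHS]ger0_norm ?invr_ge0// -sqrtr_sqr; congr Num.sqrt; lra.
  by rewrite ler_wsqrtr.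
(* This keeps [theta] below [2^-1]. It rests on [e >= 2^-1], which gives [ln N <= sqrt N <= N^e]. *)
have ls : l <= sigma.
  rewrite ler_wsqrtr// (le_trans (ln_le_sqrt N0))// -powR12_sqrt ?(ltW N0)//.
  by rewrite ler_powR.
have sigma1 : 1 <= sigma.
  by rewrite -[1]sqrtr1 ler_wsqrtr// -(powRr0 N) ler_powR// (le_trans _ e12)// invr_ge0.
pose theta := l / (2 * sigma).
have l0 : 0 <= l by exact: sqrtr_ge0.
have theta01 : 0 <= theta <= 2^-1.
  rewrite divr_ge0 ?mulr_ge0 ?(ltW sigma0)//= ler_pdivrMr ?mulr_gt0//.
  by rewrite mulrA mulVf// mul1r.
have V : @variance_bound R d L <= C1 * sigma ^+ 2.
  rewrite sigma2; have := bin_power_le R hd hL; rewrite -/n -/N -/e => h.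
  have -> : @variance_bound R d L = 32 * d%:R * (1 + 2 * d%:R) * (N / Num.sqrt L%:R).
    by rewrite /variance_bound -/n -/N; move: (_^-1) => u; ring.
  apply: le_trans (ler_wpM2l _ h) _; first by rewrite !mulr_ge0// addr_ge0.
  by rewrite /C1 le_eqVlt; apply/orP; left; apply/eqP; ring.
pose s0 := a * sigma * l.
have tail := chernoff_exponent l a sigma0 V.
pose tau : R := 2 * expR (- ((M + kappa) * ln N)).
(* The mesh is N itself, so that N points times a volume error of order [1 / N] stay bounded while
   the net remains polynomial in N. *)
pose I := ({ffun 'I_d.+1 -> 'I_(2 * n).+1 * 'I_(2 * n).+1} * 'I_(3 * n + 2 * net_width d + 4))%type.
pose F (i : I) := good_event X s0 i.
have mF i : measurable (F i) by exact: (measurable_good_event hX1).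
have hF i : (P (~` F i) <= tau%:E)%E.
  have [p [c ei]] : exists (p : CP R d) c, net_set i.1 i.2 = [set q | c < ov p q] := net_set_ov i.1 i.2.
  have -> : ~` F i = [set w | s0 < `|(count_in (X w) [set q | c < ov p q])%:R - n%:R * fine (vol R d [set q | c < ov p q])|].
    apply/seteqP; split => w; rewrite /F /good_event /count_dev /= ei (hX1.1 w).
      by move/negP; rewrite -ltNge.
    by move=> h; apply/negP; rewrite -ltNge.
  apply: le_trans (deviation_tail hd hL hX p c s0 theta01) _.
  rewrite lee_fin; apply: ler_wpM2l; first exact: ler0n.
  rewrite ler_expR; apply: le_trans tail _; rewrite lerN2 l2.
  have -> : (a - C1) / 2 = M + kappa by rewrite /a addrAC subrr add0r mulrC mulrA mulVf ?mul1r.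
  by [].
have good := probability_forall_ge mF hF.
apply: (@le_trans _ _ (1 - #|{: I}|%:R * tau)%:E).
  rewrite lee_fin lerD2l lerN2 powR_expR//.
  have -> : #|{: I}|%:R * tau = (2 * #|{: I}|)%:R * expR (- ((M + kappa) * ln N)).
    by rewrite /tau natrM; move: (expR _) (#|_|%:R) => u v; ring.
  (* The union bound multiplies each tail [N^(- (M + kappa))] by at most [N^kappa], leaving
     [N^(- M)]. *)
  have -> : expR (- M * ln N) = N ^+ net_exponent d * expR (- ((M + kappa) * ln N)).
    rewrite -[in N ^+ _](lnK N0) -expRM_natl -expRD; congr expR; rewrite /kappa; ring.
  rewrite ler_wpM2r ?expR_ge0// -natrX ler_nat.
  exact: net_card_le.
apply: le_trans good _; apply: le_measure; rewrite ?inE.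
- by apply: fin_bigcap_measurable => [|i _]; [exact: finite_finset|exact: mF].
- exact: (measurable_discrepancy_event hd hX1).
move=> w h /=; apply/(discrepancy_leP) => A mA.
apply: le_trans (@net_dev R d hd (X w) n s0 n0 _ A mA) _.
  by move=> f k; exact: (h (f, k) Logic.I).
rewrite (hX1.1 w) mulrCA divff ?mulr1; last by rewrite pnatr_eq0 -lt0n.
rewrite /s0 -/slack !mulrDl lerD2l.
have : 2^-1 <= sigma * l by rewrite -[2^-1]mul1r ler_pM// invr_ge0.
move: slack0; rewrite -mulrA; move: slack (sigma * l) => u v; nra.
Qed.
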